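(* Let $\Gamma_s:\mathbb{S}^1\to\mathbb{R}^2$, $s\in[0,1]$, be a regular homotopy in the class of generic immersions, i.e. a smooth family of closed oriented plane curves such that $\Gamma_s$ is a generic immersion for every $s\in[0,1]$. Then $$I_q(\Gamma_0)=I_q(\Gamma_1),$$ where for a generic immersion $\Gamma$ with set of double points $X$ $$I_q(\Gamma)=\frac{1}{2\pi}\left(\int_{\mathbb{S}^1}\kappa(t)\,q^{\operatorname{ind}_\Gamma(\Gamma(t))}\,dt-\sum_{d\in X}\theta_d\,q^{\operatorname{ind}_\Gamma(d)}\bigl(q^{\frac12}-q^{-\frac12}\bigr)\right)\in\mathbb{R}[q^{\frac12},q^{-\frac12}].$$ In other words, $I_q(\Gamma)$ is invariant under regular homotopies of $\Gamma$ in the class of generic immersions.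
   Context: A closed oriented immersed plane curve is a smooth immersion $\Gamma:\mathbb{S}^1\to\mathbb{R}^2$. It is generic if its only singularities are a finite set $X$ of transversal double points. $\kappa$ denotes the signed curvature of $\Gamma$ (positive for a counterclockwise circle), and $\int_{\mathbb{S}^1}\kappa(t)(\cdot)\,dt$ is integration with respect to arclength along $\Gamma$. Index: for $p\in\mathbb{R}^2\setminus\Gamma$, $\operatorname{ind}_\Gamma(p)$ is the number of (counterclockwise) turns made by the vector pointing from $p$ to $\Gamma(t)$ as one follows $\Gamma$ along its orientation. For generic $\Gamma$ it is extended to a $\frac12\mathbb{Z}$-valued function on $\mathbb{R}^2$: if $p\in\Gamma$, then $\operatorname{ind}_\Gamma(p)$ is the average of the values of the index on the regions of $\mathbb{R}^2\setminus\Gamma$ locally adjacent to $p$ (two local regions if $p$ is a regular point of $\Gamma$, four local regions, counted with multiplicity, if $p$ is a double point). For each double point $d=\Gamma(t_1)=\Gamma(t_2)\in X$ ($t_1\ne t_2$), $\theta_d\in(0,\pi)$ is the non-oriented angle between the vectors $\Gamma'(t_1)$ and $-\Gamma'(t_2)$. $q^{\frac12}$ is a formal variable. *)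

(* Defs.v *)
From Stdlib Require Export Reals ZArith List ClassicalEpsilon.
From Coquelicot Require Export Coquelicot.
Open Scope R_scope.

Definition point : Type := (R * R)%type.

Definition psub (a b : point) : point := (fst a - fst b, snd a - snd b).
Definition popp (a : point) : point := (- fst a, - snd a).
Definition dot (a b : point) : R := fst a * fst b + snd a * snd b.
Definition cross (a b : point) : R := fst a * snd b - snd a * fst b.
Definition norm2 (a : point) : R := sqrt (dot a a).
Definition dist2 (a b : point) : R := norm2 (psub a b).

(* Non-oriented angle, in [0, PI], between two nonzero vectors. *)
Definition angle (a b : point) : R := acos (dot a b / (norm2 a * norm2 b)).

(* The circle is R/Z: a closed curve is a 1-periodic map on R, with
   fundamental domain [0,1). *)
Definition curve : Type := R -> point.

Definition vel (g : curve) (t : R) : point :=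
  (Derive (fun u => fst (g u)) t, Derive (fun u => snd (g u)) t).
Definition acc (g : curve) (t : R) : point :=
  (Derive_n (fun u => fst (g u)) 2 t, Derive_n (fun u => snd (g u)) 2 t).
Definition speed (g : curve) (t : R) : R := norm2 (vel g t).
Definition curvature (g : curve) (t : R) : R :=
  cross (vel g t) (acc g t) / speed g t ^ 3.

Definition closed_immersion (g : curve) : Prop :=
  (forall t, g (t + 1) = g t) /\
  (forall n t, ex_derive_n (fun u => fst (g u)) n t /\
               ex_derive_n (fun u => snd (g u)) n t) /\
  (forall t, vel g t <> (0, 0)).

Definition double_pair (g : curve) (d : point) (t1 t2 : R) : Prop :=
  0 <= t1 < 1 /\ 0 <= t2 < 1 /\ t1 <> t2 /\ g t1 = d /\ g t2 = d.

Definition double_point (g : curve) (d : point) : Prop :=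
  exists t1 t2, double_pair g d t1 t2.

Definition generic_immersion (g : curve) : Prop :=
  closed_immersion g /\
  (exists l : list point, forall d, double_point g d -> In d l) /\
  (forall t1 t2 t3, 0 <= t1 < 1 -> 0 <= t2 < 1 -> 0 <= t3 < 1 ->
     g t1 = g t2 -> g t2 = g t3 -> t1 = t2 \/ t2 = t3 \/ t1 = t3) /\
  (forall d t1 t2, double_pair g d t1 t2 -> cross (vel g t1) (vel g t2) <> 0).

Definition off_curve (g : curve) (p : point) : Prop := forall t, g t <> p.

(* The vector from p to g makes k counterclockwise turns: total variation
   over one period of a continuous determination of its argument. *)
Definition is_index (g : curve) (p : point) (k : Z) : Prop :=
  exists th : R -> R,
    (forall t, continuous th t) /\
    (forall t, psub (g t) p =
       (norm2 (psub (g t) p) * cos (th t), norm2 (psub (g t) p) * sin (th t))) /\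
    th 1 - th 0 = 2 * PI * IZR k.

Definition index (g : curve) (p : point) : Z :=
  epsilon (inhabits 0%Z) (is_index g p).

(* a and b lie in the same connected component of B(p,r) minus the curve;
   for this open set, connected components are path components. *)
Definition joined (g : curve) (p : point) (r : R) (a b : point) : Prop :=
  exists c : R -> point,
    (forall u, continuous (fun v => fst (c v)) u /\
               continuous (fun v => snd (c v)) u) /\
    c 0 = a /\ c 1 = b /\
    (forall u, 0 <= u <= 1 -> dist2 p (c u) < r /\ off_curve g (c u)).

(* a lies in a component of B(p,r) minus the curve having p in its closure. *)
Definition adjacent (g : curve) (p : point) (r : R) (a : point) : Prop :=
  forall eps, 0 < eps -> exists b, dist2 p b < eps /\ joined g p r a b.

(* l consists of exactly one representative of each such component. *)
Definition local_regions (g : curve) (p : point) (r : R) (l : list point) : Prop :=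
  List.Forall (adjacent g p r) l /\
  ForallOrdPairs (fun a b => ~ joined g p r a b) l /\
  (forall a, adjacent g p r a -> exists b, In b l /\ joined g p r a b).

Definition sum_list {A : Type} (f : A -> R) (l : list A) : R :=
  fold_right Rplus 0 (map f l).

(* Average of the index over the local regions at p, for all small radii.
   There are two of them at a regular point of a generic curve and four at a
   double point. Two local regions belonging to the same global region are
   counted separately. Off the curve there is one, and the value is the index. *)
Definition is_ext_index (g : curve) (p : point) (v : R) : Prop :=
  exists r0, 0 < r0 /\ forall r, 0 < r < r0 ->
    exists l, local_regions g p r l /\
      v = sum_list (fun a => IZR (index g a)) l / INR (length l).

Definition ext_index (g : curve) (p : point) : R :=
  epsilon (inhabits 0) (is_ext_index g p).

Definition double_points (g : curve) : list point :=
  epsilon (inhabits nil)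
    (fun l => NoDup l /\ forall d, In d l <-> double_point g d).

Definition is_theta (g : curve) (d : point) (x : R) : Prop :=
  exists t1 t2, double_pair g d t1 t2 /\ x = angle (vel g t1) (popp (vel g t2)).

Definition theta (g : curve) (d : point) : R :=
  epsilon (inhabits 0) (is_theta g d).

(* A formal expression in the powers of q^(1/2) is given by its coefficients:
   f n is the coefficient of q^(n/2). *)
Definition formal : Type := Z -> R.

Definition is_laurent (f : formal) : Prop :=
  exists N : Z, forall n : Z, (N < Z.abs n)%Z -> f n = 0.

(* q^v, for v a half-integer. *)
Definition qpow (v : R) : formal :=
  fun n => if Req_EM_T (IZR n / 2) v then 1 else 0.

Definition fsub (f h : formal) : formal := fun n => f n - h n.
Definition fscal (a : R) (f : formal) : formal := fun n => a * f n.
Definition fsum {A : Type} (l : list A) (f : A -> formal) : formal :=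
  fun n => sum_list (fun a => f a n) l.
Definition fint (f : R -> formal) (a b : R) : formal :=
  fun n => RInt (fun t => f t n) a b.
(* Product of f and q^(k/2). *)
Definition fshift (k : Z) (f : formal) : formal := fun n => f (n - k)%Z.
(* Product of f and q^(1/2) - q^(-1/2). *)
Definition fdiff (f : formal) : formal := fsub (fshift 1 f) (fshift (-1) f).

(* The factor speed g t turns dt into the arclength element. *)
Definition Iq (g : curve) : formal :=
  fscal (/ (2 * PI))
    (fsub
       (fint (fun t => fscal (curvature g t * speed g t)
                             (qpow (ext_index g (g t)))) 0 1)
       (fsum (double_points g)
             (fun d => fscal (theta g d) (fdiff (qpow (ext_index g d)))))).

(* Smoothness on the closed strip [0,1] x R, in the usual sense: restriction
   of a smooth map on the plane. *)
Definition smooth_family (G : R -> curve) : Prop :=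
  exists X Y : R -> R -> R,
    (forall n s t, ex_diff_n X n s t /\ ex_diff_n Y n s t) /\
    (forall s t, 0 <= s <= 1 -> G s t = (X s t, Y s t)).

Definition generic_regular_homotopy (G : R -> curve) : Prop :=
  smooth_family G /\ forall s, 0 <= s <= 1 -> generic_immersion (G s).

(* Main.v *)
Require Import Defs.
From Stdlib Require Import Lra Lia Psatz Permutation FunctionalExtensionality.

(** For one generic curve, integrate [kappa q^ind] by parts. Along the curve the index
    changes only at the double points, and near a double point [d] of index [i] the
    strand crossing the other one from left to right goes from [i + 1/2] to [i - 1/2]
    while the other goes from [i - 1/2] to [i + 1/2]. So, with [phi] a continuous
    argument of the velocity, [2 pi I_q] is the rotation of the curve times
    [q^ind] at a base point, minus the sum over the double points of
    [(theta_d + phi(t2) - phi(t1)) q^i (q^(1/2) - q^(-1/2))], and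
    [theta_d + phi(t2) - phi(t1)] lies in [pi + 2 pi Z]. In a generic homotopy the double
    points move continuously without meeting, being born or dying; the indices are
    locally constant, and the angular quantities are continuous with discrete values.
    Hence every term is locally constant in the parameter. *)

(* [ring] and [field] do not see through the carrier of Coquelicot's [R_NormedModule]. *)
Ltac eqR := match goal with |- @eq _ ?x ?y => change (@eq R x y) end.

(** The quantities [index], [ext_index], [double_points] and [theta] are picked by [epsilon], so
    each must first be shown to have a determined value; for [ext_index] this means exhibiting the
    local regions explicitly, as sectors cut out by one or two strands. Integer turning numbers are
    compared by a dog-on-a-leash argument: if the dot product of two moving vectors stays positive,
    their arguments vary by amounts differing by less than PI. Local geometry rests on strict
    differentiability, with an error proportional to the increment and uniform in the homotopy
    parameter. It gives strands, local injectivity and uniqueness of nearby double points without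
    the implicit function theorem; existence of nearby double points comes from the index, whose
    drop across a double time survives a small deformation. The value of
    [theta_d + phi(t2) - phi(t1)] has a simple reason: reversing the second velocity replaces the
    rotation from the first velocity to the second, taken in (0, PI), by its supplement. *)

(** * Vectors in the plane *)

Definition padd (a b : point) : point := (fst a + fst b, snd a + snd b).
Definition pscal (k : R) (a : point) : point := (k * fst a, k * snd a).

Ltac plane :=
  repeat match goal with p : point |- _ => destruct p end;
  unfold dist2, psub, padd, pscal, popp, dot, cross in *; simpl in *.

Lemma dot_self_ge0 (a : point) : 0 <= dot a a.
Proof. plane; nra. Qed.

Lemma norm2_ge0 (a : point) : 0 <= norm2 a.
Proof. apply sqrt_pos. Qed.

Lemma norm2_sq (a : point) : norm2 a * norm2 a = dot a a.
Proof. apply sqrt_sqrt, dot_self_ge0. Qed.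

Lemma norm2_pos (a : point) : a <> (0, 0) -> 0 < norm2 a.
Proof.
  intros Ha. apply sqrt_lt_R0. destruct a as [x y]; unfold dot; simpl.
  destruct (Req_dec x 0) as [->|Hx]; [|nra].
  destruct (Req_dec y 0) as [->|Hy]; [|nra]. now elim Ha.
Qed.

Lemma norm2_zero : norm2 (0, 0) = 0.
Proof. unfold norm2, dot; simpl. replace (0 * 0 + 0 * 0) with 0 by ring. apply sqrt_0. Qed.

Lemma norm2_eq0 (a : point) : norm2 a = 0 -> a = (0, 0).
Proof.
  intros H. destruct (classic (a = (0, 0))) as [|n]; auto.
  apply norm2_pos in n; lra.
Qed.

(** Lagrange's identity. It bounds both products, and it shows that a vector both parallel and
    orthogonal to a nonzero one vanishes. *)
Lemma lagrange (a b : point) :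
  dot a b * dot a b + cross a b * cross a b
  = (norm2 a * norm2 b) * (norm2 a * norm2 b).
Proof.
  transitivity ((norm2 a * norm2 a) * (norm2 b * norm2 b)); [|ring].
  rewrite !norm2_sq. plane; ring.
Qed.

Lemma dot_le (a b : point) : Rabs (dot a b) <= norm2 a * norm2 b.
Proof.
  rewrite <- (Rabs_pos_eq (norm2 a * norm2 b));
    [|apply Rmult_le_pos; apply norm2_ge0].
  apply Rsqr_le_abs_0. unfold Rsqr. pose proof (lagrange a b). nra.
Qed.

Lemma cross_le (a b : point) : Rabs (cross a b) <= norm2 a * norm2 b.
Proof.
  rewrite <- (Rabs_pos_eq (norm2 a * norm2 b));
    [|apply Rmult_le_pos; apply norm2_ge0].
  apply Rsqr_le_abs_0. unfold Rsqr. pose proof (lagrange a b). nra.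
Qed.

Lemma norm2_triang (a b : point) : norm2 (padd a b) <= norm2 a + norm2 b.
Proof.
  pose proof (norm2_ge0 a); pose proof (norm2_ge0 b).
  apply Rsqr_incr_0_var; [|lra]. unfold Rsqr.
  pose proof (dot_le a b). pose proof (Rle_abs (dot a b)).
  transitivity (norm2 a * norm2 a + norm2 b * norm2 b + 2 * dot a b); [|nra].
  rewrite !norm2_sq. plane; lra.
Qed.

Lemma norm2_scal (k : R) (a : point) : norm2 (pscal k a) = Rabs k * norm2 a.
Proof.
  unfold norm2. rewrite <- sqrt_Rsqr_abs, <- sqrt_mult;
    [|apply Rle_0_sqr|apply dot_self_ge0].
  f_equal. unfold Rsqr. plane; ring.
Qed.

Lemma norm2_opp (a : point) : norm2 (popp a) = norm2 a.
Proof. unfold norm2; f_equal; plane; ring. Qed.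

Lemma norm2_sub_comm (a b : point) : norm2 (psub a b) = norm2 (psub b a).
Proof. unfold norm2; f_equal; plane; ring. Qed.

Lemma norm2_fst (a : point) : Rabs (fst a) <= norm2 a.
Proof.
  rewrite <- (Rabs_pos_eq (norm2 a)); [|apply norm2_ge0].
  apply Rsqr_le_abs_0. unfold Rsqr. rewrite norm2_sq. plane; nra.
Qed.

Lemma norm2_snd (a : point) : Rabs (snd a) <= norm2 a.
Proof.
  rewrite <- (Rabs_pos_eq (norm2 a)); [|apply norm2_ge0].
  apply Rsqr_le_abs_0. unfold Rsqr. rewrite norm2_sq. plane; nra.
Qed.

Lemma norm2_le_sum (a : point) : norm2 a <= Rabs (fst a) + Rabs (snd a).
Proof.
  pose proof (Rabs_pos (fst a)); pose proof (Rabs_pos (snd a)).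
  apply Rsqr_incr_0_var; [|lra]. unfold Rsqr. rewrite norm2_sq.
  pose proof (Rsqr_abs (fst a)); pose proof (Rsqr_abs (snd a)).
  unfold Rsqr, dot in *. nra.
Qed.

Lemma dist2_sym (a b : point) : dist2 a b = dist2 b a.
Proof. apply norm2_sub_comm. Qed.

Lemma dist2_refl (a : point) : dist2 a a = 0.
Proof.
  unfold dist2. replace (psub a a) with ((0, 0) : point); [apply norm2_zero|].
  plane; f_equal; ring.
Qed.

Lemma dist2_triang (a b c : point) : dist2 a c <= dist2 a b + dist2 b c.
Proof.
  unfold dist2. replace (psub a c) with (padd (psub a b) (psub b c));
    [apply norm2_triang|]. plane; f_equal; ring.
Qed.

Lemma padd_psub (a b : point) : padd b (psub a b) = a.
Proof. plane; f_equal; ring. Qed.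

(** * The line *)

(** Connectedness of the segment, by the supremum of the points up to which [f] keeps the value
    [f a]. The target is any type because it will be integers, booleans, reals and formal
    expressions. *)
Lemma loc_const {T : Type} (f : R -> T) (a b : R) :
  a <= b ->
  (forall x, a <= x <= b -> exists d, 0 < d /\
     forall y, a <= y <= b -> Rabs (y - x) < d -> f y = f x) ->
  f b = f a.
Proof.
  intros Hab H.
  set (E := fun x => a <= x <= b /\ forall y, a <= y <= x -> f y = f a).
  destruct (completeness E) as [m [Hm1 Hm2]].
  - exists b. intros x [Hx _]; lra.
  - exists a. split; [lra|]. intros y Hy. f_equal; lra.
  - assert (Ea : E a) by (split; [lra|]; intros y Hy; f_equal; lra).
    assert (am : a <= m) by (apply Hm1, Ea).
    assert (mb : m <= b) by (apply Hm2; intros x [Hx _]; lra).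
    destruct (H m (conj am mb)) as [d [d0 Hd]].
    (* Otherwise [m - d] would already bound [E]. *)
    assert (Hex : exists x, E x /\ m - d < x).
    { destruct (classic (exists x, E x /\ m - d < x)) as [|N]; auto.
      assert (m <= m - d); [|lra]. apply Hm2. intros x Ex.
      destruct (Rle_dec x (m - d)); auto. elim N. exists x; split; auto; lra. }
    destruct Hex as [x [Ex xm]]. pose proof (Hm1 _ Ex) as xm'.
    assert (fm : f m = f a).
    { transitivity (f x).
      - symmetry. destruct Ex as [Ex _]. apply Hd; [lra|apply Rabs_def1; lra].
      - destruct Ex as [Ex1 Ex2]. apply Ex2; lra. }
    assert (Hall : forall y, a <= y <= b -> y < m + d -> f y = f a).
    { intros y Hy yd. destruct (Rle_dec y x) as [yx|yx].
      - apply Ex; lra.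
      - rewrite <- fm. apply Hd; [lra|apply Rabs_def1; lra]. }
    destruct (Rle_dec b (m + d / 2)) as [B|B]; [apply Hall; lra|].
    assert (E (m + d / 2)).
    { split; [lra|]. intros y Hy. apply Hall; lra. }
    apply Hm1 in H0; lra.
Qed.

Lemma loc_const_between {T : Type} (f : R -> T) (a b x y : R) :
  (forall x, a <= x <= b -> exists d, 0 < d /\
     forall y, a <= y <= b -> Rabs (y - x) < d -> f y = f x) ->
  a <= x <= b -> a <= y <= b -> f x = f y.
Proof.
  intros H Hx Hy.
  assert (H' : forall z, a <= z <= b -> f z = f a); [|now rewrite (H' x), (H' y)].
  intros z Hz. apply loc_const; [lra|]. intros w Hw.
  destruct (H w) as [d [d0 Hd]]; [lra|]. exists d; split; auto.
  intros v Hv. apply Hd; lra.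
Qed.

(** Meant for functions with exceptional values at isolated points, such as the index, which is an
    average at a double point. The function [h] of the punctured limits is locally constant in the
    plain sense, and agrees with [f] wherever [f] itself is locally constant. *)
Lemma loc_const_punctured {T : Type} (f : R -> T) (a b x y : R) :
  (forall x, a <= x <= b -> exists d c, 0 < d /\
     forall y, 0 < Rabs (y - x) < d -> f y = c) ->
  (exists d, 0 < d /\ forall z, Rabs (z - x) < d -> f z = f x) ->
  (exists d, 0 < d /\ forall z, Rabs (z - y) < d -> f z = f y) ->
  a <= x <= b -> a <= y <= b -> f x = f y.
Proof.
  intros H Gx Gy Hx Hy.
  set (P := fun x c => exists d, 0 < d /\ forall y, 0 < Rabs (y - x) < d -> f y = c).
  assert (Puniq : forall x c c', P x c -> P x c' -> c = c').
  { intros z c c' [d [d0 Hd]] [d' [d'0 Hd']].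
    set (m := Rmin d d'). assert (0 < m) by (apply Rmin_glb_lt; auto).
    assert (m <= d) by apply Rmin_l. assert (m <= d') by apply Rmin_r.
    assert (R : Rabs (z + m / 2 - z) = m / 2)
      by (replace (z + m / 2 - z) with (m / 2) by ring; apply Rabs_pos_eq; lra).
    rewrite <- (Hd (z + m / 2)) by (rewrite R; lra).
    apply Hd'; rewrite R; lra. }
  set (h := fun x => epsilon (inhabits (f x)) (P x)).
  assert (Ph : forall x, a <= x <= b -> P x (h x)).
  { intros z Hz. apply epsilon_spec. destruct (H z Hz) as [d [c [d0 Hd]]].
    exists c, d; auto. }
  assert (good : forall x, a <= x <= b ->
    (exists d, 0 < d /\ forall z, Rabs (z - x) < d -> f z = f x) -> h x = f x).
  { intros z Hz [d [d0 Hd]]. apply (Puniq z); [apply Ph, Hz|].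
    exists d; split; auto. intros w Hw; apply Hd, Hw. }
  rewrite <- (good x), <- (good y); auto.
  apply (loc_const_between h a b); auto.
  intros z Hz. destruct (Ph z Hz) as [d [d0 Hd]]. exists d; split; auto.
  intros w Hw wz. destruct (Req_dec w z) as [->|ne]; auto.
  apply (Puniq w); [apply Ph, Hw|].
  assert (wz' : 0 < Rabs (w - z)) by (apply Rabs_pos_lt; lra).
  (* This radius keeps the neighbourhood of [w] away from [z] but within the punctured neighbourhood
     of [z]. *)
  exists (Rmin (Rabs (w - z)) (d - Rabs (w - z))); split.
  { apply Rmin_glb_lt; lra. }
  intros v [Hv1 Hv2]. apply Hd.
  pose proof (Rmin_l (Rabs (w - z)) (d - Rabs (w - z))).
  pose proof (Rmin_r (Rabs (w - z)) (d - Rabs (w - z))).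
  split.
  - apply Rabs_pos_lt. intros E. replace z with v in * by lra.
    rewrite Rabs_minus_sym in wz', H0, Hv2. rewrite (Rabs_minus_sym w v) in Hv2. lra.
  - replace (v - z) with ((v - w) + (w - z)) by ring.
    eapply Rle_lt_trans; [apply Rabs_triang|]. lra.
Qed.

(** The tube lemma over the compact segment of the [u]. [N d z] reads: the parameter [z] is within
    [d] of a fixed centre. Keeping [N] abstract lets [z] be one real or a tuple of them. *)
Lemma tube {Z : Type} (N : R -> Z -> Prop) (Q : Z -> R -> Prop) (a b : R) :
  (forall d d' z, d <= d' -> N d z -> N d' z) ->
  (forall u0, a <= u0 <= b -> exists d, 0 < d /\
     forall z u, N d z -> Rabs (u - u0) < d -> Q z u) ->
  exists d, 0 < d /\ forall z u, N d z -> a <= u <= b -> Q z u.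
Proof.
  intros mono H.
  set (P := fun u0 (d : posreal) => a <= u0 <= b ->
     forall z u, N d z -> Rabs (u - u0) < d -> Q z u).
  set (delta := fun u0 => epsilon (inhabits (mkposreal 1 Rlt_0_1)) (P u0)).
  assert (Hd : forall u0, P u0 (delta u0)).
  { intros u0. apply epsilon_spec.
    destruct (classic (a <= u0 <= b)) as [I|I].
    - destruct (H u0 I) as [d [d0 Hd]]. exists (mkposreal d d0). intros _. exact Hd.
    - exists (mkposreal 1 Rlt_0_1). intros I'; contradiction. }
  destruct (compactness_value_1d a b delta) as [d Hc].
  exists d; split; [apply cond_pos|]. intros z u Nz Hu.
  (* The covering supplied by compactness is doubly negated, so [Q z u] is decided classically
     first. *)
  destruct (classic (Q z u)) as [|NQ]; auto.
  elim (Hc u Hu). intros [t [Ht [ut dt]]]. apply NQ.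
  apply (Hd t Ht); auto. eapply mono; eauto.
Qed.

(** * Continuous determinations of the argument *)

Lemma IZR_small (k : Z) : Rabs (IZR k) < 1 -> k = 0%Z.
Proof.
  intros H. apply Rabs_def2 in H as [H1 H2].
  apply (lt_IZR k 1) in H1. apply (lt_IZR (-1) k) in H2. lia.
Qed.

Lemma two_PI_Z_eq (k l : Z) :
  Rabs (2 * PI * IZR k - 2 * PI * IZR l) < 2 * PI -> k = l.
Proof.
  intros H. pose proof PI_RGT_0. assert (k - l = 0)%Z; [|lia].
  apply IZR_small. rewrite minus_IZR.
  replace (2 * PI * IZR k - 2 * PI * IZR l) with (2 * PI * (IZR k - IZR l)) in H by ring.
  rewrite Rabs_mult, (Rabs_pos_eq (2 * PI)) in H by lra. nra.
Qed.

Lemma cos_eq_1 (x : R) : cos x = 1 -> exists k : Z, x = 2 * PI * IZR k.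
Proof.
  intros H. replace x with (2 * (x / 2)) in H by lra.
  rewrite cos_2a_sin in H. assert (S : sin (x / 2) = 0) by nra.
  apply sin_eq_0_0 in S as [k Hk]. exists k. lra.
Qed.

Lemma cos_eq_m1 (x : R) : cos x = -1 -> exists k : Z, x = PI + 2 * PI * IZR k.
Proof.
  intros H. destruct (cos_eq_1 (x - PI)) as [k Hk].
  - rewrite cos_minus, H, cos_PI, sin_PI. ring.
  - exists k. lra.
Qed.

Lemma sin_period_Z (x : R) (k : Z) : sin (x + 2 * PI * IZR k) = sin x.
Proof.
  assert (Hn : forall x n, sin (x + 2 * PI * INR n) = sin x).
  { intros y n. rewrite <- (sin_period y n). f_equal; ring. }
  destruct (Z_le_dec 0 k).
  - rewrite <- (Z2Nat.id k), <- INR_IZR_INZ by lia. apply Hn.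
  - rewrite <- (Hn (x + 2 * PI * IZR k) (Z.to_nat (- k))).
    f_equal. rewrite INR_IZR_INZ, Z2Nat.id, opp_IZR by lia. ring.
Qed.

Lemma cos_period_Z (x : R) (k : Z) : cos (x + 2 * PI * IZR k) = cos x.
Proof.
  rewrite !cos_sin.
  replace (PI / 2 + (x + 2 * PI * IZR k)) with (PI / 2 + x + 2 * PI * IZR k) by ring.
  apply sin_period_Z.
Qed.

Lemma polar (x y : R) : x * x + y * y = 1 -> exists th, x = cos th /\ y = sin th.
Proof.
  intros H. assert (-1 <= x <= 1) by nra.
  assert (S : sqrt (1 - x²) = Rabs y).
  { rewrite <- sqrt_Rsqr_abs. f_equal. unfold Rsqr; lra. }
  destruct (Rle_dec 0 y) as [P|P].
  - exists (acos x). rewrite cos_acos, sin_acos, S, Rabs_pos_eq by lra. auto.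
  - exists (- acos x). rewrite cos_neg, sin_neg, cos_acos, sin_acos, S by lra.
    rewrite Rabs_left by lra. split; ring.
Qed.

Lemma continuous_between (D : R -> R) (a b y : R) :
  (forall t, continuous D t) -> a <= b ->
  Rmin (D a) (D b) <= y <= Rmax (D a) (D b) -> exists t, a <= t <= b /\ D t = y.
Proof.
  intros HD Hab Hy. destruct (IVT_gen_consistent D a b y HD Hy) as [t [Ht E]].
  rewrite Rmin_left, Rmax_right in Ht by lra. exists t; auto.
Qed.

(** By the intermediate value theorem [D] meets no zero of the cosine, and these zeros are spaced by
    PI. *)
Lemma cos_pos_oscillation (D : R -> R) (a b : R) :
  (forall t, continuous D t) -> a <= b ->
  (forall t, a <= t <= b -> 0 < cos (D t)) -> Rabs (D b - D a) < PI.
Proof.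
  intros HD Hab Hc. pose proof PI_RGT_0.
  destruct (Rlt_dec (Rabs (D b - D a)) PI) as [|N]; auto. exfalso.
  set (m := Rmin (D a) (D b)).
  assert (M : Rmax (D a) (D b) = m + Rabs (D b - D a)).
  { unfold m, Rmax, Rmin. destruct (Rle_dec (D a) (D b)).
    - rewrite Rabs_pos_eq; lra.
    - rewrite Rabs_left; lra. }
  (* [IZR k * PI + PI / 2] is the first zero of the cosine strictly above [m], hence at most
     [m + PI]. *)
  set (k := up ((m - PI / 2) / PI)).
  destruct (archimed ((m - PI / 2) / PI)) as [A1 A2]. fold k in A1, A2.
  assert (E : (m - PI / 2) / PI * PI = m - PI / 2) by (field; lra).
  destruct (continuous_between D a b (IZR k * PI + PI / 2)) as [t [Ht Dt]]; auto.
  { fold m. rewrite M. split; nra. }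
  specialize (Hc t Ht). rewrite Dt in Hc.
  rewrite (cos_eq_0_1 (IZR k * PI + PI / 2)) in Hc; [lra|]. now exists k.
Qed.

Definition is_lift (c : R -> point) (th : R -> R) : Prop :=
  (forall t, continuous th t) /\
  (forall t, c t = (norm2 (c t) * cos (th t), norm2 (c t) * sin (th t))).

Lemma lift_dot (c c' : R -> point) (th th' : R -> R) (t t' : R) :
  is_lift c th -> is_lift c' th' ->
  dot (c t) (c' t') = norm2 (c t) * norm2 (c' t') * cos (th t - th' t').
Proof.
  intros [_ H] [_ H']. rewrite cos_minus.
  pattern (c t) at 1; rewrite (H t). pattern (c' t') at 1; rewrite (H' t').
  unfold dot; simpl; ring.
Qed.

Lemma lift_cross (c c' : R -> point) (th th' : R -> R) (t t' : R) :
  is_lift c th -> is_lift c' th' ->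
  cross (c t) (c' t') = norm2 (c t) * norm2 (c' t') * sin (th' t' - th t).
Proof.
  intros [_ H] [_ H']. rewrite sin_minus.
  pattern (c t) at 1; rewrite (H t). pattern (c' t') at 1; rewrite (H' t').
  unfold cross; simpl; ring.
Qed.

Lemma norm2_dot_pos (a b : point) : 0 < dot a b -> 0 < norm2 a * norm2 b.
Proof. intros H. pose proof (dot_le a b). pose proof (Rle_abs (dot a b)). lra. Qed.

(** Dog on a leash: the cosine of the difference of the two arguments stays positive. Both paths are
    followed affinely in a common parameter, so the two intervals of times may differ. *)
Lemma leash (c c' : R -> point) (th th' : R -> R) (a b a' b' : R) :
  is_lift c th -> is_lift c' th' ->
  (forall l, 0 <= l <= 1 -> 0 < dot (c (a + l * (b - a))) (c' (a' + l * (b' - a')))) ->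
  Rabs ((th b - th a) - (th' b' - th' a')) < PI.
Proof.
  intros H H' Hd.
  set (D := fun l => th (a + l * (b - a)) - th' (a' + l * (b' - a'))).
  replace ((th b - th a) - (th' b' - th' a')) with (D 1 - D 0).
  2:{ unfold D. replace (a + 1 * (b - a)) with b by ring.
      replace (a + 0 * (b - a)) with a by ring.
      replace (a' + 1 * (b' - a')) with b' by ring.
      replace (a' + 0 * (b' - a')) with a' by ring. ring. }
  assert (aff : forall u v l, continuous (fun l => u + l * (v - u)) l).
  { intros u v l. apply (ex_derive_continuous (V := R_NormedModule)). auto_derive; auto. }
  apply cos_pos_oscillation; [|lra|].
  - intros l. unfold D. apply (continuous_minus (V := R_NormedModule)).
    + apply (continuous_comp (fun l => a + l * (b - a)) th); [apply aff|apply H].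
    + apply (continuous_comp (fun l => a' + l * (b' - a')) th'); [apply aff|apply H'].
  - intros l Hl. specialize (Hd l Hl).
    pose proof (norm2_dot_pos _ _ Hd) as P.
    rewrite (lift_dot c c' th th' _ _ H H') in Hd. unfold D. nra.
Qed.

(** The argument is the integral of the angular form, started from a polar angle at time 0; its
    derivative comes with it. *)
Lemma lift_exists (x y dx dy : R -> R) :
  (forall t, is_derive x t (dx t)) -> (forall t, is_derive y t (dy t)) ->
  (forall t, continuous dx t) -> (forall t, continuous dy t) ->
  (forall t, (x t, y t) <> (0, 0)) ->
  exists th, is_lift (fun t => (x t, y t)) th /\
    forall t, is_derive th t
      ((x t * dy t - y t * dx t) / (x t * x t + y t * y t)).
Proof.
  intros Hx Hy Cdx Cdy nz.
  assert (Npos : forall t, 0 < x t * x t + y t * y t).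
  { intros t. pose proof (norm2_pos _ (nz t)) as P.
    pose proof (norm2_sq (x t, y t)) as S. unfold dot in S; simpl in S. nra. }
  assert (Cx : forall t, continuous x t)
    by (intros t; apply (ex_derive_continuous (V := R_NormedModule)); eexists; apply Hx).
  assert (Cy : forall t, continuous y t)
    by (intros t; apply (ex_derive_continuous (V := R_NormedModule)); eexists; apply Hy).
  set (k := fun t => (x t * dy t - y t * dx t) / (x t * x t + y t * y t)).
  assert (Ck : forall t, continuous k t).
  { intros t. unfold k, Rdiv.
    apply (continuous_mult (K := R_AbsRing)).
    - apply (continuous_minus (V := R_NormedModule));
        apply (continuous_mult (K := R_AbsRing)); auto.
    - apply (continuous_comp (fun t => x t * x t + y t * y t) Rinv).
      + apply (continuous_plus (V := R_NormedModule));
          apply (continuous_mult (K := R_AbsRing)); auto.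
      + apply continuous_Rinv. specialize (Npos t); lra. }
  assert (r0 : 0 < norm2 (x 0, y 0)) by (apply norm2_pos, nz).
  destruct (polar (x 0 / norm2 (x 0, y 0)) (y 0 / norm2 (x 0, y 0))) as [th0 [E1 E2]].
  { pose proof (norm2_sq (x 0, y 0)) as S. unfold dot in S; simpl in S.
    transitivity ((x 0 * x 0 + y 0 * y 0) / (norm2 (x 0, y 0) * norm2 (x 0, y 0)));
      [field; lra|]. rewrite <- S. field; lra. }
  set (th := fun t => th0 + RInt k 0 t).
  assert (Dth : forall t, is_derive th t (k t)).
  { intros t. unfold th. replace (k t) with (0 + k t) by ring.
    apply (is_derive_plus (V := R_NormedModule)); [apply (is_derive_const (V := R_NormedModule))|].
    apply (is_derive_RInt k (RInt k 0) 0 t); [|apply Ck].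
    apply filter_forall. intros b. apply (RInt_correct (V := R_CompleteNormedModule)).
    apply (ex_RInt_continuous (V := R_CompleteNormedModule)). intros z _; apply Ck. }
  assert (th00 : th 0 = th0).
  { unfold th. rewrite RInt_point. unfold zero; simpl; ring. }
  exists th. split; [|exact Dth].
  split; [intros t; apply (ex_derive_continuous (V := R_NormedModule)); eexists; apply Dth|].
  set (r := fun t => norm2 (x t, y t)).
  (* [W] is the cosine of the angle between the vector and the direction [th]; it has zero
     derivative and starts at 1. *)
  set (W := fun t => (x t * cos (th t) + y t * sin (th t)) / r t).
  assert (rpos : forall t, 0 < r t) by (intros t; apply norm2_pos, nz).
  assert (rsq : forall t, r t * r t = x t * x t + y t * y t)
    by (intros t; unfold r; rewrite norm2_sq; reflexivity).
  assert (DW : forall t, is_derive W t 0).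
  { intros t. specialize (Npos t). specialize (rpos t). specialize (rsq t).
    assert (Er : r t = sqrt (x t * x t + y t * y t)) by reflexivity.
    evar_last.
    { unfold W, r, norm2, dot; simpl.
      auto_derive; [|reflexivity].
      rewrite <- Er.
      repeat split; try (eexists; first [apply Hx|apply Hy|apply Dth]); lra. }
    change (Derive (fun x0 : R => x x0) t) with (Derive x t).
    change (Derive (fun x0 : R => y x0) t) with (Derive y t).
    change (Derive (fun x0 : R => th x0) t) with (Derive th t).
    rewrite (is_derive_unique _ _ _ (Hx t)), (is_derive_unique _ _ _ (Hy t)),
      (is_derive_unique _ _ _ (Dth t)).
    rewrite <- Er. unfold k. rewrite <- rsq.
    assert (Ex2 : y t ^ 2 = r t ^ 2 - x t ^ 2) by nra.
    field_simplify_eq; [|lra].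
    rewrite Ex2. ring. }
  assert (W1 : forall t, W t = 1).
  { assert (W0 : W 0 = 1).
    { unfold W. rewrite th00, <- E1, <- E2.
      transitivity ((x 0 * x 0 + y 0 * y 0) / (r 0 * r 0));
        [unfold r; field; lra|]. rewrite <- rsq. field. specialize (rpos 0); lra. }
    intros t. rewrite <- W0. destruct (Rtotal_order t 0) as [l|[->|l]]; auto.
    - apply (eq_is_derive W t 0); auto.
    - symmetry; apply (eq_is_derive W 0 t); auto. }
  intros t. specialize (W1 t). specialize (rpos t). specialize (rsq t). fold (r t).
  unfold W in W1.
  assert (E : x t * cos (th t) + y t * sin (th t) = r t).
  { apply (Rmult_eq_reg_r (/ r t)); [|apply Rinv_neq_0_compat; lra].
    rewrite Rinv_r by lra. exact W1. }
  pose proof (sin2_cos2 (th t)) as SC. unfold Rsqr in SC.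
  (* Cosine 1 is the equality case: the squared distance between the vector and its claimed polar
     form vanishes. *)
  assert (Z : (x t - r t * cos (th t)) * (x t - r t * cos (th t))
            + (y t - r t * sin (th t)) * (y t - r t * sin (th t)) = 0).
  { transitivity (x t * x t + y t * y t
      - 2 * r t * (x t * cos (th t) + y t * sin (th t))
      + r t * r t * (sin (th t) * sin (th t) + cos (th t) * cos (th t))); [ring|].
    rewrite E, SC, rsq. nra. }
  destruct (Rplus_sqr_eq_0 _ _ Z). f_equal; lra.
Qed.

(** * Closed immersions and the index *)

Lemma vel_fst (g : curve) (t : R) :
  closed_immersion g -> is_derive (fun u => fst (g u)) t (fst (vel g t)).
Proof. intros [_ [H _]]. apply Derive_correct, (H 1%nat t). Qed.

Lemma vel_snd (g : curve) (t : R) :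
  closed_immersion g -> is_derive (fun u => snd (g u)) t (snd (vel g t)).
Proof. intros [_ [H _]]. apply Derive_correct, (H 1%nat t). Qed.

Lemma acc_fst (g : curve) (t : R) :
  closed_immersion g -> is_derive (fun u => fst (vel g u)) t (fst (acc g t)).
Proof. intros [_ [H _]]. apply (Derive_correct (fun u => fst (vel g u))), (H 2%nat t). Qed.

Lemma acc_snd (g : curve) (t : R) :
  closed_immersion g -> is_derive (fun u => snd (vel g u)) t (snd (acc g t)).
Proof. intros [_ [H _]]. apply (Derive_correct (fun u => snd (vel g u))), (H 2%nat t). Qed.

Lemma is_derive_continuous (f : R -> R) (t l : R) : is_derive f t l -> continuous f t.
Proof. intros H. apply (ex_derive_continuous (V := R_NormedModule)). now exists l. Qed.

Lemma acc_continuous (g : curve) (t : R) : closed_immersion g ->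
  continuous (fun u => fst (acc g u)) t /\ continuous (fun u => snd (acc g u)) t.
Proof.
  intros [_ [H _]]; split; apply (ex_derive_continuous (V := R_NormedModule)), (H 3%nat t).
Qed.

Lemma curve_period (g : curve) (t : R) (k : Z) :
  closed_immersion g -> g (t + IZR k) = g t.
Proof.
  intros [H _].
  assert (Hn : forall n t, g (t + INR n) = g t).
  { induction n; intros u; [simpl; f_equal; ring|].
    rewrite S_INR, <- Rplus_assoc, H. apply IHn. }
  destruct (Z_le_dec 0 k).
  - rewrite <- (Z2Nat.id k), <- INR_IZR_INZ by lia. apply Hn.
  - rewrite <- (Hn (Z.to_nat (- k)) (t + IZR k)).
    f_equal. rewrite INR_IZR_INZ, Z2Nat.id, opp_IZR by lia. ring.
Qed.

Lemma vel_period (g : curve) (t : R) (k : Z) :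
  closed_immersion g -> vel g (t + IZR k) = vel g t.
Proof.
  intros H.
  assert (S : is_derive (fun u => u + IZR k) t 1) by (auto_derive; auto).
  unfold vel. f_equal.
  - transitivity (Derive (fun u => fst (g (u + IZR k))) t).
    + symmetry. apply is_derive_unique.
      evar_last; [apply (is_derive_comp (fun u => fst (g u)) (fun u => u + IZR k));
        [apply vel_fst, H|exact S]|]. unfold scal; simpl; unfold mult; simpl; ring.
    + apply Derive_ext. intros u. now rewrite curve_period.
  - transitivity (Derive (fun u => snd (g (u + IZR k))) t).
    + symmetry. apply is_derive_unique.
      evar_last; [apply (is_derive_comp (fun u => snd (g u)) (fun u => u + IZR k));
        [apply vel_snd, H|exact S]|]. unfold scal; simpl; unfold mult; simpl; ring.
    + apply Derive_ext. intros u. now rewrite curve_period.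
Qed.

Lemma psub_eq0 (a b : point) : psub a b = (0, 0) -> a = b.
Proof. plane. intros [=]. f_equal; lra. Qed.

Lemma lift_curve (g : curve) (p : point) :
  closed_immersion g -> off_curve g p -> exists th, is_lift (fun t => psub (g t) p) th.
Proof.
  intros H O.
  destruct (lift_exists (fun t => fst (g t) - fst p) (fun t => snd (g t) - snd p)
    (fun t => fst (vel g t)) (fun t => snd (vel g t))) as [th [L _]].
  - intros t. evar_last; [apply (is_derive_minus (V := R_NormedModule));
      [apply vel_fst, H|apply (is_derive_const (V := R_NormedModule))]|].
    apply (minus_zero_r (G := R_AbelianMonoid)) || (unfold minus, plus, opp, zero; simpl; ring).
  - intros t. evar_last; [apply (is_derive_minus (V := R_NormedModule));
      [apply vel_snd, H|apply (is_derive_const (V := R_NormedModule))]|].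
    unfold minus, plus, opp, zero; simpl; ring.
  - intros t. eapply is_derive_continuous, acc_fst, H.
  - intros t. eapply is_derive_continuous, acc_snd, H.
  - intros t E. apply (O t). now apply psub_eq0.
  - exists th. exact L.
Qed.

Lemma lift_tangent (g : curve) : closed_immersion g ->
  exists ph, is_lift (vel g) ph /\
    forall t, is_derive ph t (curvature g t * speed g t).
Proof.
  intros H.
  destruct (lift_exists (fun t => fst (vel g t)) (fun t => snd (vel g t))
    (fun t => fst (acc g t)) (fun t => snd (acc g t))) as [ph [L D]].
  - intros t; apply acc_fst, H.
  - intros t; apply acc_snd, H.
  - intros t; apply (acc_continuous g t H).
  - intros t; apply (acc_continuous g t H).
  - intros t. apply H.
  - exists ph. split; [exact L|]. intros t. evar_last; [apply D|].
    assert (P : 0 < speed g t) by (apply norm2_pos, H).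
    pose proof (norm2_sq (vel g t)) as S. fold (speed g t) in S.
    unfold dot in S. rewrite <- S. unfold curvature, cross. field. lra.
Qed.

Lemma lift_turn (c : R -> point) (th : R -> R) (a b : R) :
  is_lift c th -> c a = c b -> c a <> (0, 0) ->
  exists k : Z, th b - th a = 2 * PI * IZR k.
Proof.
  intros L E nz. apply cos_eq_1.
  pose proof (lift_dot c c th th b a L L) as D.
  rewrite <- E in D. rewrite <- norm2_sq in D. apply norm2_pos in nz.
  assert (0 < norm2 (c a) * norm2 (c a)) by nra.
  apply (Rmult_eq_reg_l (norm2 (c a) * norm2 (c a))); lra.
Qed.

(** Each discrepancy is an integer number of turns, and a leash from [c] to itself makes it smaller
    than one turn. For a change of starting time, the increments over [[a, b]] and [[a + 1, b + 1]]
    are compared. *)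
Lemma lift_turn_unique (c : R -> point) (th th' : R -> R) (a b : R) :
  (forall t, c (t + 1) = c t) -> (forall t, c t <> (0, 0)) ->
  is_lift c th -> is_lift c th' -> th (a + 1) - th a = th' (b + 1) - th' b.
Proof.
  intros P nz L L'.
  assert (G : forall th th' a b, is_lift c th -> is_lift c th' -> a = b ->
    th (a + 1) - th a = th' (b + 1) - th' b).
  { clear - P nz. intros th th' a b L L' <-.
    destruct (lift_turn c th a (a + 1)) as [k Hk]; auto.
    destruct (lift_turn c th' a (a + 1)) as [k' Hk']; auto.
    rewrite Hk, Hk'. do 2 f_equal. apply two_PI_Z_eq. rewrite <- Hk, <- Hk'.
    pose proof PI_RGT_0. eapply Rlt_trans; [apply (leash c c); auto|lra].
    intros l _. rewrite <- norm2_sq. apply Rmult_lt_0_compat; apply norm2_pos, nz. }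
  transitivity (th (b + 1) - th b); [|apply G; auto].
  destruct (lift_turn c th a (a + 1)) as [k Hk]; auto.
  destruct (lift_turn c th b (b + 1)) as [k' Hk']; auto.
  rewrite Hk, Hk'. do 2 f_equal. apply two_PI_Z_eq. rewrite <- Hk, <- Hk'.
  pose proof PI_RGT_0.
  assert (R : Rabs ((th (b + 1) - th (a + 1)) - (th b - th a)) < PI).
  { apply (leash c c); auto. intros l _.
    replace (a + 1 + l * (b + 1 - (a + 1))) with (a + l * (b - a) + 1) by ring.
    rewrite P, <- norm2_sq. apply Rmult_lt_0_compat; apply norm2_pos, nz. }
  rewrite Rabs_minus_sym.
  replace (th (b + 1) - th b - (th (a + 1) - th a))
    with (th (b + 1) - th (a + 1) - (th b - th a)) by ring. lra.
Qed.

Lemma off_curve_nonzero (g : curve) (p : point) (t : R) :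
  off_curve g p -> psub (g t) p <> (0, 0).
Proof. intros O E. apply (O t). now apply psub_eq0. Qed.

(** Frees [index] from the choice made by [epsilon]: every lift, from every starting time, computes
    it. *)
Lemma index_spec (g : curve) (p : point) (th : R -> R) (a : R) :
  closed_immersion g -> off_curve g p -> is_lift (fun t => psub (g t) p) th ->
  th (a + 1) - th a = 2 * PI * IZR (index g p).
Proof.
  intros H O L.
  assert (S : is_index g p (index g p)).
  { unfold index. apply epsilon_spec.
    destruct (lift_turn _ th 0 1 L) as [k Hk].
    - cbv beta. replace 1 with (0 + 1) by ring. destruct H as [H _]. now rewrite H.
    - now apply off_curve_nonzero.
    - exists k, th. destruct L as [L1 L2]. auto. }
  destruct S as [th' [S1 [S2 <-]]].
  replace (th' 1) with (th' (0 + 1)) by (f_equal; ring).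
  apply (lift_turn_unique (fun t => psub (g t) p)); auto.
  - intros t. destruct H as [H _]. now rewrite H.
  - intros t. now apply off_curve_nonzero.
  - split; auto.
Qed.

(** Curve and point may both change, so this serves for motions of the point as well as for
    deformations of the curve. *)
Lemma index_leash (g g' : curve) (p p' : point) :
  closed_immersion g -> closed_immersion g' -> off_curve g p -> off_curve g' p' ->
  (forall u, 0 <= u <= 1 -> 0 < dot (psub (g u) p) (psub (g' u) p')) ->
  index g p = index g' p'.
Proof.
  intros H H' O O' D.
  destruct (lift_curve g p H O) as [th L]. destruct (lift_curve g' p' H' O') as [th' L'].
  apply two_PI_Z_eq.
  rewrite <- (index_spec g p th 0 H O L), <- (index_spec g' p' th' 0 H' O' L').
  pose proof PI_RGT_0. eapply Rlt_trans; [eapply leash; eauto|lra].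
  intros l Hl. simpl.
  replace (0 + l * (0 + 1 - 0)) with l by ring. auto.
Qed.

Lemma curve_continuous (g : curve) (t eps : R) :
  closed_immersion g -> 0 < eps ->
  exists d, 0 < d /\ forall u, Rabs (u - t) < d -> dist2 (g u) (g t) < eps.
Proof.
  intros H e0.
  assert (C1 := is_derive_continuous _ _ _ (vel_fst g t H)).
  assert (C2 := is_derive_continuous _ _ _ (vel_snd g t H)).
  assert (e2 : 0 < eps / 2) by lra.
  apply filterlim_locally with (eps := mkposreal _ e2) in C1 as [d1 H1].
  apply filterlim_locally with (eps := mkposreal _ e2) in C2 as [d2 H2].
  exists (Rmin d1 d2). split; [apply Rmin_glb_lt; apply cond_pos|].
  intros u Hu.
  assert (B1 := H1 u (Rlt_le_trans _ _ _ Hu (Rmin_l _ _))).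
  assert (B2 := H2 u (Rlt_le_trans _ _ _ Hu (Rmin_r _ _))).
  unfold ball in B1, B2; simpl in B1, B2; unfold AbsRing_ball, abs, minus, plus, opp in B1, B2;
    simpl in B1, B2.
  unfold dist2. eapply Rle_lt_trans; [apply norm2_le_sum|].
  unfold psub; simpl. unfold Rminus. lra.
Qed.

Lemma Z_fraction (x b : R) : exists k : Z, b <= x + IZR k < b + 1.
Proof.
  exists (- (up (x - b) - 1))%Z. rewrite opp_IZR, minus_IZR.
  destruct (archimed (x - b)). lra.
Qed.

Lemma dist_curve_pos (g : curve) (p : point) :
  closed_immersion g -> off_curve g p ->
  exists m, 0 < m /\ forall u, m <= dist2 (g u) p.
Proof.
  intros H O.
  (* Taking the lower bound itself as the parameter [z] makes the tube lemma yield a uniform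
     positive bound. *)
  destruct (tube (fun d z => Rabs z < d) (fun z u => Rabs z < dist2 (g u) p) 0 1)
    as [d [d0 Hd]].
  - intros d d' z Hdd Hz; lra.
  - intros u0 _.
    assert (P : 0 < dist2 (g u0) p) by now apply norm2_pos, off_curve_nonzero.
    destruct (curve_continuous g u0 (dist2 (g u0) p / 2) H) as [d [d0 Hd]]; [lra|].
    exists (Rmin d (dist2 (g u0) p / 2)). split; [apply Rmin_glb_lt; lra|].
    intros z u Hz Hu.
    pose proof (Rmin_l d (dist2 (g u0) p / 2)). pose proof (Rmin_r d (dist2 (g u0) p / 2)).
    assert (dist2 (g u) (g u0) < dist2 (g u0) p / 2) by (apply Hd; lra).
    pose proof (dist2_triang (g u0) (g u) p). rewrite (dist2_sym (g u0) (g u)) in H3. lra.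
  - exists (d / 2). split; [lra|]. intros u.
    destruct (Z_fraction u 0) as [k Hk]. rewrite <- (curve_period g u k H).
    left. replace (d / 2) with (Rabs (d / 2)) by (apply Rabs_pos_eq; lra).
    apply Hd; [rewrite Rabs_pos_eq; lra|lra].
Qed.

Lemma dot_close_pos (a b : point) : norm2 (psub b a) < norm2 a -> 0 < dot a b.
Proof.
  intros H. pose proof (dot_le a (psub b a)) as C. pose proof (norm2_sq a) as S.
  pose proof (norm2_ge0 (psub b a)).
  replace (dot a b) with (dot a a + dot a (psub b a)) by (plane; ring).
  rewrite <- S. pose proof (Rcomplements.Rabs_le_between (dot a (psub b a)) (norm2 a * norm2 (psub b a))) as [B _].
  specialize (B C). nra.
Qed.

Lemma index_loc_const (g : curve) (p : point) :
  closed_immersion g -> off_curve g p ->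
  exists m, 0 < m /\ forall q, dist2 p q < m -> off_curve g q /\ index g q = index g p.
Proof.
  intros H O. destruct (dist_curve_pos g p H O) as [m [m0 Hm]].
  exists m. split; auto. intros q Hq.
  assert (Oq : off_curve g q).
  { intros t E. specialize (Hm t). rewrite E, dist2_sym in Hm. lra. }
  split; auto. symmetry. apply index_leash; auto. intros u _.
  apply dot_close_pos. specialize (Hm u). unfold dist2 in *.
  replace (psub (psub (g u) q) (psub (g u) p)) with (psub p q)
    by (plane; f_equal; ring). lra.
Qed.

Lemma path_close (c : R -> point) (u eps : R) :
  continuous (fun v => fst (c v)) u -> continuous (fun v => snd (c v)) u -> 0 < eps ->
  exists d, 0 < d /\ forall v, Rabs (v - u) < d -> dist2 (c u) (c v) < eps.
Proof.
  intros C1 C2 e0. assert (e2 : 0 < eps / 2) by lra.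
  apply filterlim_locally with (eps := mkposreal _ e2) in C1 as [d1 H1].
  apply filterlim_locally with (eps := mkposreal _ e2) in C2 as [d2 H2].
  exists (Rmin d1 d2). split; [apply Rmin_glb_lt; apply cond_pos|].
  intros v Hu.
  assert (B1 := H1 v (Rlt_le_trans _ _ _ Hu (Rmin_l _ _))).
  assert (B2 := H2 v (Rlt_le_trans _ _ _ Hu (Rmin_r _ _))).
  unfold ball in B1, B2; simpl in B1, B2; unfold AbsRing_ball, abs, minus, plus, opp in B1, B2;
    simpl in B1, B2.
  rewrite dist2_sym. unfold dist2. eapply Rle_lt_trans; [apply norm2_le_sum|].
  unfold psub; simpl. unfold Rminus. lra.
Qed.

Lemma joined_index (g : curve) (p : point) (r : R) (a b : point) :
  closed_immersion g -> joined g p r a b -> index g a = index g b.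
Proof.
  intros H [c [C [<- [<- I]]]].
  symmetry. apply (loc_const (fun u => index g (c u)) 0 1); [lra|].
  intros u Hu. destruct (I u Hu) as [_ O].
  destruct (index_loc_const g (c u) H O) as [m [m0 Hm]].
  destruct (C u) as [C1 C2].
  destruct (path_close c u m C1 C2 m0) as [d [d0 Hd]].
  exists d. split; auto. intros v _ vu. apply Hm, Hd, vu.
Qed.

(** * Families of curves *)

Definition continuous_family (F : R -> R -> point) : Prop :=
  forall s0 t0 eps, 0 <= s0 <= 1 -> 0 < eps -> exists d, 0 < d /\
    forall s t, 0 <= s <= 1 -> Rabs (s - s0) < d -> Rabs (t - t0) < d ->
      dist2 (F s t) (F s0 t0) < eps.

(** Joint continuity of the curve and of its velocity is what the compactness arguments work with.
    Constant families qualify, so statements on families specialise to a single curve. *)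
Definition C1_family (G : R -> curve) : Prop :=
  (forall s, 0 <= s <= 1 -> closed_immersion (G s)) /\
  continuous_family G /\ continuous_family (fun s => vel (G s)).

Lemma vel_continuous (g : curve) (t eps : R) :
  closed_immersion g -> 0 < eps ->
  exists d, 0 < d /\ forall u, Rabs (u - t) < d -> dist2 (vel g u) (vel g t) < eps.
Proof.
  intros H e0.
  destruct (path_close (vel g) t eps) as [d [d0 Hd]]; auto.
  - eapply is_derive_continuous, acc_fst, H.
  - eapply is_derive_continuous, acc_snd, H.
  - exists d; split; auto. intros u Hu. rewrite dist2_sym. auto.
Qed.

Lemma C1_family_const (g : curve) : closed_immersion g -> C1_family (fun _ => g).
Proof.
  intros H. split; [auto|split].
  - intros s0 t0 eps _ e0. destruct (curve_continuous g t0 eps H e0) as [d [d0 Hd]].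
    exists d; auto.
  - intros s0 t0 eps _ e0. destruct (vel_continuous g t0 eps H e0) as [d [d0 Hd]].
    exists d; auto.
Qed.

Lemma increment_close (x dx : R -> R) (t t' t0 d l eta : R) :
  (forall u, is_derive x u (dx u)) ->
  (forall u, Rabs (u - t0) < d -> Rabs (dx u - l) <= eta) ->
  Rabs (t - t0) < d -> Rabs (t' - t0) < d ->
  Rabs (x t' - x t - (t' - t) * l) <= eta * Rabs (t' - t).
Proof.
  intros Dx Hd Ht Ht'.
  destruct (MVT_gen x t t' dx) as [c [Hc E]].
  - intros u _. apply Dx.
  - intros u _. apply continuity_pt_filterlim. eapply is_derive_continuous, Dx.
  - rewrite E. replace (dx c * (t' - t) - (t' - t) * l) with ((dx c - l) * (t' - t)) by ring.
    rewrite Rabs_mult. apply Rmult_le_compat_r; [apply Rabs_pos|].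
    apply Hd. apply Rabs_def2 in Ht. apply Rabs_def2 in Ht'. apply Rabs_def1.
    + pose proof (Rmax_lub_lt t t' (t0 + d)). lra.
    + pose proof (Rmin_glb_lt t t' (t0 - d)). lra.
Qed.

(** By the mean value theorem, all the curves [G s] near [(s0, t0)] move with the single velocity
    [vel (G s0) t0] up to an [eta]-Lipschitz error. *)
Lemma strict_derivative (G : R -> curve) (s0 t0 eta : R) :
  C1_family G -> 0 <= s0 <= 1 -> 0 < eta ->
  exists d, 0 < d /\ forall s t t', 0 <= s <= 1 -> Rabs (s - s0) < d ->
    Rabs (t - t0) < d -> Rabs (t' - t0) < d ->
    norm2 (psub (psub (G s t') (G s t)) (pscal (t' - t) (vel (G s0) t0)))
      <= eta * Rabs (t' - t).
Proof.
  intros [HG [_ HV]] Hs0 e0.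
  destruct (HV s0 t0 (eta / 2) Hs0) as [d [d0 Hd]]; [lra|].
  exists d; split; auto. intros s t t' Hs Hsd Ht Ht'.
  eapply Rle_trans; [apply norm2_le_sum|].
  replace (eta * Rabs (t' - t)) with
    (eta / 2 * Rabs (t' - t) + eta / 2 * Rabs (t' - t)) by lra.
  assert (B : forall u, Rabs (u - t0) < d ->
    Rabs (fst (vel (G s) u) - fst (vel (G s0) t0)) <= eta / 2 /\
    Rabs (snd (vel (G s) u) - snd (vel (G s0) t0)) <= eta / 2).
  { intros u Hu. specialize (Hd s u Hs Hsd Hu). unfold dist2 in Hd. split.
    - eapply Rle_trans; [apply (norm2_fst (psub _ _))|lra].
    - eapply Rle_trans; [apply (norm2_snd (psub _ _))|lra]. }
  apply Rplus_le_compat.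
  - apply (increment_close (fun u => fst (G s u)) (fun u => fst (vel (G s) u)) t t' t0 d); auto.
    + intros u. apply vel_fst; auto.
    + intros u Hu. apply B, Hu.
  - apply (increment_close (fun u => snd (G s u)) (fun u => snd (vel (G s) u)) t t' t0 d); auto.
    + intros u. apply vel_snd; auto.
    + intros u Hu. apply B, Hu.
Qed.

Lemma strict_derivative_curve (g : curve) (t0 eta : R) :
  closed_immersion g -> 0 < eta ->
  exists d, 0 < d /\ forall t t', Rabs (t - t0) < d -> Rabs (t' - t0) < d ->
    norm2 (psub (psub (g t') (g t)) (pscal (t' - t) (vel g t0))) <= eta * Rabs (t' - t).
Proof.
  intros H e0.
  destruct (strict_derivative (fun _ => g) 0 t0 eta (C1_family_const g H)) as [d [d0 Hd]];
    [lra|auto|].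
  exists d; split; auto. intros t t' Ht Ht'. apply (Hd 0); auto; [lra|].
  rewrite Rminus_diag, Rabs_R0; auto.
Qed.

(** * Crossing the curve *)

Definition same_time (x y : R) : Prop := exists k : Z, y = x + IZR k.

Lemma same_time_refl (x : R) : same_time x x.
Proof. exists 0%Z; ring. Qed.

Lemma same_time_sym (x y : R) : same_time x y -> same_time y x.
Proof. intros [k ->]. exists (- k)%Z. rewrite opp_IZR; ring. Qed.

Lemma same_time_trans (x y z : R) : same_time x y -> same_time y z -> same_time x z.
Proof. intros [k ->] [l ->]. exists (k + l)%Z. rewrite plus_IZR; ring. Qed.

Lemma same_time_close (x y : R) : same_time x y -> Rabs (y - x) < 1 -> y = x.
Proof.
  intros [k ->] H. replace (x + IZR k - x) with (IZR k) in H by ring.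
  rewrite (IZR_small k H). ring.
Qed.

Lemma curve_same_time (g : curve) (x y : R) :
  closed_immersion g -> same_time x y -> g y = g x.
Proof. intros H [k ->]. now apply curve_period. Qed.

Lemma vel_same_time (g : curve) (x y : R) :
  closed_immersion g -> same_time x y -> vel g y = vel g x.
Proof. intros H [k ->]. now apply vel_period. Qed.

(* When the segment from [p - w] to [p + w] meets the curve only at [t0], the
   difference [D] of the arguments seen from its two endpoints equals [PI] modulo
   [2 * PI] only at [t0] and its translates; it leaves [PI] upwards at [t0] and so
   reaches [3 * PI] at [t0 + 1]. *)
Lemma index_crossing (g : curve) (t0 : R) (w : point) :
  closed_immersion g -> 0 < cross (vel g t0) w ->
  (forall m u, -1 <= m <= 1 -> g u = padd (g t0) (pscal m w) -> same_time t0 u) ->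
  off_curve g (padd (g t0) w) /\ off_curve g (psub (g t0) w) /\
  index g (padd (g t0) w) = (index g (psub (g t0) w) + 1)%Z.
Proof.
  intros H Hw Seg. set (p := g t0) in *.
  assert (w0 : w <> (0, 0)) by (intros ->; unfold cross in Hw; simpl in Hw; lra).
  assert (Wpos := norm2_pos w w0).
  assert (Op : off_curve g (padd p w)).
  { intros u E. apply w0. assert (S : same_time t0 u).
    { apply (Seg 1); [lra|]. rewrite E. plane; f_equal; ring. }
    apply (curve_same_time g) in S; auto. rewrite E in S. fold p in S.
    clearbody p. clear - S. plane. injection S; intros. f_equal; lra. }
  assert (Om : off_curve g (psub p w)).
  { intros u E. apply w0. assert (S : same_time t0 u).
    { apply (Seg (-1)); [lra|]. rewrite E. plane; f_equal; ring. }
    apply (curve_same_time g) in S; auto. rewrite E in S. fold p in S.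
    clearbody p. clear - S. plane. injection S; intros. f_equal; lra. }
  split; [auto|split; [auto|]].
  destruct (lift_curve g (padd p w) H Op) as [tp Lp].
  destruct (lift_curve g (psub p w) H Om) as [tm Lm].
  assert (Ip := index_spec g _ tp t0 H Op Lp).
  assert (Im := index_spec g _ tm t0 H Om Lm).
  set (D := fun u => tp u - tm u).
  assert (DC : forall u, continuous D u).
  { intros u. apply (continuous_minus (V := R_NormedModule)); [apply Lp|apply Lm]. }
  set (N := fun u => norm2 (psub (g u) (padd p w)) * norm2 (psub (g u) (psub p w))).
  assert (Npos : forall u, 0 < N u).
  { intros u. apply Rmult_lt_0_compat; apply norm2_pos, off_curve_nonzero; auto. }
  set (x := fun u => psub (g u) p).
  assert (Dcos : forall u, N u * cos (D u) = dot (x u) (x u) - dot w w).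
  { intros u. unfold N, D. rewrite <- (lift_dot _ _ _ _ u u Lp Lm).
    unfold x. clearbody p. plane; ring. }
  assert (Dsin : forall u, N u * sin (D u) = - 2 * cross (x u) w).
  { intros u. unfold N, D. rewrite (Rmult_comm (norm2 _)).
    rewrite <- (lift_cross _ _ _ _ u u Lm Lp). unfold x. clearbody p. plane; ring. }
  assert (x0 : x t0 = (0, 0)) by (unfold x; fold p; clearbody p; plane; f_equal; ring).
  (* To first order [x u] is [(u - t0) * vel g t0], so near [t0] the sign of [cross (x u) w] is that
     of [u - t0]. *)
  assert (Sgn : exists d, 0 < d /\ forall u, Rabs (u - t0) < d ->
     (t0 < u -> 0 < cross (x u) w) /\ (u < t0 -> cross (x u) w < 0)).
  { set (eta := cross (vel g t0) w / (2 * norm2 w)).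
    assert (e0 : 0 < eta) by (apply Rdiv_lt_0_compat; lra).
    destruct (strict_derivative_curve g t0 eta H e0) as [d [d0 Hd]].
    exists d; split; auto. intros u Hu.
    specialize (Hd t0 u). fold p in Hd.
    assert (B : Rabs (cross (x u) w - (u - t0) * cross (vel g t0) w)
                <= cross (vel g t0) w / 2 * Rabs (u - t0)).
    { replace (cross (x u) w - (u - t0) * cross (vel g t0) w) with
        (cross (psub (psub (g u) p) (pscal (u - t0) (vel g t0))) w)
        by (unfold x; clearbody p; plane; ring).
      eapply Rle_trans; [apply cross_le|].
      replace (cross (vel g t0) w / 2 * Rabs (u - t0)) with
        (eta * Rabs (u - t0) * norm2 w) by (unfold eta; field; lra).
      apply Rmult_le_compat_r; [lra|]. apply Hd; auto.
      rewrite Rminus_diag, Rabs_R0; auto. }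
    apply Rcomplements.Rabs_le_between in B.
    split; intros Hlt.
    - rewrite Rabs_pos_eq in B by lra. nra.
    - rewrite Rabs_left in B by lra. nra. }
  destruct Sgn as [d [d0 Sgn]].
  (* The endpoints are seen in opposite directions only from the open segment between them: sine 0
     makes [x u] collinear with [w], and cosine -1 makes it shorter. *)
  assert (avoid : forall u (k : Z), t0 < u < t0 + 1 -> D u <> PI + 2 * PI * IZR k).
  { intros u k Hu E. specialize (Dcos u). specialize (Dsin u). specialize (Npos u).
    rewrite E, cos_period_Z, cos_PI in Dcos. rewrite E, sin_period_Z, sin_PI in Dsin.
    assert (Cz : cross (x u) w = 0) by nra.
    assert (Dlt : dot (x u) (x u) < dot w w) by nra.
    set (m := dot (x u) w / dot w w).
    assert (ww : 0 < dot w w) by (rewrite <- norm2_sq; nra).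
    assert (Ex : x u = pscal m w).
    { destruct (x u) as [a b]. destruct w as [e f]. unfold pscal, m, dot, cross in *; simpl in *.
      f_equal.
      - transitivity (((a * e + b * f) * e + f * (a * f - b * e)) / (e * e + f * f));
          [field; lra|rewrite Cz; field; lra].
      - transitivity (((a * e + b * f) * f - e * (a * f - b * e)) / (e * e + f * f));
          [field; lra|rewrite Cz; field; lra]. }
    assert (same_time t0 u) as [j Hj].
    { apply (Seg m).
      - rewrite Ex in Dlt. assert (m * m < 1); [|nra].
        assert (dot (pscal m w) (pscal m w) = m * m * dot w w) by (plane; ring). nra.
      - fold p. rewrite <- Ex. unfold x. symmetry. apply padd_psub. }
    assert (0 < IZR j < 1) by lra.
    assert (0 < j)%Z by (apply lt_IZR; lra). assert (j < 1)%Z by (apply lt_IZR; lra). lia. }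
  destruct (cos_eq_m1 (D t0)) as [m Hm].
  { specialize (Dcos t0). specialize (Dsin t0). specialize (Npos t0). rewrite x0 in *.
    assert (sin (D t0) = 0).
    { apply (Rmult_eq_reg_l (N t0)); [|lra]. rewrite Dsin. unfold cross; simpl; ring. }
    pose proof (sin2_cos2 (D t0)) as SC. unfold Rsqr in SC.
    assert (cos (D t0) < 0).
    { rewrite <- (norm2_sq w) in Dcos. unfold dot in Dcos; simpl in Dcos. nra. }
    nra. }
  set (k := (index g (padd p w) - index g (psub p w))%Z).
  assert (Hk : D (t0 + 1) = D t0 + 2 * PI * IZR k).
  { unfold D, k. rewrite minus_IZR. lra. }
  pose proof PI_RGT_0 as Ppos.
  (* [E] is [D] normalised to the value PI at [t0]. *)
  set (E := fun u => D u - 2 * PI * IZR m).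
  assert (EC : forall u, continuous E u).
  { intros u. apply (continuous_minus (V := R_NormedModule)); [apply DC|apply continuous_const]. }
  assert (Esin : forall u, sin (E u) = sin (D u)).
  { intros u. unfold E. rewrite <- (sin_period_Z (D u) (- m)). f_equal. rewrite opp_IZR; ring. }
  assert (close : forall t, exists d, 0 < d /\ forall u, Rabs (u - t) < d -> Rabs (E u - E t) < PI / 2).
  { intros t. assert (h : 0 < PI / 2) by lra.
    pose proof (EC t) as C. apply filterlim_locally with (eps := mkposreal _ h) in C as [e He].
    exists e. split; [apply cond_pos|]. intros u Hu. apply (He u Hu). }
  assert (E0 : E t0 = PI) by (unfold E; lra).
  destruct (close t0) as [d1 [d10 Hd1]].
  set (h1 := Rmin (d / 2) (Rmin (d1 / 2) (1 / 4))).
  assert (h1pos : 0 < h1) by (repeat apply Rmin_glb_lt; lra).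
  assert (h1a : h1 <= d / 2) by apply Rmin_l.
  assert (h1b : h1 <= d1 / 2) by (eapply Rle_trans; [apply Rmin_r|apply Rmin_l]).
  assert (h1c : h1 <= 1 / 4) by (eapply Rle_trans; [apply Rmin_r|apply Rmin_r]).
  (* Just after [t0] the sine is negative while [E] is within PI / 2 of PI, so [E] has moved above
     PI. *)
  assert (U1 : PI < E (t0 + h1)).
  { assert (R1 : Rabs (t0 + h1 - t0) = h1)
      by (replace (t0 + h1 - t0) with h1 by ring; apply Rabs_pos_eq; lra).
    specialize (Hd1 (t0 + h1)). rewrite R1, E0 in Hd1.
    assert (B := Rabs_def2 _ _ (Hd1 ltac:(lra))).
    destruct (Sgn (t0 + h1)) as [S _]; [rewrite R1; lra|].
    specialize (S ltac:(lra)). specialize (Dsin (t0 + h1)). specialize (Npos (t0 + h1)).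
    rewrite <- Esin in Dsin. assert (sin (E (t0 + h1)) < 0) by nra.
    destruct (Rle_dec (E (t0 + h1)) PI); [|lra].
    assert (0 <= sin (E (t0 + h1))) by (apply sin_ge_0; lra). lra. }
  (* Until the next passage through the segment, [E] can reach neither PI nor 3 PI. *)
  assert (Range : forall u, t0 + h1 <= u < t0 + 1 -> PI < E u < 3 * PI).
  { intros u Hu.
    assert (A1 : forall v, t0 + h1 <= v < t0 + 1 -> E v <> PI).
    { intros v Hv Ev. apply (avoid v m); [lra|]. unfold E in Ev; lra. }
    assert (A3 : forall v, t0 + h1 <= v < t0 + 1 -> E v <> 3 * PI).
    { intros v Hv Ev. apply (avoid v (m + 1)%Z); [lra|]. rewrite plus_IZR. unfold E in Ev; lra. }
    assert (U1' : E (t0 + h1) < 3 * PI).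
    { specialize (Hd1 (t0 + h1)).
      replace (t0 + h1 - t0) with h1 in Hd1 by ring. rewrite Rabs_pos_eq, E0 in Hd1 by lra.
      assert (B := Rabs_def2 _ _ (Hd1 ltac:(lra))). lra. }
    split.
    - destruct (Rlt_dec PI (E u)); auto. exfalso.
      destruct (continuous_between E (t0 + h1) u PI EC) as [v [Hv Ev]]; [lra| |].
      + rewrite Rmin_right, Rmax_left by lra. lra.
      + apply (A1 v); [lra|auto].
    - destruct (Rlt_dec (E u) (3 * PI)); auto. exfalso.
      destruct (continuous_between E (t0 + h1) u (3 * PI) EC) as [v [Hv Ev]]; [lra| |].
      + rewrite Rmin_left, Rmax_right by lra. lra.
      + apply (A3 v); [lra|auto]. }
  destruct (close (t0 + 1)) as [d2 [d20 Hd2]].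
  set (h2 := Rmin (d / 2) (Rmin (d2 / 2) (1 / 4))).
  assert (h2pos : 0 < h2) by (repeat apply Rmin_glb_lt; lra).
  assert (h2a : h2 <= d / 2) by apply Rmin_l.
  assert (h2b : h2 <= d2 / 2) by (eapply Rle_trans; [apply Rmin_r|apply Rmin_l]).
  assert (h2c : h2 <= 1 / 4) by (eapply Rle_trans; [apply Rmin_r|apply Rmin_r]).
  set (u2 := t0 + 1 - h2).
  assert (R2 : Rabs (u2 - (t0 + 1)) = h2).
  { unfold u2. replace (t0 + 1 - h2 - (t0 + 1)) with (- h2) by ring.
    rewrite Rabs_Ropp; apply Rabs_pos_eq; lra. }
  specialize (Hd2 u2). rewrite R2 in Hd2. assert (B := Rabs_def2 _ _ (Hd2 ltac:(lra))).
  (* Just before [t0 + 1] the sine is positive, so [E] lies in the upper half of its range. The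
     value at [t0 + 1], less than PI / 2 away and of the form PI + 2 PI k, can only be 3 PI. *)
  assert (S2 : 0 < sin (E u2)).
  { rewrite Esin. specialize (Dsin u2). specialize (Npos u2).
    assert (Xu : x u2 = x (t0 - h2)).
    { unfold x. f_equal. apply curve_same_time; auto. exists 1%Z. unfold u2; ring. }
    rewrite Xu in Dsin. destruct (Sgn (t0 - h2)) as [_ S].
    { replace (t0 - h2 - t0) with (- h2) by ring. rewrite Rabs_Ropp, Rabs_pos_eq; lra. }
    specialize (S ltac:(lra)). nra. }
  assert (I2 : PI < E u2 < 3 * PI) by (apply Range; unfold u2; lra).
  assert (J2 : 2 * PI < E u2).
  { destruct (Rle_dec (E u2) (2 * PI)); [|lra].
    assert (sin (E u2) <= 0) by (apply sin_le_0; lra). lra. }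
  assert (Ek : E (t0 + 1) = PI + 2 * PI * IZR k) by (unfold E; lra).
  assert (k = 1)%Z; [|unfold k in *; lia].
  apply two_PI_Z_eq. rewrite Ek in B. apply Rabs_def1; lra.
Qed.

(** * Local regions *)

Lemma joined_sym (g : curve) (p : point) (r : R) (a b : point) :
  joined g p r a b -> joined g p r b a.
Proof.
  intros [c [C [E0 [E1 I]]]]. exists (fun u => c (1 - u)).
  assert (A : forall u, continuous (fun u => 1 - u) u).
  { intros u. apply (ex_derive_continuous (V := R_NormedModule)). auto_derive; auto. }
  split; [|split; [|split]].
  - intros u. destruct (C (1 - u)) as [C1 C2]. split.
    + apply (continuous_comp (fun u => 1 - u) (fun v => fst (c v))); auto.
    + apply (continuous_comp (fun u => 1 - u) (fun v => snd (c v))); auto.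
  - now replace (1 - 0) with 1 by ring.
  - now replace (1 - 1) with 0 by ring.
  - intros u Hu. apply I; lra.
Qed.

(** [joined] asks for paths continuous on the whole line. Clamping the two time changes gives the
    concatenation as one formula: one term rests at the common endpoint while the other moves. *)
Lemma continuous_glue (f h : R -> R) :
  (forall u, continuous f u) -> (forall u, continuous h u) -> f 1 = h 0 ->
  forall u, continuous (fun u => f (Rmin (2 * u) 1) + h (Rmax (2 * u - 1) 0) - h 0) u.
Proof.
  intros Hf Hh E u.
  assert (Cmin : continuous (fun u => Rmin (2 * u) 1) u).
  { apply (continuous_ext (fun u => / 2 * (2 * u + 1 - Rabs (2 * u - 1)))).
    - intros v. unfold Rmin. destruct (Rle_dec (2 * v) 1).
      + rewrite Rabs_left1 by lra. lra.
      + rewrite Rabs_pos_eq by lra. lra.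
    - apply (continuous_mult (K := R_AbsRing)); [apply continuous_const|].
      apply (continuous_minus (V := R_NormedModule)).
      + apply (ex_derive_continuous (V := R_NormedModule)). auto_derive; auto.
      + apply (continuous_comp (fun v => 2 * v - 1) Rabs).
        * apply (ex_derive_continuous (V := R_NormedModule)). auto_derive; auto.
        * apply continuous_Rabs. }
  assert (Cmax : continuous (fun u => Rmax (2 * u - 1) 0) u).
  { apply (continuous_ext (fun u => / 2 * (2 * u - 1 + Rabs (2 * u - 1)))).
    - intros v. unfold Rmax. destruct (Rle_dec (2 * v - 1) 0).
      + rewrite Rabs_left1 by lra. lra.
      + rewrite Rabs_pos_eq by lra. lra.
    - apply (continuous_mult (K := R_AbsRing)); [apply continuous_const|].
      apply (continuous_plus (V := R_NormedModule)).
      + apply (ex_derive_continuous (V := R_NormedModule)). auto_derive; auto.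
      + apply (continuous_comp (fun v => 2 * v - 1) Rabs).
        * apply (ex_derive_continuous (V := R_NormedModule)). auto_derive; auto.
        * apply continuous_Rabs. }
  apply (continuous_minus (V := R_NormedModule)); [|apply continuous_const].
  apply (continuous_plus (V := R_NormedModule)).
  - apply (continuous_comp (fun u => Rmin (2 * u) 1) f); auto.
  - apply (continuous_comp (fun u => Rmax (2 * u - 1) 0) h); auto.
Qed.

Lemma joined_trans (g : curve) (p : point) (r : R) (a b c : point) :
  joined g p r a b -> joined g p r b c -> joined g p r a c.
Proof.
  intros [c1 [C1 [E0 [E1 I1]]]] [c2 [C2 [F0 [F1 I2]]]].
  set (k := fun u => padd (c1 (Rmin (2 * u) 1)) (psub (c2 (Rmax (2 * u - 1) 0)) b)).
  assert (KL : forall u, u <= 1 / 2 -> k u = c1 (2 * u)).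
  { intros u Hu. unfold k. rewrite Rmin_left, Rmax_right, F0 by lra.
    destruct (c1 (2 * u)). plane; f_equal; ring. }
  assert (KR : forall u, 1 / 2 <= u -> k u = c2 (2 * u - 1)).
  { intros u Hu. unfold k. rewrite Rmin_right, Rmax_left, E1 by lra. apply padd_psub. }
  exists k. split; [|split; [|split]].
  - intros u. split.
    + apply (continuous_ext (fun u => fst (c1 (Rmin (2 * u) 1))
        + fst (c2 (Rmax (2 * u - 1) 0)) - fst (c2 0))).
      * intros v. unfold k, padd, psub; simpl. rewrite F0. ring.
      * apply (continuous_glue (fun v => fst (c1 v)) (fun v => fst (c2 v))).
        -- intros v; apply C1.
        -- intros v; apply C2.
        -- now rewrite E1, F0.
    + apply (continuous_ext (fun u => snd (c1 (Rmin (2 * u) 1))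
        + snd (c2 (Rmax (2 * u - 1) 0)) - snd (c2 0))).
      * intros v. unfold k, padd, psub; simpl. rewrite F0. ring.
      * apply (continuous_glue (fun v => snd (c1 v)) (fun v => snd (c2 v))).
        -- intros v; apply C1.
        -- intros v; apply C2.
        -- now rewrite E1, F0.
  - rewrite KL by lra. now rewrite Rmult_0_r.
  - rewrite KR by lra. now replace (2 * 1 - 1) with 1 by ring.
  - intros u Hu. destruct (Rle_dec u (1 / 2)).
    + rewrite KL by lra. apply I1; lra.
    + rewrite KR by lra. apply I2; lra.
Qed.

Lemma joined_segment (g : curve) (p : point) (r : R) (a b : point) :
  (forall l, 0 <= l <= 1 ->
     let x := padd a (pscal l (psub b a)) in dist2 p x < r /\ off_curve g x) ->
  joined g p r a b.
Proof.
  intros H. exists (fun l => padd a (pscal l (psub b a))).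
  split; [|split; [|split]]; auto.
  - intros u. unfold padd, pscal; simpl.
    split; apply (ex_derive_continuous (V := R_NormedModule)); auto_derive; auto.
  - plane; f_equal; ring.
  - plane; f_equal; ring.
Qed.

Lemma joined_ends (g : curve) (p : point) (r : R) (a b : point) :
  joined g p r a b -> (dist2 p a < r /\ off_curve g a) /\ (dist2 p b < r /\ off_curve g b).
Proof. intros [c [_ [<- [<- I]]]]. split; apply I; lra. Qed.

Lemma ForallOrdPairs_remove {A : Type} (Q : A -> A -> Prop) (l1 l2 : list A) (b : A) :
  (forall x y, Q x y -> Q y x) -> ForallOrdPairs Q (l1 ++ b :: l2) ->
  ForallOrdPairs Q (l1 ++ l2) /\ (forall y, In y (l1 ++ l2) -> Q b y).
Proof.
  intros Sy. induction l1 as [|x l1 IH]; simpl; intros H; inversion H; subst.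
  - split; auto. now apply Forall_forall.
  - destruct (IH H3) as [I1 I2]. rewrite Forall_forall in H2. split.
    + constructor; auto. apply Forall_forall. intros y Hy. apply H2.
      apply in_app_iff in Hy. apply in_app_iff. simpl; tauto.
    + intros y [<-|Hy]; auto. apply Sy, H2, in_app_iff; simpl; auto.
Qed.

Lemma sum_list_remove {A : Type} (f : A -> R) (l1 l2 : list A) (b : A) :
  sum_list f (l1 ++ b :: l2) = f b + sum_list f (l1 ++ l2).
Proof.
  unfold sum_list. induction l1; simpl; auto. rewrite IHl1. ring.
Qed.

(** Two systems of representatives are matched and reduced one class at a time. This makes the
    average in [is_ext_index] independent of the list. *)
Lemma representatives_sum {A : Type} (Q : A -> A -> Prop) (f : A -> R) (l l' : list A) :
  (forall x y, Q x y -> Q y x) -> (forall x y z, Q x y -> Q y z -> Q x z) ->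
  (forall x y, Q x y -> f x = f y) ->
  ForallOrdPairs (fun x y => ~ Q x y) l -> ForallOrdPairs (fun x y => ~ Q x y) l' ->
  (forall x, In x l -> exists y, In y l' /\ Q x y) ->
  (forall y, In y l' -> exists x, In x l /\ Q y x) ->
  sum_list f l = sum_list f l' /\ length l = length l'.
Proof.
  intros Sy Tr Hf. revert l'. induction l as [|a l IH]; intros l' P P' H H'.
  - destruct l' as [|y l']; auto. destruct (H' y) as [x [[] _]]; simpl; auto.
  - destruct (H a) as [b [Hb ab]]; [simpl; auto|].
    apply in_split in Hb as [l1 [l2 ->]].
    apply ForallOrdPairs_remove in P' as [P1 P2]; [|intros x y N M; apply N, Sy, M].
    inversion P; subst. rewrite Forall_forall in H2.
    destruct (IH (l1 ++ l2)) as [S L]; auto.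
    + intros x Hx. destruct (H x) as [y [Hy xy]]; [simpl; auto|].
      exists y; split; auto. apply in_app_iff in Hy as [Hy|[<-|Hy]];
        [apply in_app_iff; auto| |apply in_app_iff; auto].
      elim (H2 x Hx). eauto.
    + intros y Hy. destruct (H' y) as [x [Hx yx]].
      { apply in_app_iff in Hy. apply in_app_iff. simpl; tauto. }
      exists x; split; auto. destruct Hx as [<-|Hx]; auto.
      elim (P2 y Hy). eauto.
    + split.
      * rewrite sum_list_remove, <- S, <- (Hf a b ab). reflexivity.
      * simpl. rewrite L, !length_app. simpl. lia.
Qed.

(* A sector at [p], entered along the direction [w]: [S] stands for one of the
   local regions, inside the ball of radius [r] around [p]. *)
Definition sector (g : curve) (p : point) (r : R) (S : point -> Prop) (w : point) : Prop :=
  (exists e, 0 < e /\ forall l, 0 < l <= e ->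
     S (padd p (pscal l w)) /\ off_curve g (padd p (pscal l w))) /\
  (forall r', 0 < r' <= r -> exists e, 0 < e /\ forall a b,
     dist2 p a < e -> dist2 p b < e -> S a -> S b -> joined g p r' a b) /\
  (forall r' a b, r' <= r -> joined g p r' a b -> S a -> S b).

Lemma common_radius {A : Type} (P : list A) (Q : A -> R -> Prop) :
  (forall x, In x P -> exists e, 0 < e /\ forall l, 0 < l <= e -> Q x l) ->
  exists e, 0 < e /\ forall x l, In x P -> 0 < l <= e -> Q x l.
Proof.
  induction P as [|a P IH]; intros H.
  - exists 1. split; [lra|]. intros x l [].
  - destruct IH as [e1 [e10 H1]]; [intros x Hx; apply H; simpl; auto|].
    destruct (H a) as [e2 [e20 H2]]; [simpl; auto|].
    pose proof (Rmin_l e1 e2). pose proof (Rmin_r e1 e2).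
    exists (Rmin e1 e2). split; [apply Rmin_glb_lt; auto|].
    intros x l [<-|Hx] Hl; [apply H2; lra|apply H1; auto; lra].
Qed.

Lemma dist2_ray (p w : point) (l : R) : 0 <= l -> dist2 p (padd p (pscal l w)) = l * norm2 w.
Proof.
  intros Hl. unfold dist2. rewrite <- (Rabs_pos_eq l) at 2 by auto.
  rewrite <- norm2_scal, <- norm2_opp. f_equal. plane; f_equal; ring.
Qed.

Lemma ray_small (w : point) (e : R) : 0 < e ->
  exists d, 0 < d /\ forall l, 0 < l <= d -> l * norm2 w < e.
Proof.
  intros e0. pose proof (norm2_ge0 w). exists (e / (norm2 w + 1)).
  split; [apply Rdiv_lt_0_compat; lra|]. intros l Hl.
  assert (E : e / (norm2 w + 1) * (norm2 w + 1) = e) by (field; lra). nra.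
Qed.

(** Reduces the extended index to a finite list of disjoint sectors that cover the complement of the
    curve near [p]. One point on each entering ray serves as the representative of its region. *)
Lemma ext_index_sectors (g : curve) (p : point) (r : R)
    (P : list ((point -> Prop) * point * Z)) :
  closed_immersion g -> 0 < r ->
  (forall S w i, In (S, w, i) P -> sector g p r S w /\
     exists e, 0 < e /\ forall b, dist2 p b < e -> S b -> index g b = i) ->
  (forall x, dist2 p x < r -> off_curve g x -> exists S w i, In (S, w, i) P /\ S x) ->
  ForallOrdPairs (fun s s' => forall x, fst (fst s) x -> fst (fst s') x -> False) P ->
  ext_index g p = sum_list (fun s => IZR (snd s)) P / INR (length P).
Proof.
  intros H r0 HP Cov Dis.
  set (rep := fun l (s : (point -> Prop) * point * Z) => padd p (pscal l (snd (fst s)))).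
  assert (LR : forall r', 0 < r' < r -> exists l,
    local_regions g p r' (map (rep l) P) /\
    sum_list (fun a => IZR (index g a)) (map (rep l) P) = sum_list (fun s => IZR (snd s)) P).
  { intros r' Hr'.
    assert (H1 : exists e, 0 < e /\ forall s l, In s P -> 0 < l <= e ->
      fst (fst s) (rep l s) /\ off_curve g (rep l s) /\ index g (rep l s) = snd s).
    { apply common_radius. intros [[S w] i] Hs. destruct (HP S w i Hs) as [[S1 _] [e [e0 He]]].
      destruct S1 as [e1 [e10 He1]]. destruct (ray_small w e e0) as [d [d0 Hd]].
      pose proof (Rmin_l e1 d). pose proof (Rmin_r e1 d).
      exists (Rmin e1 d). split; [apply Rmin_glb_lt; auto|]. intros l Hl. simpl.
      destruct (He1 l) as [A B]; [lra|]. split; [exact A|split; [exact B|]].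
      apply He; auto. unfold rep. simpl. rewrite dist2_ray by lra. apply Hd; lra. }
    assert (H2 : exists e, 0 < e /\ forall s l, In s P -> 0 < l <= e ->
      forall a b, dist2 p a < l -> dist2 p b < l -> fst (fst s) a -> fst (fst s) b ->
      joined g p r' a b).
    { apply common_radius. intros [[S w] i] Hs. destruct (HP S w i Hs) as [[_ [S2 _]] _].
      destruct (S2 r') as [e [e0 He]]; [lra|]. exists e; split; auto.
      intros l Hl a b Ha Hb. apply He; lra. }
    destruct H1 as [e1 [e10 H1]]. destruct H2 as [e2 [e20 H2]].
    assert (H3 : exists e, 0 < e /\ forall s l, In s P -> 0 < l <= e -> l * norm2 (snd (fst s)) < e2).
    { apply common_radius. intros s _. apply (ray_small _ e2 e20). }
    destruct H3 as [e3 [e30 H3]].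
    set (l := Rmin e1 e3). assert (l0 : 0 < l) by (apply Rmin_glb_lt; auto).
    assert (le1 : l <= e1) by apply Rmin_l. assert (le3 : l <= e3) by apply Rmin_r.
    assert (repin : forall s m, In s P -> 0 < m <= l -> dist2 p (rep m s) < e2).
    { intros s m Hs Hm. unfold rep. rewrite dist2_ray by lra. apply H3; auto; lra. }
    exists l. split; [split; [|split]|].
    (* Adjacency: the points of a ray tend to [p] within the same sector. *)
    - apply Forall_forall. intros a Ha. apply in_map_iff in Ha as [s [<- Hs]].
      intros eps eps0. destruct (ray_small (snd (fst s)) eps eps0) as [d [d0 Hd]].
      set (m := Rmin l d). assert (0 < m) by (apply Rmin_glb_lt; auto).
      assert (m <= l) by apply Rmin_l. assert (m <= d) by apply Rmin_r.
      exists (rep m s). split.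
      + unfold rep. rewrite dist2_ray by lra. apply Hd; lra.
      + apply (H2 s e2); auto; try lra; try (apply repin; auto; lra); apply H1; auto; lra.
    - clear - H HP H1 Dis l0 le1 Hr'. induction P as [|s P IH]; simpl; constructor.
      + inversion Dis; subst. rewrite Forall_forall in H3.
        apply Forall_forall. intros b Hb J. apply in_map_iff in Hb as [s' [<- Hs']].
        destruct s as [[S w] i]. destruct (HP S w i) as [[_ [_ S3]] _]; [simpl; auto|].
        apply (H3 s' Hs' (rep l s')).
        * simpl. apply (S3 r' (rep l (S, w, i))); auto; [lra|].
          apply (H1 (S, w, i)); simpl; auto; lra.
        * apply H1; simpl; auto; lra.
      + apply IH.
        * intros S w i Hs. apply HP; simpl; auto.
        * inversion Dis; auto.
        * intros s' l' Hs'. apply H1; simpl; auto.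
    (* A region with [p] in its closure reaches a point near [p]; the representative of the sector
       of that point is in the same region. *)
    - intros a Ha. destruct (Ha e2 e20) as [b [Hb ab]].
      destruct (joined_ends _ _ _ _ _ ab) as [_ [Bb Ob]].
      destruct (Cov b) as [S [w [i [Hs Sb]]]]; auto; [lra|].
      exists (rep l (S, w, i)). split; [apply in_map, Hs|].
      apply (joined_trans _ _ _ _ b); auto.
      apply (H2 (S, w, i) e2); auto; try lra; [apply repin; auto; lra|].
      apply H1; auto; lra.
    - assert (HI : forall s, In s P -> index g (rep l s) = snd s)
        by (intros s Hs; apply H1; auto; lra).
      clear - HI. unfold sum_list. rewrite map_map. f_equal. apply map_ext_in.
      intros s Hs. now rewrite HI. }
  (* The value chosen by [epsilon] is known only below its own radius [r1]; it is compared with the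
     sectors at a radius below both. *)
  assert (X : is_ext_index g p (ext_index g p)).
  { unfold ext_index. apply epsilon_spec.
    exists (sum_list (fun s => IZR (snd s)) P / INR (length P)).
    exists r. split; auto. intros r' Hr'. destruct (LR r' Hr') as [l [L1 L2]].
    exists (map (rep l) P). split; auto. now rewrite L2, length_map. }
  destruct X as [r1 [r10 X]].
  set (r' := Rmin r r1 / 2). pose proof (Rmin_l r r1). pose proof (Rmin_r r r1).
  assert (0 < Rmin r r1) by (apply Rmin_glb_lt; auto).
  destruct (X r') as [l' [[A1 [A2 A3]] ->]]; [unfold r'; lra|].
  destruct (LR r') as [l [[B1 [B2 B3]] <-]]; [unfold r'; lra|].
  rewrite Forall_forall in A1, B1.
  destruct (representatives_sum (joined g p r') (fun a => IZR (index g a)) l' (map (rep l) P))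
    as [-> L]; auto.
  - apply joined_sym.
  - apply joined_trans.
  - intros x y J. f_equal. eapply joined_index; eauto.
  - now rewrite L, length_map.
Qed.

(** * Strands *)

(** [F] is the linear form [cross v], a height to the left of the direction [v], up to an
    [eta]-Lipschitz error. Along a [w] with [0 < cross v w] and [2 * eta * norm2 w <= cross v w] it
    grows at least half as fast as the form. *)
Definition near_linear (p : point) (r eta : R) (F : point -> R) (v : point) : Prop :=
  forall x y, dist2 p x < r -> dist2 p y < r ->
    Rabs (F y - F x - cross v (psub y x)) <= eta * norm2 (psub y x).

Lemma near_linear_opp (p : point) (r eta : R) (F : point -> R) (v : point) :
  near_linear p r eta F v -> near_linear p r eta (fun x => - F x) (popp v).
Proof.
  intros H x y Hx Hy. rewrite <- Rabs_Ropp.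
  replace (- (- F y - - F x - cross (popp v) (psub y x)))
    with (F y - F x - cross v (psub y x)) by (plane; ring). auto.
Qed.

Lemma near_linear_smaller (p : point) (r r' eta : R) (F : point -> R) (v : point) :
  r' <= r -> near_linear p r eta F v -> near_linear p r' eta F v.
Proof. intros Hr H x y Hx Hy. apply H; lra. Qed.

(* The time [u] near [t0] at which the curve has the same abscissa as [x], measured
   along the tangent at [t0], exists and is unique; [F x] is the height of [x] above
   the curve. *)
Lemma strand_exists (g : curve) (t0 eta : R) :
  closed_immersion g -> 0 < eta ->
  exists d r F, 0 < d /\ d < 1 / 2 /\ 0 < r /\ near_linear (g t0) r eta F (vel g t0) /\
    (forall x, dist2 (g t0) x < r -> F x = 0 -> exists u, g u = x) /\
    (forall u, Rabs (u - t0) <= d -> dist2 (g t0) (g u) < r -> F (g u) = 0) /\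
    (forall u u', Rabs (u - t0) <= d -> Rabs (u' - t0) <= d -> g u = g u' -> u = u').
Proof.
  intros H e0. set (v := vel g t0). set (p := g t0).
  assert (v0 : 0 < norm2 v) by (apply norm2_pos, H).
  (* The bound [norm2 v / 2] makes the abscissa [m] strictly increasing; [eta / 2] absorbs the
     factor 2 lost when times are bounded by distances. *)
  set (nu := Rmin (norm2 v / 2) (eta / 2)).
  assert (nu0 : 0 < nu) by (apply Rmin_glb_lt; lra).
  assert (nu1 : nu <= norm2 v / 2) by apply Rmin_l.
  assert (nu2 : nu <= eta / 2) by apply Rmin_r.
  destruct (strict_derivative_curve g t0 nu H nu0) as [d1 [d10 Hd1]]. fold v in Hd1.
  set (d := Rmin (d1 / 2) (1 / 4)).
  assert (d0 : 0 < d) by (apply Rmin_glb_lt; lra).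
  assert (dd1 : d < d1) by (pose proof (Rmin_l (d1 / 2) (1 / 4)); unfold d; lra).
  assert (d14 : d < 1 / 2) by (pose proof (Rmin_r (d1 / 2) (1 / 4)); unfold d; lra).
  assert (Hd : forall t t', Rabs (t - t0) <= d -> Rabs (t' - t0) <= d ->
    norm2 (psub (psub (g t') (g t)) (pscal (t' - t) v)) <= nu * Rabs (t' - t)).
  { intros t t' Ht Ht'. apply Hd1; lra. }
  set (m := fun u => dot v (psub (g u) p)).
  assert (vv := norm2_sq v).
  assert (Hm : forall t t', Rabs (t - t0) <= d -> Rabs (t' - t0) <= d ->
    Rabs (m t' - m t - (t' - t) * dot v v) <= dot v v / 2 * Rabs (t' - t)).
  { intros t t' Ht Ht'.
    replace (m t' - m t - (t' - t) * dot v v) with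
      (dot v (psub (psub (g t') (g t)) (pscal (t' - t) v)))
      by (unfold m; clearbody p v; plane; ring).
    eapply Rle_trans; [apply dot_le|]. specialize (Hd t t' Ht Ht').
    pose proof (norm2_ge0 (psub (psub (g t') (g t)) (pscal (t' - t) v))).
    rewrite <- vv. pose proof (Rabs_pos (t' - t)).
    apply Rle_trans with (norm2 v * (nu * Rabs (t' - t))); [nra|].
    apply Rle_trans with (norm2 v * (norm2 v / 2 * Rabs (t' - t))); [|lra].
    apply Rmult_le_compat_l; [lra|]. apply Rmult_le_compat_r; lra. }
  assert (Minc : forall t t', Rabs (t - t0) <= d -> Rabs (t' - t0) <= d ->
    dot v v / 2 * Rabs (t' - t) <= Rabs (m t' - m t)).
  { intros t t' Ht Ht'. specialize (Hm t t' Ht Ht').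
    pose proof (Rabs_triang_inv ((t' - t) * dot v v) ((t' - t) * dot v v - (m t' - m t))) as T.
    replace ((t' - t) * dot v v - ((t' - t) * dot v v - (m t' - m t))) with (m t' - m t) in T by ring.
    rewrite (Rabs_minus_sym ((t' - t) * dot v v)) in T.
    rewrite Rabs_mult, (Rabs_pos_eq (dot v v)) in T by apply dot_self_ge0. lra. }
  assert (vv0 : 0 < dot v v) by (rewrite <- vv; nra).
  assert (Mcont : forall u, continuous m u).
  { intros u. unfold m, dot, psub; simpl.
    apply (continuous_plus (V := R_NormedModule)); apply (continuous_mult (K := R_AbsRing));
      try apply continuous_const; apply (continuous_minus (V := R_NormedModule));
      try apply continuous_const.
    - eapply is_derive_continuous, vel_fst, H.
    - eapply is_derive_continuous, vel_snd, H. }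
  assert (m0 : m t0 = 0) by (unfold m; fold p; clearbody p v; plane; ring).
  assert (T0 : Rabs (t0 - t0) <= d) by (rewrite Rminus_diag, Rabs_R0; lra).
  (* Every abscissa met in the ball of this radius is attained by the curve on
     [[t0 - d, t0 + d]]. *)
  set (r := norm2 v * d / 2).
  assert (r0 : 0 < r) by (unfold r; apply Rdiv_lt_0_compat; [apply Rmult_lt_0_compat; lra|lra]).
  set (good := fun x u => Rabs (u - t0) <= d /\ m u = dot v (psub x p)).
  assert (Ex : forall x, dist2 p x < r -> exists u, good x u).
  { intros x Hx.
    assert (Dx : Rabs (dot v (psub x p)) <= dot v v * d / 2).
    { eapply Rle_trans; [apply dot_le|]. rewrite dist2_sym in Hx. unfold dist2, r in Hx.
      rewrite <- vv. replace (norm2 v * norm2 v * d / 2) with (norm2 v * (norm2 v * d / 2)) by lra.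
      apply Rmult_le_compat_l; lra. }
    apply Rcomplements.Rabs_le_between in Dx.
    assert (Up : dot v v * d / 2 <= m (t0 + d)).
    { assert (A : Rabs (t0 + d - t0) <= d)
        by (replace (t0 + d - t0) with d by ring; rewrite Rabs_pos_eq; lra).
      specialize (Hm t0 (t0 + d) T0 A). rewrite m0 in Hm.
      replace (t0 + d - t0) with d in Hm by ring. rewrite (Rabs_pos_eq d) in Hm by lra.
      apply Rcomplements.Rabs_le_between in Hm. lra. }
    assert (Lo : m (t0 - d) <= - (dot v v * d / 2)).
    { assert (A : Rabs (t0 - d - t0) <= d)
        by (replace (t0 - d - t0) with (- d) by ring; rewrite Rabs_Ropp, Rabs_pos_eq; lra).
      specialize (Hm t0 (t0 - d) T0 A). rewrite m0 in Hm.
      replace (t0 - d - t0) with (- d) in Hm by ring. rewrite (Rabs_Ropp d), (Rabs_pos_eq d) in Hm by lra.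
      apply Rcomplements.Rabs_le_between in Hm. lra. }
    destruct (continuous_between m (t0 - d) (t0 + d) (dot v (psub x p)) Mcont) as [u [Hu E]]; [lra| |].
    - rewrite Rmin_left, Rmax_right by nra. lra.
    - exists u. split; auto. apply Rcomplements.Rabs_le_between. lra. }
  set (tau := fun x => epsilon (inhabits t0) (good x)).
  assert (Ht : forall x, dist2 p x < r -> good x (tau x)).
  { intros x Hx. apply epsilon_spec, Ex, Hx. }
  exists d, r, (fun x => cross v (psub x (g (tau x)))).
  split; [auto|]. split; [auto|]. split; [auto|].
  assert (Inj : forall u u', Rabs (u - t0) <= d -> Rabs (u' - t0) <= d -> m u = m u' -> u = u').
  { intros u u' Hu Hu' E. specialize (Minc u u' Hu Hu').
    rewrite E, Rminus_diag, Rabs_R0 in Minc. pose proof (Rabs_pos (u' - u)).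
    assert (Z : Rabs (u' - u) = 0) by nra.
    destruct (Req_dec (u' - u) 0) as [|n]; [lra|]. apply Rabs_no_R0 in n. lra. }
  split; [|split; [|split]].
  - intros x y Hx Hy. destruct (Ht x Hx) as [A1 A2]. destruct (Ht y Hy) as [B1 B2].
    set (a := tau x) in *. set (b := tau y) in *.
    replace (cross v (psub y (g b)) - cross v (psub x (g a)) - cross v (psub y x))
      with (- cross v (psub (psub (g b) (g a)) (pscal (b - a) v)))
      by (clearbody p v; plane; ring).
    rewrite Rabs_Ropp. eapply Rle_trans; [apply cross_le|].
    specialize (Hd a b A1 B1). specialize (Minc a b A1 B1).
    assert (Dm : Rabs (m b - m a) <= norm2 v * norm2 (psub y x)).
    { rewrite A2, B2. replace (dot v (psub y p) - dot v (psub x p)) with (dot v (psub y x))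
        by (clearbody p v; plane; ring). apply dot_le. }
    rewrite <- vv in Minc. pose proof (Rabs_pos (b - a)). pose proof (norm2_ge0 (psub y x)).
    assert (AB : norm2 v * Rabs (b - a) <= 2 * norm2 (psub y x)) by nra.
    apply Rle_trans with (norm2 v * (nu * Rabs (b - a))).
    + apply Rmult_le_compat_l; lra.
    + apply Rle_trans with (nu * (2 * norm2 (psub y x))).
      * replace (norm2 v * (nu * Rabs (b - a))) with (nu * (norm2 v * Rabs (b - a))) by ring.
        apply Rmult_le_compat_l; lra.
      * apply Rle_trans with (eta / 2 * (2 * norm2 (psub y x))); [|lra].
        apply Rmult_le_compat_r; lra.
  - intros x Hx Hz. destruct (Ht x Hx) as [A1 A2]. exists (tau x).
    cbv beta in Hz.
    (* This vector is orthogonal to [v] by the choice of [tau], and parallel to [v] since the height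
       is zero. *)
    assert (E : psub x (g (tau x)) = (0, 0)).
    { assert (D0 : dot v (psub x (g (tau x))) = 0).
      { transitivity (dot v (psub x p) - m (tau x)); [|rewrite A2; ring].
        unfold m. clearbody p v. plane; ring. }
      pose proof (lagrange v (psub x (g (tau x)))) as L. rewrite D0, Hz in L.
      apply norm2_eq0. assert (X : norm2 v * norm2 (psub x (g (tau x))) = 0) by nra.
      apply Rmult_integral in X as [X|X]; auto; lra. }
    symmetry. now apply psub_eq0.
  - intros u Hu Hgu. destruct (Ht (g u) Hgu) as [A1 A2].
    assert (tau (g u) = u) as -> by (apply Inj; auto).
    clearbody v. plane; ring.
  - intros u u' Hu Hu' E. apply Inj; auto. unfold m. now rewrite E.
Qed.

(** Compactness of the circle: at times far from [t1] and [t2] the curve stays at a positive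
    distance from [p]. A regular point is the case [t1 = t2]. *)
Lemma times_near (g : curve) (p : point) (t1 t2 d : R) :
  closed_immersion g -> 0 < d ->
  (forall u, g u = p -> same_time t1 u \/ same_time t2 u) ->
  exists r, 0 < r /\ forall u, dist2 p (g u) < r ->
    exists u', same_time u u' /\ (Rabs (u' - t1) < d \/ Rabs (u' - t2) < d).
Proof.
  intros H d0 Hp.
  destruct (tube (fun e z => Rabs z < e) (fun z u => dist2 p (g u) < Rabs z ->
      exists u', same_time u u' /\ (Rabs (u' - t1) < d \/ Rabs (u' - t2) < d)) 0 1)
    as [r [r0 Hr]].
  - intros e e' z He Hz; lra.
  - intros u0 _. destruct (classic (g u0 = p)) as [E|N].
    + exists d. split; auto. intros z u _ Hu _.
      destruct (Hp u0 E) as [S|S]; apply same_time_sym in S as [k Hk].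
      * exists (u + IZR k). split; [now exists k|]. left. rewrite Hk.
        now replace (u + IZR k - (u0 + IZR k)) with (u - u0) by ring.
      * exists (u + IZR k). split; [now exists k|]. right. rewrite Hk.
        now replace (u + IZR k - (u0 + IZR k)) with (u - u0) by ring.
    + assert (P : 0 < dist2 p (g u0)).
      { apply norm2_pos. intros E. apply N. symmetry. now apply psub_eq0. }
      destruct (curve_continuous g u0 (dist2 p (g u0) / 2) H) as [e [e0 He]]; [lra|].
      exists (Rmin e (dist2 p (g u0) / 2)). split; [apply Rmin_glb_lt; lra|].
      intros z u Hz Hu Hd.
      pose proof (Rmin_l e (dist2 p (g u0) / 2)). pose proof (Rmin_r e (dist2 p (g u0) / 2)).
      assert (dist2 (g u) (g u0) < dist2 p (g u0) / 2) by (apply He; lra).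
      pose proof (dist2_triang p (g u) (g u0)). lra.
  - exists (r / 2). split; [lra|]. intros u Hu.
    destruct (Z_fraction u 0) as [k Hk].
    assert (R2 : Rabs (r / 2) = r / 2) by (apply Rabs_pos_eq; lra).
    destruct (Hr (r / 2) (u + IZR k)) as [u' [S Hu']]; [lra|lra| |].
    + rewrite R2, curve_period; auto.
    + exists u'; split; auto. apply (same_time_trans _ (u + IZR k)); auto. now exists k.
Qed.

Lemma near_linear_lower (p : point) (r eta : R) (F : point -> R) (v x y : point) :
  near_linear p r eta F v -> dist2 p x < r -> dist2 p y < r ->
  F x + cross v (psub y x) - eta * norm2 (psub y x) <= F y.
Proof.
  intros H Hx Hy. specialize (H x y Hx Hy). apply Rcomplements.Rabs_le_between in H. lra.
Qed.

Lemma near_linear_continuous (p : point) (r eta : R) (F : point -> R) (v x : point) (eps : R) :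
  near_linear p r eta F v -> 0 < eta -> dist2 p x < r -> 0 < eps ->
  exists d, 0 < d /\ forall y, dist2 p y < r -> dist2 x y < d -> Rabs (F y - F x) < eps.
Proof.
  intros H e0 Hx eps0. pose proof (norm2_ge0 v).
  exists (eps / (norm2 v + eta)). split; [apply Rdiv_lt_0_compat; lra|].
  intros y Hy xy. specialize (H x y Hx Hy). pose proof (cross_le v (psub y x)) as C.
  rewrite dist2_sym in xy. unfold dist2 in xy.
  assert (E : eps / (norm2 v + eta) * (norm2 v + eta) = eps) by (field; lra).
  pose proof (norm2_ge0 (psub y x)).
  replace (F y - F x) with ((F y - F x - cross v (psub y x)) + cross v (psub y x)) by ring.
  eapply Rle_lt_trans; [apply Rabs_triang|].
  apply Rle_lt_trans with ((norm2 v + eta) * norm2 (psub y x)); [lra|].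
  rewrite <- E, Rmult_comm. apply Rmult_lt_compat_r; lra.
Qed.

(** The zeros of [F] in the ball lie on the curve, so the sign of [F] is locally constant along a
    path avoiding it. *)
Lemma sign_joined (g : curve) (p : point) (r r' eta : R) (F : point -> R) (v a b : point) :
  near_linear p r eta F v -> 0 < eta -> r' <= r ->
  (forall x, dist2 p x < r -> F x = 0 -> exists u, g u = x) ->
  joined g p r' a b -> 0 < F a -> 0 < F b.
Proof.
  intros L e0 Hr Z [c [C [<- [<- I]]]] Ha.
  set (s := fun u => if Rlt_dec 0 (F (c u)) then true else false).
  assert (E : s 1 = s 0).
  { apply loc_const; [lra|]. intros u Hu. destruct (I u Hu) as [Du Ou].
    assert (nz : F (c u) <> 0).
    { intros E. destruct (Z (c u)) as [t Ht]; auto; [lra|]. apply (Ou t Ht). }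
    destruct (near_linear_continuous p r eta F v (c u) (Rabs (F (c u))) L e0) as [d [d0 Hd]];
      [lra|now apply Rabs_pos_lt|].
    destruct (C u) as [C1 C2].
    destruct (path_close c u d C1 C2 d0) as [e [ee He]].
    exists e; split; auto. intros w Hw wu.
    assert (B : Rabs (F (c w) - F (c u)) < Rabs (F (c u))).
    { apply Hd; [destruct (I w Hw); lra|apply He, wu]. }
    apply Rabs_def2 in B.
    unfold s. destruct (Rlt_dec 0 (F (c u))).
    - rewrite Rabs_pos_eq in B by lra. destruct (Rlt_dec 0 (F (c w))); auto; lra.
    - rewrite Rabs_left in B by lra. destruct (Rlt_dec 0 (F (c w))); auto; lra. }
  unfold s in E. destruct (Rlt_dec 0 (F (c 0))); [|lra].
  destruct (Rlt_dec 0 (F (c 1))); auto; discriminate.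
Qed.

(** Moving along [w] increases both functions. Two points close to [p] are joined by pushing each by
    [rho * w] and going straight between the two tops, which lie so close to [p + rho * w] that both
    functions stay positive. With [F1 = F2] this is one side of a single strand. *)
Lemma sector_of_strands (g : curve) (p : point) (r eta : R)
    (F1 F2 : point -> R) (v1 v2 w : point) :
  0 < r -> 0 < eta ->
  near_linear p r eta F1 v1 -> near_linear p r eta F2 v2 -> F1 p = 0 -> F2 p = 0 ->
  0 < cross v1 w -> 0 < cross v2 w ->
  2 * eta * norm2 w <= cross v1 w -> 2 * eta * norm2 w <= cross v2 w ->
  (forall x, dist2 p x < r -> F1 x = 0 \/ F2 x = 0 -> exists u, g u = x) ->
  (forall u, dist2 p (g u) < r -> F1 (g u) = 0 \/ F2 (g u) = 0) ->
  sector g p r (fun x => dist2 p x < r /\ 0 < F1 x /\ 0 < F2 x) w.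
Proof.
  intros r0 e0 L1 L2 P1 P2 W1 W2 B1 B2 Z Z'.
  assert (pr : dist2 p p < r) by (rewrite dist2_refl; lra).
  assert (w0 : 0 < norm2 w).
  { apply norm2_pos. intros ->. unfold cross in W1; simpl in W1; lra. }
  assert (off : forall x, dist2 p x < r -> 0 < F1 x -> 0 < F2 x -> off_curve g x).
  { intros x Hx A1 A2 u E. subst x. destruct (Z' u Hx); lra. }
  assert (move : forall F v x l, near_linear p r eta F v -> 0 < cross v w ->
    2 * eta * norm2 w <= cross v w -> 0 <= l ->
    dist2 p x < r -> dist2 p (padd x (pscal l w)) < r ->
    F x + l * (cross v w / 2) <= F (padd x (pscal l w))).
  { intros F v x l L W B l0 Hx Hy. pose proof (near_linear_lower _ _ _ _ _ _ _ L Hx Hy) as N.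
    replace (psub (padd x (pscal l w)) x) with (pscal l w) in N by (plane; f_equal; ring).
    rewrite norm2_scal, Rabs_pos_eq in N by auto.
    replace (cross v (pscal l w)) with (l * cross v w) in N by (plane; ring). nra. }
  split; [|split].
  - destruct (ray_small w r r0) as [e [ee He]]. exists e; split; auto. intros l Hl.
    assert (D : dist2 p (padd p (pscal l w)) < r) by (rewrite dist2_ray by lra; auto).
    pose proof (move F1 v1 p l L1 W1 B1 ltac:(lra) pr D).
    pose proof (move F2 v2 p l L2 W2 B2 ltac:(lra) pr D).
    assert (0 < l * (cross v1 w / 2)) by (apply Rmult_lt_0_compat; lra).
    assert (0 < l * (cross v2 w / 2)) by (apply Rmult_lt_0_compat; lra).
    assert (0 < F1 (padd p (pscal l w))) by lra.
    assert (0 < F2 (padd p (pscal l w))) by lra.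
    auto.
  - intros r' Hr'.
    (* The push has length [r' / 2], leaving the other half of the radius for the starting
       points. *)
    set (rho := r' / (2 * norm2 w)).
    assert (rho0 : 0 < rho) by (apply Rdiv_lt_0_compat; lra).
    assert (Erho : rho * norm2 w = r' / 2) by (unfold rho; field; lra).
    (* [M] exceeds the Lipschitz constants of [F1] and [F2], and both are at least [rho * c / 2] at
       [p + rho * w]; the radius [e] keeps the variation below that. *)
    set (M := norm2 v1 + norm2 v2 + eta + 1).
    pose proof (norm2_ge0 v1). pose proof (norm2_ge0 v2).
    assert (Mp : 0 < M) by (unfold M; lra).
    set (c := Rmin (cross v1 w) (cross v2 w)).
    assert (c0 : 0 < c) by (apply Rmin_glb_lt; auto).
    assert (c1 : c <= cross v1 w) by apply Rmin_l.
    assert (c2 : c <= cross v2 w) by apply Rmin_r.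
    set (e := Rmin (r' / 2) (rho * c / (2 * M))).
    assert (ee : 0 < e).
    { apply Rmin_glb_lt; [lra|]. apply Rdiv_lt_0_compat; [apply Rmult_lt_0_compat; auto|lra]. }
    assert (e1 : e <= r' / 2) by apply Rmin_l.
    assert (e2 : M * e <= rho * c / 2).
    { replace (rho * c / 2) with (M * (rho * c / (2 * M))) by (field; lra).
      apply Rmult_le_compat_l; [lra|apply Rmin_r]. }
    exists e; split; auto.
    assert (up : forall a, dist2 p a < e -> 0 < F1 a -> 0 < F2 a ->
      joined g p r' a (padd a (pscal rho w))).
    { intros a Ha A1 A2. apply joined_segment. intros l Hl; cbv zeta.
      replace (padd a (pscal l (psub (padd a (pscal rho w)) a))) with (padd a (pscal (l * rho) w))
        by (plane; f_equal; ring).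
      assert (lr : 0 <= l * rho <= rho) by nra.
      assert (D : dist2 p (padd a (pscal (l * rho) w)) < r').
      { pose proof (dist2_triang p a (padd a (pscal (l * rho) w))) as T.
        rewrite (dist2_ray a) in T by lra.
        assert (l * rho * norm2 w <= rho * norm2 w) by (apply Rmult_le_compat_r; lra). lra. }
      split; auto.
      pose proof (move F1 v1 a (l * rho) L1 W1 B1 ltac:(lra) ltac:(lra) ltac:(lra)).
      pose proof (move F2 v2 a (l * rho) L2 W2 B2 ltac:(lra) ltac:(lra) ltac:(lra)).
      apply off; [lra|nra|nra]. }
    assert (top : forall F v y, near_linear p r eta F v -> F p = 0 -> 0 < cross v w ->
      2 * eta * norm2 w <= cross v w -> c <= cross v w -> norm2 v + eta < M -> norm2 y < e ->
      0 < F (padd (padd p (pscal rho w)) y)).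
    { intros F v y L Fp W B cw vM Hy.
      assert (D : dist2 p (padd (padd p (pscal rho w)) y) < r).
      { unfold dist2. rewrite norm2_sub_comm.
        replace (psub (padd (padd p (pscal rho w)) y) p) with (padd (pscal rho w) y)
          by (plane; f_equal; ring).
        pose proof (norm2_triang (pscal rho w) y) as T.
        rewrite norm2_scal, Rabs_pos_eq in T by lra. lra. }
      pose proof (near_linear_lower _ _ _ _ _ _ _ L pr D) as N.
      replace (psub (padd (padd p (pscal rho w)) y) p) with (padd (pscal rho w) y) in N
        by (plane; f_equal; ring).
      pose proof (norm2_triang (pscal rho w) y) as T.
      rewrite norm2_scal, Rabs_pos_eq in T by lra.
      replace (cross v (padd (pscal rho w) y)) with (rho * cross v w + cross v y) in N
        by (plane; ring).
      pose proof (cross_le v y) as C. apply Rcomplements.Rabs_le_between in C.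
      pose proof (norm2_ge0 y). pose proof (norm2_ge0 v).
      assert (X1 : (norm2 v + eta) * norm2 y <= (norm2 v + eta) * e)
        by (apply Rmult_le_compat_l; lra).
      assert (X2 : (norm2 v + eta) * e < M * e) by (apply Rmult_lt_compat_r; lra).
      assert (X3 : rho * c <= rho * cross v w) by (apply Rmult_le_compat_l; lra).
      assert (X4 : eta * norm2 (padd (pscal rho w) y) <= eta * (rho * norm2 w + norm2 y))
        by (apply Rmult_le_compat_l; lra).
      assert (X5 : rho * (2 * eta * norm2 w) <= rho * cross v w)
        by (apply Rmult_le_compat_l; lra).
      lra. }
    intros a b Ha Hb [_ [A1 A2]] [_ [A3 A4]].
    apply (joined_trans _ _ _ _ (padd a (pscal rho w))); [now apply up|].
    apply (joined_trans _ _ _ _ (padd b (pscal rho w))); [|now apply joined_sym, up].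
    apply joined_segment. intros l Hl; cbv zeta.
    set (y := padd (pscal (1 - l) (psub a p)) (pscal l (psub b p))).
    replace (padd (padd a (pscal rho w)) (pscal l (psub (padd b (pscal rho w)) (padd a (pscal rho w)))))
      with (padd (padd p (pscal rho w)) y) by (unfold y; plane; f_equal; ring).
    assert (Hy : norm2 y < e).
    { unfold y. eapply Rle_lt_trans; [apply norm2_triang|]. rewrite !norm2_scal.
      rewrite dist2_sym in Ha, Hb. unfold dist2 in Ha, Hb.
      rewrite !Rabs_pos_eq by lra.
      set (A := norm2 (psub a p)) in *. set (B := norm2 (psub b p)) in *.
      assert (0 <= l * (e - B)) by (apply Rmult_le_pos; lra).
      assert (0 <= (1 - l) * (e - A)) by (apply Rmult_le_pos; lra).
      destruct (Rle_dec l (1 / 2)).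
      - assert (0 < (1 - l) * (e - A)) by (apply Rmult_lt_0_compat; lra). lra.
      - assert (0 < l * (e - B)) by (apply Rmult_lt_0_compat; lra). lra. }
    assert (D : dist2 p (padd (padd p (pscal rho w)) y) < r').
    { unfold dist2. rewrite norm2_sub_comm.
      replace (psub (padd (padd p (pscal rho w)) y) p) with (padd (pscal rho w) y)
        by (clearbody y; plane; f_equal; ring).
      pose proof (norm2_triang (pscal rho w) y) as T.
      rewrite norm2_scal, Rabs_pos_eq in T by lra. lra. }
    split; auto. apply off; [lra| |].
    + apply (top F1 v1); auto; unfold M; lra.
    + apply (top F2 v2); auto; unfold M; lra.
  - intros r' a b Hr J [_ [A1 A2]].
    destruct (joined_ends _ _ _ _ _ J) as [_ [Hb _]].
    split; [lra|split].
    + apply (sign_joined g p r r' eta F1 v1 a b); auto.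
    + apply (sign_joined g p r r' eta F2 v2 a b); auto.
Qed.

(** * The extended index along the curve *)

Definition regular_time (g : curve) (t : R) : Prop :=
  forall u, g u = g t -> same_time t u.

Lemma sector_index (g : curve) (p : point) (r : R) (S : point -> Prop) (w : point) :
  closed_immersion g -> 0 < r -> sector g p r S w ->
  exists i e, 0 < e /\ forall b, dist2 p b < e -> S b -> index g b = i.
Proof.
  intros H r0 [[e1 [e10 S1]] [S2 _]]. destruct (S2 r) as [e [e0 He]]; [lra|].
  destruct (ray_small w e e0) as [d [d0 Hd]].
  set (l := Rmin e1 d). assert (0 < l) by (apply Rmin_glb_lt; auto).
  assert (l <= e1) by apply Rmin_l. assert (l <= d) by apply Rmin_r.
  exists (index g (padd p (pscal l w))), e. split; auto. intros b Hb Sb.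
  apply (joined_index g p r); auto. apply He; auto.
  - rewrite dist2_ray by lra. apply Hd; lra.
  - apply S1; lra.
Qed.

Lemma psub_ray (p w : point) (l : R) : psub p (pscal l w) = padd p (pscal l (popp w)).
Proof. plane; f_equal; ring. Qed.

(** The strand at [g t0] bounds two sectors. A short transversal segment meets the curve only at
    [t0], so their indices differ by one and the average is the right one plus a half. *)
Lemma ext_index_regular (g : curve) (t0 : R) (w : point) :
  closed_immersion g -> regular_time g t0 -> 0 < cross (vel g t0) w ->
  exists e, 0 < e /\ forall l, 0 < l <= e ->
    off_curve g (padd (g t0) (pscal l w)) /\ off_curve g (psub (g t0) (pscal l w)) /\
    index g (padd (g t0) (pscal l w)) = (index g (psub (g t0) (pscal l w)) + 1)%Z /\
    ext_index g (g t0) = IZR (index g (psub (g t0) (pscal l w))) + 1 / 2.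
Proof.
  intros H Reg W. set (p := g t0). set (v := vel g t0) in *.
  assert (w0 : 0 < norm2 w).
  { apply norm2_pos. intros ->. unfold cross in W; simpl in W; lra. }
  set (eta := cross v w / (2 * norm2 w)).
  assert (e0 : 0 < eta) by (apply Rdiv_lt_0_compat; lra).
  assert (Eeta : 2 * eta * norm2 w = cross v w) by (unfold eta; field; lra).
  destruct (strand_exists g t0 eta H e0) as [d [r1 [F [d0 [d12 [r10 [L [Z [Z' Inj]]]]]]]]].
  fold p v in L, Z, Z'.
  destruct (times_near g p t0 t0 d H d0) as [r2 [r20 T]].
  { intros u E. left. apply Reg, E. }
  set (r := Rmin r1 r2). assert (r0 : 0 < r) by (apply Rmin_glb_lt; auto).
  assert (rr1 : r <= r1) by apply Rmin_l. assert (rr2 : r <= r2) by apply Rmin_r.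
  apply (near_linear_smaller _ _ r) in L; auto.
  assert (Fp : F p = 0).
  { apply Z'; [rewrite Rminus_diag, Rabs_R0; lra|fold p; rewrite dist2_refl; lra]. }
  assert (ZF : forall x, dist2 p x < r -> F x = 0 -> exists u, g u = x)
    by (intros x Hx; apply Z; lra).
  assert (FZ : forall u, dist2 p (g u) < r -> F (g u) = 0).
  { intros u Hu. destruct (T u) as [u' [S D]]; [lra|].
    rewrite <- (curve_same_time g u u' H S) in *. apply Z'; lra. }
  assert (C' : cross (popp v) (popp w) = cross v w) by (plane; ring).
  (* The same strand fills both places of the two-strand lemma. *)
  assert (S1 := sector_of_strands g p r eta F F v v w).
  destruct (sector_index g p r _ w H r0 (S1 r0 e0 L L Fp Fp W W ltac:(lra) ltac:(lra)
    ltac:(intros x Hx [A|A]; auto) ltac:(auto))) as [i [e1 [e10 I1]]].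
  specialize (S1 r0 e0 L L Fp Fp W W ltac:(lra) ltac:(lra)
    ltac:(intros x Hx [A|A]; auto) ltac:(auto)).
  assert (S2 : sector g p r (fun x => dist2 p x < r /\ 0 < - F x /\ 0 < - F x) (popp w)).
  { apply (sector_of_strands g p r eta _ _ (popp v) (popp v)); auto;
      try (apply near_linear_opp; auto); try (rewrite ?C', ?norm2_opp; lra).
    - intros x Hx [A|A]; apply ZF; auto; lra.
    - intros u Hu. left. rewrite FZ; auto; ring. }
  destruct (sector_index g p r _ _ H r0 S2) as [j [e2 [e20 I2]]].
  assert (Ext : ext_index g p = (IZR i + (IZR j + 0)) / (1 + 1)).
  { rewrite (ext_index_sectors g p r
      ((fun x => dist2 p x < r /\ 0 < F x /\ 0 < F x, w, i) ::
       (fun x => dist2 p x < r /\ 0 < - F x /\ 0 < - F x, popp w, j) :: nil)); auto.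
    - intros S w' k [E|[E|[]]]; injection E as <- <- <-; split; auto;
        [exists e1|exists e2]; auto.
    - intros x Hx O. assert (F x <> 0).
      { intros E. destruct (ZF x Hx E) as [u Hu]. apply (O u Hu). }
      destruct (Rlt_dec 0 (F x)); eexists; eexists; eexists; split.
      + left; reflexivity.
      + simpl; auto.
      + right; left; reflexivity.
      + simpl. split; [auto|lra].
    - constructor; [|constructor; [constructor|constructor]].
      constructor; [|constructor]. simpl. intros x [_ [A _]] [_ [B _]]. lra. }
  destruct S1 as [[a1 [a10 A1]] _]. destruct S2 as [[a2 [a20 A2]] _].
  assert (e120 : 0 < Rmin e1 e2) by (apply Rmin_glb_lt; auto).
  destruct (ray_small w (Rmin e1 (Rmin e2 r))) as [b [b0 B]]; [repeat apply Rmin_glb_lt; auto|].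
  exists (Rmin b (Rmin a1 a2)). split; [repeat apply Rmin_glb_lt; auto|].
  intros l [l0 Hl].
  assert (lb : l <= b) by (eapply Rle_trans; [exact Hl|apply Rmin_l]).
  assert (la1 : l <= a1)
    by (eapply Rle_trans; [exact Hl|eapply Rle_trans; [apply Rmin_r|apply Rmin_l]]).
  assert (la2 : l <= a2)
    by (eapply Rle_trans; [exact Hl|eapply Rle_trans; [apply Rmin_r|apply Rmin_r]]).
  specialize (B l (conj l0 lb)).
  assert (B1 : l * norm2 w < e1) by (eapply Rlt_le_trans; [exact B|apply Rmin_l]).
  assert (B2 : l * norm2 w < e2)
    by (eapply Rlt_le_trans; [exact B|eapply Rle_trans; [apply Rmin_r|apply Rmin_l]]).
  assert (B3 : l * norm2 w < r)
    by (eapply Rlt_le_trans; [exact B|eapply Rle_trans; [apply Rmin_r|apply Rmin_r]]).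
  assert (Ei : index g (padd p (pscal l w)) = i).
  { apply I1; [rewrite dist2_ray by lra; auto|apply A1; lra]. }
  assert (Ej : index g (psub p (pscal l w)) = j).
  { rewrite psub_ray. apply I2; [rewrite dist2_ray, norm2_opp by lra; auto|apply A2; lra]. }
  destruct (index_crossing g t0 (pscal l w)) as [O1 [O2 E]]; auto.
  - replace (cross (vel g t0) (pscal l w)) with (l * cross v w) by (unfold v; plane; ring).
    apply Rmult_lt_0_compat; auto.
  - intros m u Hm E. fold p in E. apply Reg. rewrite E. fold p.
    assert (D : dist2 p (g u) < r).
    { rewrite E. unfold dist2. rewrite norm2_sub_comm.
      replace (psub (padd p (pscal m (pscal l w))) p) with (pscal (m * l) w)
        by (clearbody p; plane; f_equal; ring).
      rewrite norm2_scal, Rabs_mult, (Rabs_pos_eq l) by lra.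
      assert (Rabs m <= 1) by (apply Rabs_le; lra). pose proof (Rabs_pos m).
      assert (Rabs m * (l * norm2 w) <= 1 * (l * norm2 w)); [|lra].
      apply Rmult_le_compat_r; [apply Rmult_le_pos; lra|auto]. }
    (* The height has nonzero slope along [w], so a point of the segment with height zero is [p]. *)
    specialize (L p (g u)). rewrite (FZ u D), Fp, dist2_refl in L.
    specialize (L r0 D). rewrite E in L.
    replace (psub (padd p (pscal m (pscal l w))) p) with (pscal (m * l) w) in L
      by (clearbody p; plane; f_equal; ring).
    rewrite norm2_scal in L.
    replace (0 - 0 - cross v (pscal (m * l) w)) with (- (m * l * cross v w)) in L
      by (clearbody v; plane; ring).
    rewrite Rabs_Ropp, Rabs_mult, (Rabs_pos_eq (cross v w)) in L by lra.
    replace (eta * (Rabs (m * l) * norm2 w)) with (Rabs (m * l) * (2 * eta * norm2 w) / 2) in L by lra.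
    rewrite Eeta in L. pose proof (Rabs_pos (m * l)).
    assert (Z0 : Rabs (m * l) = 0) by nra.
    assert (ml : m * l = 0).
    { destruct (Req_dec (m * l) 0) as [|n]; auto. apply Rabs_no_R0 in n. lra. }
    replace (pscal m (pscal l w)) with (pscal (m * l) w) by (plane; f_equal; ring).
    rewrite ml. clearbody p. plane; f_equal; ring.
  - fold p in O1, O2, E. repeat split; auto.
    rewrite Ext, Ej. rewrite Ei, Ej in E. rewrite E, plus_IZR. lra.
Qed.

(** The branch through [g t0] is transversal to the strand, so the linear part
    [(t - t0) * cross v (vel g t0)] dominates and decides on which side [g t] lies. *)
Lemma strand_side (g : curve) (t0 r eta : R) (F : point -> R) (v : point) :
  closed_immersion g -> near_linear (g t0) r eta F v -> F (g t0) = 0 -> 0 < r -> 0 < eta ->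
  cross v (vel g t0) <> 0 -> 2 * eta * norm2 (vel g t0) <= Rabs (cross v (vel g t0)) ->
  exists d, 0 < d /\ forall t, 0 < Rabs (t - t0) < d -> dist2 (g t0) (g t) < r ->
    0 < F (g t) * ((t - t0) * cross v (vel g t0)).
Proof.
  intros H L F0 r0 e0 nz B. set (c := cross v (vel g t0)) in *. set (p := g t0) in *.
  assert (c0 : 0 < Rabs c) by now apply Rabs_pos_lt.
  pose proof (norm2_ge0 v) as v0.
  set (nu := Rabs c / (4 * (eta + norm2 v))).
  assert (nu0 : 0 < nu) by (apply Rdiv_lt_0_compat; lra).
  assert (Enu : (eta + norm2 v) * nu = Rabs c / 4) by (unfold nu; field; lra).
  destruct (strict_derivative_curve g t0 nu H nu0) as [d [d0 Hd]].
  exists d; split; auto. intros t [Ht1 Ht2] Dt.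
  specialize (Hd t0 t). fold p in Hd. rewrite Rminus_diag, Rabs_R0 in Hd.
  specialize (Hd d0 Ht2).
  set (err := psub (psub (g t) p) (pscal (t - t0) (vel g t0))) in *.
  assert (Ex : psub (g t) p = padd (pscal (t - t0) (vel g t0)) err).
  { unfold err. destruct (psub (g t) p), (vel g t0). plane; f_equal; ring. }
  specialize (L p (g t)). rewrite F0, dist2_refl, Ex in L. specialize (L r0 Dt).
  replace (cross v (padd (pscal (t - t0) (vel g t0)) err)) with ((t - t0) * c + cross v err) in L
    by (unfold c; clearbody err; plane; ring).
  pose proof (norm2_triang (pscal (t - t0) (vel g t0)) err) as T. rewrite norm2_scal in T.
  pose proof (cross_le v err) as C.
  set (x := F (g t)) in *. set (h := t - t0) in *.
  (* Half of the linear part may be lost to [eta], and a quarter to [nu]. *)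
  assert (M : Rabs (x - h * c) <= 3 / 4 * (Rabs h * Rabs c)).
  { replace (x - h * c) with ((x - 0 - (h * c + cross v err)) + cross v err) by ring.
    eapply Rle_trans; [apply Rabs_triang|].
    assert (X1 : eta * norm2 (padd (pscal h (vel g t0)) err)
      <= eta * (Rabs h * norm2 (vel g t0) + nu * Rabs h)) by (apply Rmult_le_compat_l; lra).
    assert (X2 : norm2 v * norm2 err <= norm2 v * (nu * Rabs h)) by (apply Rmult_le_compat_l; lra).
    assert (X3 : Rabs h * (2 * eta * norm2 (vel g t0)) <= Rabs h * Rabs c)
      by (apply Rmult_le_compat_l; lra).
    assert (X4 : Rabs h * ((eta + norm2 v) * nu) = Rabs h * (Rabs c / 4)) by now rewrite Enu.
    lra. }
  rewrite <- Rabs_mult in M. assert (0 < Rabs (h * c)) by (rewrite Rabs_mult; nra).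
  destruct (Rle_dec 0 (h * c)) as [P|P].
  - rewrite (Rabs_pos_eq (h * c)) in * by auto. apply Rcomplements.Rabs_le_between in M.
    apply Rmult_lt_0_compat; lra.
  - rewrite (Rabs_left (h * c)) in * by lra. apply Rcomplements.Rabs_le_between in M. nra.
Qed.

(* [iL] and [iR] are the indices of the local regions at [p] to the left and to the
   right of the edge through [g t]. *)
Lemma ext_index_edge (g : curve) (p : point) (r eta : R) (Fa Fb : point -> R)
    (va vb w : point) (t : R) (iL iR : Z) :
  closed_immersion g -> 0 < eta ->
  near_linear p r eta Fa va -> near_linear p r eta Fb vb ->
  dist2 p (g t) < r -> Fa (g t) = 0 -> 0 < Fb (g t) ->
  regular_time g t -> 0 < cross (vel g t) w ->
  0 < cross va w -> 2 * eta * norm2 w <= cross va w ->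
  (forall b, dist2 p b < r -> 0 < Fa b -> 0 < Fb b -> index g b = iL) ->
  (forall b, dist2 p b < r -> 0 < - Fa b -> 0 < Fb b -> index g b = iR) ->
  iL = (iR + 1)%Z /\ ext_index g (g t) = IZR iR + 1 / 2.
Proof.
  intros H e0 La Lb Dt Fa0 Fb0 Reg W Wa Wb HL HR.
  destruct (ext_index_regular g t w H Reg W) as [e1 [e10 E1]].
  destruct (near_linear_continuous p r eta Fb vb (g t) (Fb (g t)) Lb e0 Dt Fb0) as [d1 [d10 C]].
  set (d := Rmin d1 (r - dist2 p (g t))).
  assert (d0 : 0 < d) by (apply Rmin_glb_lt; lra).
  assert (dd1 : d <= d1) by apply Rmin_l. assert (dd2 : d <= r - dist2 p (g t)) by apply Rmin_r.
  destruct (ray_small w d d0) as [e2 [e20 E2]].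
  set (l := Rmin e1 e2). assert (l0 : 0 < l) by (apply Rmin_glb_lt; auto).
  assert (l1 : l <= e1) by apply Rmin_l. assert (l2 : l <= e2) by apply Rmin_r.
  specialize (E2 l (conj l0 l2)).
  destruct (E1 l (conj l0 l1)) as [_ [_ [I E]]].
  assert (Near : forall y, dist2 (g t) y < d -> dist2 p y < r /\ 0 < Fb y).
  { intros y Hy. assert (Dy : dist2 p y < r).
    { pose proof (dist2_triang p (g t) y). lra. }
    split; auto. specialize (C y Dy ltac:(lra)). apply Rabs_def2 in C. lra. }
  assert (P : l * cross va w > 0) by (apply Rmult_lt_0_compat; auto).
  assert (IL : index g (padd (g t) (pscal l w)) = iL).
  { destruct (Near (padd (g t) (pscal l w))) as [N1 N2]; [rewrite dist2_ray by lra; auto|].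
    apply HL; auto.
    pose proof (near_linear_lower _ _ _ _ _ _ _ La Dt N1) as N. rewrite Fa0 in N.
    replace (psub (padd (g t) (pscal l w)) (g t)) with (pscal l w) in N
      by (destruct (g t); plane; f_equal; ring).
    rewrite norm2_scal, Rabs_pos_eq in N by lra.
    replace (cross va (pscal l w)) with (l * cross va w) in N by (plane; ring). nra. }
  assert (IR : index g (psub (g t) (pscal l w)) = iR).
  { rewrite psub_ray.
    destruct (Near (padd (g t) (pscal l (popp w)))) as [N1 N2];
      [rewrite dist2_ray, norm2_opp by lra; auto|].
    apply HR; auto.
    pose proof (near_linear_lower _ _ _ _ _ _ _ (near_linear_opp _ _ _ _ _ La) Dt N1) as N.
    cbv beta in N. rewrite Fa0 in N.
    replace (psub (padd (g t) (pscal l (popp w))) (g t)) with (pscal l (popp w)) in N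
      by (destruct (g t); plane; f_equal; ring).
    rewrite norm2_scal, norm2_opp, Rabs_pos_eq in N by lra.
    replace (cross (popp va) (pscal l (popp w))) with (l * cross va w) in N by (plane; ring). nra. }
  rewrite IL, IR in I. rewrite IR in E. auto.
Qed.

Lemma cross_vel_near (g : curve) (t0 : R) (w : point) :
  closed_immersion g -> 0 < cross (vel g t0) w ->
  exists d, 0 < d /\ forall t, Rabs (t - t0) < d -> 0 < cross (vel g t) w.
Proof.
  intros H W.
  assert (w0 : 0 < norm2 w).
  { apply norm2_pos. intros ->. unfold cross in W; simpl in W; lra. }
  destruct (vel_continuous g t0 (cross (vel g t0) w / norm2 w) H) as [d [d0 Hd]];
    [apply Rdiv_lt_0_compat; auto|].
  exists d; split; auto. intros t Ht. specialize (Hd t Ht). unfold dist2 in Hd.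
  pose proof (cross_le (psub (vel g t) (vel g t0)) w) as C.
  apply Rcomplements.Rabs_le_between in C.
  replace (cross (psub (vel g t) (vel g t0)) w) with (cross (vel g t) w - cross (vel g t0) w) in C
    by (plane; ring).
  assert (norm2 (psub (vel g t) (vel g t0)) * norm2 w < cross (vel g t0) w / norm2 w * norm2 w)
    by (apply Rmult_lt_compat_r; auto).
  replace (cross (vel g t0) w / norm2 w * norm2 w) with (cross (vel g t0) w) in * by (field; lra).
  lra.
Qed.

(** Two transversal strands cut a small disc into four quadrants. Crossing an edge changes the index
    by one, so the quadrants carry i - 1, i, i and i + 1, with average i, and each edge carries the
    average of its two sides. *)
Lemma ext_index_double (g : curve) (t1 t2 : R) :
  closed_immersion g -> g t2 = g t1 ->
  (forall u, g u = g t1 -> same_time t1 u \/ same_time t2 u) ->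
  0 < cross (vel g t1) (vel g t2) ->
  exists d, 0 < d /\
    (forall t, t1 - d < t < t1 -> regular_time g t /\
       ext_index g (g t) = ext_index g (g t1) + 1 / 2) /\
    (forall t, t1 < t < t1 + d -> regular_time g t /\
       ext_index g (g t) = ext_index g (g t1) - 1 / 2) /\
    (forall t, t2 - d < t < t2 -> regular_time g t /\
       ext_index g (g t) = ext_index g (g t1) - 1 / 2) /\
    (forall t, t2 < t < t2 + d -> regular_time g t /\
       ext_index g (g t) = ext_index g (g t1) + 1 / 2).
Proof.
  intros H E21 Times W.
  set (p := g t1) in *. set (v1 := vel g t1) in *. set (v2 := vel g t2) in *.
  set (c := cross v1 v2) in *.
  assert (n1 : 0 < norm2 v1) by (apply norm2_pos, H).
  assert (n2 : 0 < norm2 v2) by (apply norm2_pos, H).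
  (* Gives [2 * eta * norm2 w <= c] for every combination [w] of the two velocities with
     coefficients 1 or -1. *)
  set (eta := c / (2 * (norm2 v1 + norm2 v2))).
  assert (e0 : 0 < eta) by (apply Rdiv_lt_0_compat; lra).
  assert (Eeta : 2 * eta * (norm2 v1 + norm2 v2) = c) by (unfold eta; field; lra).
  assert (Eeta1 : 0 < eta * norm2 v1) by (apply Rmult_lt_0_compat; auto).
  assert (Eeta2 : 0 < eta * norm2 v2) by (apply Rmult_lt_0_compat; auto).
  assert (Small : forall w, norm2 w <= norm2 v1 + norm2 v2 -> 2 * eta * norm2 w <= c).
  { intros w Hw. rewrite <- Eeta. apply Rmult_le_compat_l; lra. }
  destruct (strand_exists g t1 eta H e0) as [d1 [r1 [F1 [d10 [_ [r10 [L1 [Z1 [Z1' Inj1]]]]]]]]].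
  destruct (strand_exists g t2 eta H e0) as [d2 [r2 [F2 [d20 [_ [r20 [L2 [Z2 [Z2' Inj2]]]]]]]]].
  rewrite E21 in L2, Z2, Z2'. fold p in L1, L2, Z1, Z1', Z2, Z2'. fold v1 in L1. fold v2 in L2.
  set (dd := Rmin d1 d2). assert (dd0 : 0 < dd) by (apply Rmin_glb_lt; auto).
  assert (dd1 : dd <= d1) by apply Rmin_l. assert (dd2 : dd <= d2) by apply Rmin_r.
  destruct (times_near g p t1 t2 dd H dd0 Times) as [r3 [r30 T]].
  set (r := Rmin r1 (Rmin r2 r3)). assert (r0 : 0 < r) by (repeat apply Rmin_glb_lt; auto).
  assert (rr1 : r <= r1) by apply Rmin_l.
  assert (rr2 : r <= r2) by (eapply Rle_trans; [apply Rmin_r|apply Rmin_l]).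
  assert (rr3 : r <= r3) by (eapply Rle_trans; [apply Rmin_r|apply Rmin_r]).
  apply (near_linear_smaller _ _ r) in L1; auto. apply (near_linear_smaller _ _ r) in L2; auto.
  pose proof (near_linear_opp _ _ _ _ _ L1) as M1. pose proof (near_linear_opp _ _ _ _ _ L2) as M2.
  assert (F1p : F1 p = 0).
  { apply Z1'; [rewrite Rminus_diag, Rabs_R0; lra|fold p; rewrite dist2_refl; lra]. }
  assert (F2p : F2 p = 0).
  { rewrite <- E21. apply Z2'; [rewrite Rminus_diag, Rabs_R0; lra|].
    rewrite E21, dist2_refl; lra. }
  assert (ZF : forall x, dist2 p x < r -> F1 x = 0 \/ F2 x = 0 -> exists u, g u = x).
  { intros x Hx [A|A]; [apply Z1|apply Z2]; auto; lra. }
  assert (FZ : forall u, dist2 p (g u) < r -> F1 (g u) = 0 \/ F2 (g u) = 0).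
  { intros u Hu. destruct (T u) as [u' [S D]]; [lra|].
    rewrite <- (curve_same_time g u u' H S) in *.
    destruct D; [left; apply Z1'; lra|right; apply Z2'; lra]. }
  (* Quadrants are indexed by signs: 1 for the left of a strand, -1 for its right. *)
  set (S := fun (s1 s2 : R) x => dist2 p x < r /\ 0 < s1 * F1 x /\ 0 < s2 * F2 x).
  assert (Scaled : forall (s : R) F v, s = 1 \/ s = -1 -> near_linear p r eta F v ->
    near_linear p r eta (fun x => s * F x) (pscal s v)).
  { intros s F v [->| ->] L x y Hx Hy.
    - replace (1 * F y - 1 * F x - cross (pscal 1 v) (psub y x)) with
        (F y - F x - cross v (psub y x)) by (plane; ring). auto.
    - rewrite <- Rabs_Ropp.
      replace (- (-1 * F y - -1 * F x - cross (pscal (-1) v) (psub y x))) with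
        (F y - F x - cross v (psub y x)) by (plane; ring). auto. }
  (* This vector has cross product [c] with both [s1 * v1] and [s2 * v2], so it enters the
     quadrant. *)
  set (w := fun s1 s2 : R => padd (pscal (- s2) v1) (pscal s1 v2)).
  assert (Sec : forall s1 s2, s1 = 1 \/ s1 = -1 -> s2 = 1 \/ s2 = -1 ->
    sector g p r (S s1 s2) (w s1 s2)).
  { intros s1 s2 H1 H2.
    assert (Q1 : s1 * s1 = 1) by (destruct H1; subst; ring).
    assert (Q2 : s2 * s2 = 1) by (destruct H2; subst; ring).
    assert (W1 : cross (pscal s1 v1) (w s1 s2) = c).
    { transitivity (s1 * s1 * c); [unfold w, c; clearbody v1 v2; plane; ring|rewrite Q1; ring]. }
    assert (W2 : cross (pscal s2 v2) (w s1 s2) = c).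
    { transitivity (s2 * s2 * c); [unfold w, c; clearbody v1 v2; plane; ring|rewrite Q2; ring]. }
    assert (Nw : norm2 (w s1 s2) <= norm2 v1 + norm2 v2).
    { eapply Rle_trans; [apply norm2_triang|]. rewrite !norm2_scal.
      assert (A1 : Rabs (- s2) = 1)
        by (rewrite Rabs_Ropp; destruct H2; subst; [apply Rabs_R1|rewrite Rabs_left; lra]).
      assert (A2 : Rabs s1 = 1) by (destruct H1; subst; [apply Rabs_R1|rewrite Rabs_left; lra]).
      rewrite A1, A2. lra. }
    apply (sector_of_strands g p r eta _ _ (pscal s1 v1) (pscal s2 v2)); auto;
      try (rewrite ?W1, ?W2; auto; fail).
    - rewrite F1p; ring.
    - rewrite F2p; ring.
    - intros x Hx A. apply ZF; auto. destruct A as [A|A];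
        apply Rmult_integral in A as [A|A]; auto; exfalso; lra.
    - intros u Hu. destruct (FZ u Hu) as [A|A]; rewrite A; [left|right]; ring. }
  assert (o1 : 1 = 1 \/ 1 = -1) by auto. assert (o2 : -1 = 1 \/ -1 = -1) by auto.
  destruct (sector_index g p r _ _ H r0 (Sec 1 1 o1 o1)) as [ipp [app [app0 Ipp]]].
  destruct (sector_index g p r _ _ H r0 (Sec 1 (-1) o1 o2)) as [ipm [apm [apm0 Ipm]]].
  destruct (sector_index g p r _ _ H r0 (Sec (-1) 1 o2 o1)) as [imp [amp [amp0 Imp]]].
  destruct (sector_index g p r _ _ H r0 (Sec (-1) (-1) o2 o2)) as [imm [amm [amm0 Imm]]].
  assert (Ext : ext_index g p
    = (IZR ipp + (IZR ipm + (IZR imp + (IZR imm + 0)))) / (1 + 1 + 1 + 1)).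
  { rewrite (ext_index_sectors g p r
      ((S 1 1, w 1 1, ipp) :: (S 1 (-1), w 1 (-1), ipm) ::
       (S (-1) 1, w (-1) 1, imp) :: (S (-1) (-1), w (-1) (-1), imm) :: nil)); auto.
    - intros Q w' k [E|[E|[E|[E|[]]]]]; injection E as <- <- <-; split; auto;
        [exists app|exists apm|exists amp|exists amm]; auto.
    - intros x Hx O.
      assert (F1 x <> 0) by (intros E; destruct (ZF x Hx (or_introl E)) as [u Hu]; apply (O u Hu)).
      assert (F2 x <> 0) by (intros E; destruct (ZF x Hx (or_intror E)) as [u Hu]; apply (O u Hu)).
      destruct (Rlt_dec 0 (F1 x)); destruct (Rlt_dec 0 (F2 x)).
      + exists (S 1 1), (w 1 1), ipp. split; [simpl; tauto|]. unfold S; repeat split; lra.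
      + exists (S 1 (-1)), (w 1 (-1)), ipm. split; [simpl; tauto|]. unfold S; repeat split; lra.
      + exists (S (-1) 1), (w (-1) 1), imp. split; [simpl; tauto|]. unfold S; repeat split; lra.
      + exists (S (-1) (-1)), (w (-1) (-1)), imm.
        split; [simpl; tauto|]. unfold S; repeat split; lra.
    - repeat constructor; simpl; unfold S; intros x [_ [A1 A2]] [_ [B1 B2]]; lra. }
  set (r' := Rmin r (Rmin (Rmin app apm) (Rmin amp amm))).
  assert (r'0 : 0 < r') by (repeat apply Rmin_glb_lt; auto).
  assert (r'r : r' <= r) by apply Rmin_l.
  assert (r'1 : r' <= app)
    by (eapply Rle_trans; [apply Rmin_r|eapply Rle_trans; [apply Rmin_l|apply Rmin_l]]).
  assert (r'2 : r' <= apm)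
    by (eapply Rle_trans; [apply Rmin_r|eapply Rle_trans; [apply Rmin_l|apply Rmin_r]]).
  assert (r'3 : r' <= amp)
    by (eapply Rle_trans; [apply Rmin_r|eapply Rle_trans; [apply Rmin_r|apply Rmin_l]]).
  assert (r'4 : r' <= amm)
    by (eapply Rle_trans; [apply Rmin_r|eapply Rle_trans; [apply Rmin_r|apply Rmin_r]]).
  apply (near_linear_smaller _ _ r') in L1, L2, M1, M2; auto.
  assert (C21 : cross v2 v1 = - c) by (unfold c; clearbody v1 v2; plane; ring).
  destruct (strand_side g t1 r' eta F2 v2 H L2 F2p r'0 e0) as [h1 [h10 Side1]].
  { fold v1. rewrite C21. lra. }
  { fold v1. rewrite C21, Rabs_Ropp, Rabs_pos_eq by lra. apply Small. lra. }
  destruct (strand_side g t2 r' eta F1 v1 H) as [h2 [h20 Side2]]; auto.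
  { rewrite E21; auto. }
  { rewrite E21; auto. }
  { fold v2 c. lra. }
  { fold v2 c. rewrite Rabs_pos_eq by lra. apply Small. lra. }
  fold p v1 in Side1. fold v2 in Side2. rewrite C21 in Side1. fold c in Side2. rewrite E21 in Side2.
  destruct (cross_vel_near g t1 v2 H W) as [k1 [k10 Vel1]].
  destruct (cross_vel_near g t2 (popp v1) H) as [k2 [k20 Vel2]].
  { fold v2. replace (cross v2 (popp v1)) with c; auto. unfold c; clearbody v1 v2; plane; ring. }
  destruct (curve_continuous g t1 r' H r'0) as [m1 [m10 Near1]].
  destruct (curve_continuous g t2 r' H r'0) as [m2 [m20 Near2]].
  rewrite E21 in Near2. fold p in Near1, Near2.
  set (d := Rmin dd (Rmin (Rmin h1 h2) (Rmin (Rmin k1 k2) (Rmin m1 m2)))).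
  assert (d0 : 0 < d) by (repeat apply Rmin_glb_lt; auto).
  assert (ddd : d <= dd) by apply Rmin_l.
  assert (dh : d <= Rmin h1 h2) by (eapply Rle_trans; [apply Rmin_r|apply Rmin_l]).
  assert (dkm : d <= Rmin (Rmin k1 k2) (Rmin m1 m2))
    by (eapply Rle_trans; [apply Rmin_r|apply Rmin_r]).
  pose proof (Rmin_l h1 h2). pose proof (Rmin_r h1 h2).
  pose proof (Rmin_l k1 k2). pose proof (Rmin_r k1 k2).
  pose proof (Rmin_l m1 m2). pose proof (Rmin_r m1 m2).
  pose proof (Rmin_l (Rmin k1 k2) (Rmin m1 m2)). pose proof (Rmin_r (Rmin k1 k2) (Rmin m1 m2)).
  (* Near [t1] and off it, the first branch is strictly on one side of the second strand. A second
     passage through the same point is excluded near [t2] by its height zero, and near [t1] by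
     injectivity. *)
  assert (N1 : forall t, 0 < Rabs (t - t1) < d -> dist2 p (g t) < r' /\ F1 (g t) = 0 /\
    0 < F2 (g t) * ((t - t1) * - c) /\ regular_time g t /\ 0 < cross (vel g t) v2).
  { intros t [Ht0 Ht].
    assert (D : dist2 p (g t) < r') by (rewrite dist2_sym; apply Near1; lra).
    assert (S2 : 0 < F2 (g t) * ((t - t1) * - c)) by (apply Side1; auto; lra).
    split; [auto|]. split; [apply Z1'; lra|]. split; [auto|]. split; [|apply Vel1; lra].
    intros u Eu. destruct (T u) as [u' [Su [D'|D']]]; [rewrite Eu; lra| |].
    - assert (u' = t) as ->; [|now apply same_time_sym].
      apply Inj1; try lra. rewrite (curve_same_time g u u'); auto.
    - exfalso. assert (Z0 : F2 (g t) = 0).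
      { rewrite <- Eu, <- (curve_same_time g u u' H Su). apply Z2'; [lra|].
        rewrite (curve_same_time g u u' H Su), Eu. lra. }
      rewrite Z0 in S2. lra. }
  assert (N2 : forall t, 0 < Rabs (t - t2) < d -> dist2 p (g t) < r' /\ F2 (g t) = 0 /\
    0 < F1 (g t) * ((t - t2) * c) /\ regular_time g t /\ 0 < cross (vel g t) (popp v1)).
  { intros t [Ht0 Ht].
    assert (D : dist2 p (g t) < r') by (rewrite dist2_sym; apply Near2; lra).
    assert (S1 : 0 < F1 (g t) * ((t - t2) * c)) by (apply Side2; auto; lra).
    split; [auto|]. split; [apply Z2'; lra|]. split; [auto|]. split; [|apply Vel2; lra].
    intros u Eu. destruct (T u) as [u' [Su [D'|D']]]; [rewrite Eu; lra| |].
    - exfalso. assert (Z0 : F1 (g t) = 0).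
      { rewrite <- Eu, <- (curve_same_time g u u' H Su). apply Z1'; [lra|].
        rewrite (curve_same_time g u u' H Su), Eu. lra. }
      rewrite Z0 in S1. lra.
    - assert (u' = t) as ->; [|now apply same_time_sym].
      apply Inj2; try lra. rewrite (curve_same_time g u u'); auto. }
  assert (Wb2 : 2 * eta * norm2 v2 <= cross v1 v2) by (apply Small; lra).
  assert (W2' : cross v2 (popp v1) = c) by (unfold c; clearbody v1 v2; plane; ring).
  assert (Wb1 : 2 * eta * norm2 (popp v1) <= cross v2 (popp v1))
    by (rewrite W2'; apply Small; rewrite norm2_opp; lra).
  (* The four edges in turn; each yields a relation between two neighbouring quadrants. *)
  assert (A1 : forall t, t1 - d < t < t1 ->
    regular_time g t /\ ipp = (imp + 1)%Z /\ ext_index g (g t) = IZR imp + 1 / 2).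
  { intros t Ht. destruct (N1 t) as [D [Fz [Fs [Reg V]]]]; [rewrite Rabs_left; lra|].
    assert (0 < (t1 - t) * c) by (apply Rmult_lt_0_compat; lra).
    split; [auto|]. apply (ext_index_edge g p r' eta F1 F2 v1 v2 v2); auto; [nra| |];
      intros b Hb B1 B2; [apply Ipp|apply Imp]; unfold S; repeat split; lra. }
  assert (A2 : forall t, t1 < t < t1 + d ->
    regular_time g t /\ ipm = (imm + 1)%Z /\ ext_index g (g t) = IZR imm + 1 / 2).
  { intros t Ht. destruct (N1 t) as [D [Fz [Fs [Reg V]]]]; [rewrite Rabs_pos_eq; lra|].
    assert (0 < (t - t1) * c) by (apply Rmult_lt_0_compat; lra).
    split; [auto|].
    apply (ext_index_edge g p r' eta F1 (fun x => - F2 x) v1 (popp v2) v2); auto; [nra| |];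
      intros b Hb B1 B2; [apply Ipm|apply Imm]; unfold S; repeat split; lra. }
  assert (A3 : forall t, t2 - d < t < t2 ->
    regular_time g t /\ imp = (imm + 1)%Z /\ ext_index g (g t) = IZR imm + 1 / 2).
  { intros t Ht. destruct (N2 t) as [D [Fz [Fs [Reg V]]]]; [rewrite Rabs_left; lra|].
    assert (0 < (t2 - t) * c) by (apply Rmult_lt_0_compat; lra).
    split; [auto|].
    apply (ext_index_edge g p r' eta F2 (fun x => - F1 x) v2 (popp v1) (popp v1)); auto;
      [nra|lra| |];
      intros b Hb B1 B2; [apply Imp|apply Imm]; unfold S; repeat split; lra. }
  assert (A4 : forall t, t2 < t < t2 + d ->
    regular_time g t /\ ipp = (ipm + 1)%Z /\ ext_index g (g t) = IZR ipm + 1 / 2).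
  { intros t Ht. destruct (N2 t) as [D [Fz [Fs [Reg V]]]]; [rewrite Rabs_pos_eq; lra|].
    assert (0 < (t - t2) * c) by (apply Rmult_lt_0_compat; lra).
    split; [auto|].
    apply (ext_index_edge g p r' eta F2 F1 v2 v1 (popp v1)); auto; [nra|lra| |];
      intros b Hb B1 B2; [apply Ipp|apply Ipm]; unfold S; repeat split; lra. }
  assert (I1 : ipp = (imp + 1)%Z) by (apply (A1 (t1 - d / 2)); lra).
  assert (I2 : ipm = (imm + 1)%Z) by (apply (A2 (t1 + d / 2)); lra).
  assert (I3 : imp = (imm + 1)%Z) by (apply (A3 (t2 - d / 2)); lra).
  subst ipp ipm imp. rewrite !plus_IZR in *.
  assert (Ext' : ext_index g p = IZR imm + 1) by (rewrite Ext; field).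
  exists d. split; [auto|].
  split; [|split; [|split]]; intros t Ht.
  - destruct (A1 t Ht) as [A [_ E]]. split; auto. rewrite E, Ext'. lra.
  - destruct (A2 t Ht) as [A [_ E]]. split; auto. rewrite E, Ext'. lra.
  - destruct (A3 t Ht) as [A [_ E]]. split; auto. rewrite E, Ext'. lra.
  - destruct (A4 t Ht) as [A [_ E]]. split; auto. rewrite E, Ext'. lra.
Qed.

(** * Stability of the extended index in a family *)

Lemma index_segment (g : curve) (a b : point) :
  closed_immersion g ->
  (forall l, 0 <= l <= 1 -> off_curve g (padd a (pscal l (psub b a)))) ->
  index g a = index g b.
Proof.
  intros H O. apply (joined_index g a (norm2 (psub b a) + 1)); auto.
  apply joined_segment. intros l Hl; cbv zeta. split; auto.
  rewrite dist2_ray by lra. pose proof (norm2_ge0 (psub b a)). nra.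
Qed.

(** Curve and base point each move by less than half the distance [m] from [q0] to the curve, so the
    vectors from the point to the curve stay on a leash. *)
Lemma index_family (G : R -> curve) (s0 : R) (q0 : point) :
  C1_family G -> 0 <= s0 <= 1 -> off_curve (G s0) q0 ->
  exists d, 0 < d /\ forall s q, 0 <= s <= 1 -> Rabs (s - s0) < d -> dist2 q0 q < d ->
    off_curve (G s) q /\ index (G s) q = index (G s0) q0.
Proof.
  intros HG Hs0 O. pose proof HG as [HC [HP _]].
  destruct (dist_curve_pos (G s0) q0 (HC s0 Hs0) O) as [m [m0 Hm]].
  destruct (tube (fun d s => 0 <= s <= 1 /\ Rabs (s - s0) < d)
    (fun s u => dist2 (G s u) (G s0 u) < m / 2) 0 1) as [d [d0 Hd]].
  - intros d d' s Hd [Hs1 Hs2]; split; auto; lra.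
  - intros u0 _. destruct (HP s0 u0 (m / 4) Hs0) as [d [d0 Hd]]; [lra|].
    exists d; split; auto. intros s u [Hs1 Hs2] Hu.
    pose proof (Hd s u Hs1 Hs2 Hu).
    assert (dist2 (G s0 u) (G s0 u0) < m / 4).
    { apply Hd; auto. rewrite Rminus_diag, Rabs_R0; auto. }
    pose proof (dist2_triang (G s u) (G s0 u0) (G s0 u)) as T.
    rewrite (dist2_sym (G s0 u0) (G s0 u)) in T. lra.
  - exists (Rmin d (m / 2)). split; [apply Rmin_glb_lt; lra|].
    pose proof (Rmin_l d (m / 2)). pose proof (Rmin_r d (m / 2)).
    intros s q Hs Hsd Hq.
    assert (Close : forall u, 0 <= u <= 1 -> dist2 (G s u) (G s0 u) < m / 2)
      by (intros u Hu; apply (Hd s u); auto; split; auto; lra).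
    assert (Oq : off_curve (G s) q).
    { intros t E. destruct (Z_fraction t 0) as [k Hk].
      rewrite <- (curve_period _ t k (HC s Hs)) in E.
      specialize (Close (t + IZR k) ltac:(lra)). specialize (Hm (t + IZR k)).
      rewrite E in Close.
      pose proof (dist2_triang (G s0 (t + IZR k)) q q0) as T.
      rewrite (dist2_sym (G s0 (t + IZR k)) q), (dist2_sym q q0) in T. lra. }
    split; auto. symmetry. apply index_leash; auto. intros u Hu.
    apply dot_close_pos. specialize (Close u Hu). specialize (Hm u). unfold dist2 in *.
    replace (psub (psub (G s u) q) (psub (G s0 u) q0))
      with (padd (psub (G s u) (G s0 u)) (psub q0 q))
      by (destruct (G s u), (G s0 u); plane; f_equal; ring).
    eapply Rle_lt_trans; [apply norm2_triang|]. lra.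
Qed.

(** The index is read on the right of the curve at a normal offset [eps] that is uniform near
    [(s0, t0)]. The normal segment at [t] meets [G s] only at [t], so the offset point has the index
    of the right side, and it moves little with [(s, t)]. *)
Lemma ext_index_family (G : R -> curve) (s0 t0 : R) :
  C1_family G -> 0 <= s0 <= 1 -> regular_time (G s0) t0 ->
  exists d, 0 < d /\ forall s t, 0 <= s <= 1 -> Rabs (s - s0) < d -> Rabs (t - t0) < d ->
    regular_time (G s) t /\ ext_index (G s) (G s t) = ext_index (G s0) (G s0 t0).
Proof.
  intros HG Hs0 Reg. pose proof HG as [HC [HP HV]].
  set (v := vel (G s0) t0).
  assert (v0 : 0 < norm2 v) by (apply norm2_pos, (HC s0 Hs0)).
  (* The velocity rotated by a quarter turn to the left: a normal of the same length. *)
  set (w := (- snd v, fst v) : point).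
  assert (Wv : cross v w = norm2 v * norm2 v)
    by (rewrite norm2_sq; unfold w; clearbody v; plane; ring).
  assert (Nw : norm2 w = norm2 v)
    by (unfold norm2; f_equal; unfold w; clearbody v; plane; ring).
  assert (Dw : dot v w = 0) by (unfold w; clearbody v; plane; ring).
  destruct (strict_derivative G s0 t0 (norm2 v / 2) HG Hs0) as [d1 [d10 Hd1]]; [lra|].
  fold v in Hd1.
  (* Compactness confines to times near [t0] any meeting of [G s] with the short normal segment at
     [t]. *)
  destruct (tube (fun d (z : R * R * R) => let '(s, t, l) := z in
      0 <= s <= 1 /\ Rabs (s - s0) < d /\ Rabs (t - t0) < d /\ Rabs l < d)
    (fun z u => let '(s, t, l) := z in G s u = padd (G s t) (pscal l w) ->
      exists u', same_time u u' /\ Rabs (u' - t0) < d1) 0 1) as [d2 [d20 Hd2]].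
  { intros d d' [[s t] l] Hd [A [B [C D]]]. repeat split; try apply A; lra. }
  { intros u0 _. destruct (classic (G s0 u0 = G s0 t0)) as [E|N].
    - exists d1; split; auto. intros [[s t] l] u _ Hu _.
      destruct (same_time_sym _ _ (Reg u0 E)) as [k Hk].
      exists (u + IZR k). split; [now exists k|].
      rewrite Hk. now replace (u + IZR k - (u0 + IZR k)) with (u - u0) by ring.
    - set (m := dist2 (G s0 u0) (G s0 t0)).
      assert (m0 : 0 < m) by (apply norm2_pos; intros E; apply N; now apply psub_eq0).
      destruct (HP s0 u0 (m / 3) Hs0) as [e1 [e10 He1]]; [lra|].
      destruct (HP s0 t0 (m / 3) Hs0) as [e2 [e20 He2]]; [lra|].
      set (e3 := m / 3 / (norm2 w + 1)).
      assert (e30 : 0 < e3) by (apply Rdiv_lt_0_compat; lra).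
      assert (Ee3 : e3 * (norm2 w + 1) = m / 3) by (unfold e3; field; lra).
      exists (Rmin e1 (Rmin e2 e3)). split; [repeat apply Rmin_glb_lt; auto|].
      pose proof (Rmin_l e1 (Rmin e2 e3)). pose proof (Rmin_r e1 (Rmin e2 e3)).
      pose proof (Rmin_l e2 e3). pose proof (Rmin_r e2 e3).
      intros [[s t] l] u [A [B [C D]]] Hu E. exfalso.
      specialize (He1 s u A ltac:(lra) ltac:(lra)).
      specialize (He2 s t A ltac:(lra) ltac:(lra)).
      assert (X : dist2 (G s u) (G s t) <= e3 * norm2 w).
      { rewrite E. unfold dist2. replace (psub (padd (G s t) (pscal l w)) (G s t)) with (pscal l w)
          by (destruct (G s t); plane; f_equal; ring).
        rewrite norm2_scal. apply Rmult_le_compat_r; lra. }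
      pose proof (dist2_triang (G s0 u0) (G s u) (G s0 t0)).
      pose proof (dist2_triang (G s u) (G s t) (G s0 t0)).
      rewrite (dist2_sym (G s0 u0) (G s u)) in *. fold m in H3. nra. }
  set (eps := d2 / 2).
  assert (Uniq : forall s t l u, 0 <= s <= 1 -> Rabs (s - s0) < Rmin d1 d2 ->
    Rabs (t - t0) < Rmin d1 d2 -> Rabs l <= eps ->
    G s u = padd (G s t) (pscal l w) -> same_time t u).
  { intros s t l u Hs Hsd Htd Hl E.
    pose proof (Rmin_l d1 d2). pose proof (Rmin_r d1 d2).
    destruct (Z_fraction u 0) as [k Hk].
    destruct (Hd2 (s, t, l) (u + IZR k)) as [u' [S D]].
    - repeat split; try apply Hs; unfold eps in Hl; lra.
    - lra.
    - rewrite curve_period; auto.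
    - assert (S' : same_time u u') by (apply (same_time_trans _ (u + IZR k)); auto; now exists k).
      assert (u' = t) as ->; [|now apply same_time_sym].
      specialize (Hd1 s t u' Hs ltac:(lra) ltac:(lra) ltac:(lra)).
      rewrite (curve_same_time _ _ _ (HC s Hs) S'), E in Hd1.
      set (x := psub (psub (padd (G s t) (pscal l w)) (G s t)) (pscal (u' - t) v)) in Hd1.
      (* A chord between two times near [t0] is nearly tangent, whereas this one is normal; so it
         has no length in time. *)
      assert (Dx : dot v x = - ((u' - t) * (norm2 v * norm2 v))).
      { rewrite norm2_sq. transitivity (l * dot v w - (u' - t) * dot v v); [|rewrite Dw; ring].
        unfold x. clearbody v w. destruct (G s t). plane; ring. }
      pose proof (dot_le v x) as C. rewrite Dx, Rabs_Ropp, Rabs_mult in C.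
      rewrite (Rabs_pos_eq (norm2 v * norm2 v)) in C by nra.
      pose proof (Rabs_pos (u' - t)).
      assert (norm2 v * norm2 x <= norm2 v * (norm2 v / 2 * Rabs (u' - t)))
        by (apply Rmult_le_compat_l; lra).
      assert (vv : 0 < norm2 v * norm2 v) by nra.
      assert (Z0 : Rabs (u' - t) = 0) by nra.
      destruct (Req_dec (u' - t) 0) as [|n]; [lra|]. apply Rabs_no_R0 in n. lra. }
  assert (Off : forall s t l, 0 <= s <= 1 -> Rabs (s - s0) < Rmin d1 d2 ->
    Rabs (t - t0) < Rmin d1 d2 -> 0 < l <= eps -> off_curve (G s) (psub (G s t) (pscal l w))).
  { intros s t l Hs Hsd Htd Hl u E.
    assert (E' : G s u = padd (G s t) (pscal (- l) w))
      by (rewrite E; destruct (G s t); plane; f_equal; ring).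
    assert (S : same_time t u).
    { apply (Uniq s t (- l) u); auto. rewrite Rabs_Ropp, Rabs_pos_eq; lra. }
    rewrite (curve_same_time _ _ _ (HC s Hs) S) in E'.
    assert (Nz : norm2 (pscal (- l) w) = 0).
    { replace (pscal (- l) w) with ((0, 0) : point); [apply norm2_zero|].
      transitivity (psub (G s t) (G s t));
        [destruct (G s t); plane; f_equal; ring|].
      rewrite E' at 1. destruct (G s t); plane; f_equal; ring. }
    rewrite norm2_scal, Rabs_Ropp, Rabs_pos_eq in Nz by lra. nra. }
  assert (d120 : 0 < Rmin d1 d2) by (apply Rmin_glb_lt; auto).
  assert (eps0 : 0 < eps) by (unfold eps; lra).
  assert (Z0 : forall x, Rabs (x - x) < Rmin d1 d2)
    by (intros x; rewrite Rminus_diag, Rabs_R0; auto).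
  set (q0 := psub (G s0 t0) (pscal eps w)).
  assert (Oq0 : off_curve (G s0) q0) by (apply Off; auto; lra).
  destruct (index_family G s0 q0 HG Hs0 Oq0) as [d3 [d30 Hd3]].
  destruct (HP s0 t0 d3 Hs0 d30) as [d4 [d40 Hd4]].
  destruct (HV s0 t0 (norm2 v) Hs0 v0) as [d5 [d50 Hd5]]. fold v in Hd5.
  set (d := Rmin (Rmin d1 d2) (Rmin d3 (Rmin d4 d5))).
  assert (d0 : 0 < d) by (repeat apply Rmin_glb_lt; auto).
  assert (da : d <= Rmin d1 d2) by apply Rmin_l.
  assert (db : d <= d3) by (eapply Rle_trans; [apply Rmin_r|apply Rmin_l]).
  assert (dc : d <= d4)
    by (eapply Rle_trans; [apply Rmin_r|eapply Rle_trans; [apply Rmin_r|apply Rmin_l]]).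
  assert (de : d <= d5)
    by (eapply Rle_trans; [apply Rmin_r|eapply Rle_trans; [apply Rmin_r|apply Rmin_r]]).
  assert (Main : forall s t, 0 <= s <= 1 -> Rabs (s - s0) < d -> Rabs (t - t0) < d ->
    regular_time (G s) t /\ ext_index (G s) (G s t) = IZR (index (G s0) q0) + 1 / 2).
  { intros s t Hs Hsd Htd.
    assert (Rg : regular_time (G s) t).
    { intros u E. apply (Uniq s t 0 u); auto; try lra.
      - rewrite Rabs_R0; lra.
      - rewrite E. destruct (G s t); plane; f_equal; ring. }
    split; auto.
    assert (W : 0 < cross (vel (G s) t) w).
    { specialize (Hd5 s t Hs ltac:(lra) ltac:(lra)). simpl in Hd5. unfold dist2 in Hd5.
      pose proof (cross_le (psub (vel (G s) t) v) w) as C.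
      apply Rcomplements.Rabs_le_between in C.
      replace (cross (psub (vel (G s) t) v) w) with (cross (vel (G s) t) w - cross v w) in C
        by (clearbody v w; plane; ring).
      rewrite Wv, Nw in C. nra. }
    destruct (ext_index_regular (G s) t w (HC s Hs) Rg W) as [e [e0 He]].
    set (l := Rmin e eps). assert (l0 : 0 < l) by (apply Rmin_glb_lt; auto).
    assert (le : l <= e) by apply Rmin_l. assert (leps : l <= eps) by apply Rmin_r.
    destruct (He l (conj l0 le)) as [_ [_ [_ ->]]]. do 2 f_equal.
    (* From the offset [l], which depends on [s] and [t], to the fixed offset [eps]. *)
    transitivity (index (G s) (psub (G s t) (pscal eps w))).
    - apply index_segment; auto. intros j Hj.
      replace (padd (psub (G s t) (pscal l w))
        (pscal j (psub (psub (G s t) (pscal eps w)) (psub (G s t) (pscal l w)))))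
        with (psub (G s t) (pscal (l + j * (eps - l)) w))
        by (destruct (G s t); clearbody w; plane; f_equal; ring).
      apply Off; auto; try lra. nra.
    - apply Hd3; auto; [lra|]. specialize (Hd4 s t Hs ltac:(lra) ltac:(lra)).
      rewrite dist2_sym in Hd4. unfold dist2 in *.
      replace (psub q0 (psub (G s t) (pscal eps w))) with (psub (G s0 t0) (G s t)); auto.
      unfold q0. destruct (G s0 t0), (G s t); plane; f_equal; ring. }
  exists d; split; auto. intros s t Hs Hsd Htd.
  destruct (Main s t Hs Hsd Htd) as [A ->]. split; auto.
  symmetry. apply Main; auto; rewrite Rminus_diag, Rabs_R0; auto.
Qed.

Lemma ext_index_near (g : curve) (t0 : R) :
  closed_immersion g -> regular_time g t0 ->
  exists d, 0 < d /\ forall t, Rabs (t - t0) < d ->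
    regular_time g t /\ ext_index g (g t) = ext_index g (g t0).
Proof.
  intros H Reg.
  destruct (ext_index_family (fun _ => g) 0 t0 (C1_family_const g H)) as [d [d0 Hd]];
    [lra|auto|].
  exists d; split; auto. intros t Ht. apply (Hd 0 t); auto; [lra|].
  rewrite Rminus_diag, Rabs_R0; auto.
Qed.

(** * Double points of a generic immersion *)

(** [generic_immersion] excludes triple points for times in [[0, 1)]; integer shifts extend this to
    all times. *)
Lemma generic_times (g : curve) (x y u : R) :
  generic_immersion g -> g x = g y -> ~ same_time x y -> g u = g x ->
  same_time x u \/ same_time y u.
Proof.
  intros [H [_ [Tr _]]] E N Eu.
  destruct (Z_fraction x 0) as [i Hi]. destruct (Z_fraction y 0) as [j Hj].
  destruct (Z_fraction u 0) as [k Hk].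
  assert (Si : same_time x (x + IZR i)) by now exists i.
  assert (Sj : same_time y (y + IZR j)) by now exists j.
  assert (Sk : same_time u (u + IZR k)) by now exists k.
  destruct (Tr (x + IZR i) (y + IZR j) (u + IZR k)) as [A|[A|A]]; try lra.
  - now rewrite !curve_period.
  - rewrite !curve_period; auto. now rewrite Eu.
  - elim N. rewrite A in Si. exact (same_time_trans _ _ _ Si (same_time_sym _ _ Sj)).
  - right. rewrite A in Sj. exact (same_time_trans _ _ _ Sj (same_time_sym _ _ Sk)).
  - left. rewrite A in Si. exact (same_time_trans _ _ _ Si (same_time_sym _ _ Sk)).
Qed.

Lemma generic_transversal (g : curve) (x y : R) :
  generic_immersion g -> g x = g y -> ~ same_time x y -> cross (vel g x) (vel g y) <> 0.
Proof.
  intros [H [_ [_ Tv]]] E N.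
  destruct (Z_fraction x 0) as [i Hi]. destruct (Z_fraction y 0) as [j Hj].
  rewrite <- (vel_period g x i H), <- (vel_period g y j H).
  apply (Tv (g x)). repeat split; try lra.
  - intros A. apply N. apply (same_time_trans _ (x + IZR i)); [now exists i|].
    rewrite A. apply same_time_sym. now exists j.
  - now apply curve_period.
  - rewrite E. now apply curve_period.
Qed.

Lemma not_regular (g : curve) (t : R) :
  ~ regular_time g t -> exists u, g u = g t /\ ~ same_time t u.
Proof.
  intros N. apply not_all_ex_not in N as [u Hu]. exists u.
  apply imply_to_and in Hu. exact Hu.
Qed.

(* The double points, each seen as the pair of its times in the period starting at
   [b], the second branch crossing the first one from right to left. *)
Definition crossing_pair (g : curve) (b : R) (pr : R * R) : Prop :=
  b < fst pr < b + 1 /\ b < snd pr < b + 1 /\ g (fst pr) = g (snd pr) /\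
  0 < cross (vel g (fst pr)) (vel g (snd pr)).

Definition crossing_list (g : curve) (b : R) (L : list (R * R)) : Prop :=
  NoDup L /\ forall pr, In pr L <-> crossing_pair g b pr.

Lemma same_time_window (b x y : R) :
  b < x < b + 1 -> b < y < b + 1 -> same_time x y -> y = x.
Proof. intros Hx Hy S. apply same_time_close; auto. apply Rabs_def1; lra. Qed.

Lemma crossing_pair_distinct (g : curve) (b : R) (pr : R * R) :
  crossing_pair g b pr -> ~ same_time (fst pr) (snd pr).
Proof.
  intros [A [B [E C]]] S. apply (same_time_window b) in S; auto.
  rewrite S in C. unfold cross in C. lra.
Qed.

(** An integer shift brings the partner time into the window, and regularity of the base time keeps
    both times off its ends. The sign of the cross product decides their order. *)
Lemma crossing_pair_of_times (g : curve) (b t u : R) :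
  generic_immersion g -> regular_time g b -> b <= t <= b + 1 ->
  g u = g t -> ~ same_time t u ->
  exists u', same_time u u' /\ b < t < b + 1 /\ b < u' < b + 1 /\
    (crossing_pair g b (t, u') \/ crossing_pair g b (u', t)).
Proof.
  intros Gen Reg Ht E N. assert (H := proj1 Gen).
  assert (NR : forall x y, g x = g y -> ~ same_time x y -> ~ same_time b x).
  { intros x y Exy Nxy S. apply Nxy.
    assert (S' : same_time b y).
    { apply Reg. rewrite <- Exy. now apply curve_same_time. }
    exact (same_time_trans _ _ _ (same_time_sym _ _ S) S'). }
  destruct (Z_fraction u b) as [k Hk].
  assert (Sk : same_time u (u + IZR k)) by now exists k.
  assert (Nt : ~ same_time b t) by (apply (NR t u); auto).
  assert (Nu : ~ same_time b u).
  { apply (NR u t); auto. intros S; apply N, same_time_sym, S. }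
  assert (Tb : t <> b) by (intros ->; apply Nt, same_time_refl).
  assert (Tb1 : t <> b + 1) by (intros ->; apply Nt; now exists 1%Z).
  assert (Ub : u + IZR k <> b).
  { intros A. apply Nu. rewrite A in Sk. now apply same_time_sym. }
  exists (u + IZR k). split; [auto|]. split; [lra|]. split; [lra|].
  assert (E' : g t = g (u + IZR k)) by (rewrite curve_period; auto).
  assert (N' : ~ same_time t (u + IZR k)).
  { intros S. apply N. exact (same_time_trans _ _ _ S (same_time_sym _ _ Sk)). }
  pose proof (generic_transversal g t (u + IZR k) Gen E' N') as C.
  destruct (Rlt_dec 0 (cross (vel g t) (vel g (u + IZR k)))) as [P|P].
  - left. repeat split; simpl; auto; lra.
  - right. repeat split; simpl; auto; try lra.
    replace (cross (vel g (u + IZR k)) (vel g t)) with (- cross (vel g t) (vel g (u + IZR k)))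
      by (plane; ring). lra.
Qed.

(** The point has just two times in the window, and exchanging them reverses the sign of the cross
    product. *)
Lemma crossing_pair_unique (g : curve) (b : R) (pr pr' : R * R) :
  generic_immersion g -> crossing_pair g b pr -> crossing_pair g b pr' ->
  g (fst pr) = g (fst pr') -> pr = pr'.
Proof.
  intros Gen P P' E. pose proof (crossing_pair_distinct _ _ _ P) as N.
  pose proof (crossing_pair_distinct _ _ _ P') as N'.
  destruct pr as [x y], pr' as [x' y']. destruct P as [A [B [C D]]], P' as [A' [B' [C' D']]].
  simpl in *.
  assert (K : forall z, b < z < b + 1 -> g z = g x -> z = x \/ z = y).
  { intros z Hz Ez. destruct (generic_times g x y z Gen C N Ez) as [S|S];
      [left|right]; now apply (same_time_window b) in S. }
  destruct (K x' A') as [->| ->]; [now rewrite E| |].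
  - destruct (K y' B') as [->| ->]; [now rewrite <- C'| |]; auto.
    elim N'. apply same_time_refl.
  - destruct (K y' B') as [->| ->]; [now rewrite <- C'| |].
    + exfalso. assert (cross (vel g x) (vel g y) = - cross (vel g y) (vel g x)) by (plane; ring).
      lra.
    + elim N'. apply same_time_refl.
Qed.

Lemma ext_index_crossing (g : curve) (b : R) (pr : R * R) :
  generic_immersion g -> crossing_pair g b pr ->
  let x := fst pr in let y := snd pr in let e := ext_index g (g x) in
  exists d, 0 < d /\
    (forall t, x - d < t < x -> regular_time g t /\ ext_index g (g t) = e + 1 / 2) /\
    (forall t, x < t < x + d -> regular_time g t /\ ext_index g (g t) = e - 1 / 2) /\
    (forall t, y - d < t < y -> regular_time g t /\ ext_index g (g t) = e - 1 / 2) /\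
    (forall t, y < t < y + d -> regular_time g t /\ ext_index g (g t) = e + 1 / 2).
Proof.
  intros Gen P x y e. pose proof (crossing_pair_distinct _ _ _ P) as N.
  destruct P as [A [B [E C]]]. apply ext_index_double; auto.
  - apply Gen.
  - intros u Eu. apply (generic_times g); auto.
Qed.

(** * The profile of the index along the curve as a step function *)

Definition heaviside (t u : R) : R := if Rlt_dec u t then 1 else 0.

Lemma heaviside_near (t0 u : R) : t0 <> u ->
  exists d, 0 < d /\ forall t, Rabs (t - t0) < d -> heaviside t u = heaviside t0 u.
Proof.
  intros N. exists (Rabs (t0 - u)). split; [apply Rabs_pos_lt; lra|].
  intros t Ht. apply Rabs_def2 in Ht. unfold heaviside.
  destruct (Rlt_dec u t0).
  - rewrite Rabs_pos_eq in Ht by lra. destruct (Rlt_dec u t); auto; lra.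
  - rewrite Rabs_left in Ht by lra. destruct (Rlt_dec u t); auto; lra.
Qed.

Definition jump (f : R -> R) (e : R) : R := f (e + 1 / 2) - f (e - 1 / 2).

(** The index drops by one at the first time of a pair and rises by one at the second, so a pair
    subtracts its jump between these times, or adds it when they come in the other order. *)
Definition steps (g : curve) (f : R -> R) (L : list (R * R)) (t : R) : R :=
  sum_list (fun pr => jump f (ext_index g (g (fst pr))) *
    (heaviside t (snd pr) - heaviside t (fst pr))) L.

Lemma steps_near (g : curve) (f : R -> R) (L : list (R * R)) (t0 : R) :
  (forall pr, In pr L -> t0 <> fst pr /\ t0 <> snd pr) ->
  exists d, 0 < d /\ forall t, Rabs (t - t0) < d -> steps g f L t = steps g f L t0.
Proof.
  induction L as [|pr L IH]; intros N.
  - exists 1. split; [lra|]. reflexivity.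
  - destruct IH as [d [d0 Hd]]; [intros q Hq; apply N; simpl; auto|].
    destruct (N pr) as [N1 N2]; [simpl; auto|].
    destruct (heaviside_near t0 (fst pr) N1) as [d1 [d10 H1]].
    destruct (heaviside_near t0 (snd pr) N2) as [d2 [d20 H2]].
    pose proof (Rmin_l d (Rmin d1 d2)). pose proof (Rmin_r d (Rmin d1 d2)).
    pose proof (Rmin_l d1 d2). pose proof (Rmin_r d1 d2).
    exists (Rmin d (Rmin d1 d2)). split; [repeat apply Rmin_glb_lt; auto|].
    intros t Ht. specialize (Hd t ltac:(lra)). unfold steps, sum_list in *. simpl.
    rewrite H1, H2, Hd by lra. reflexivity.
Qed.

Lemma steps_remove (g : curve) (f : R -> R) (l1 l2 : list (R * R)) (pr : R * R) (t : R) :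
  steps g f (l1 ++ pr :: l2) t = jump f (ext_index g (g (fst pr))) *
    (heaviside t (snd pr) - heaviside t (fst pr)) + steps g f (l1 ++ l2) t.
Proof. unfold steps; now rewrite sum_list_remove. Qed.

(** The index minus the steps, seen through [f], has the same value on the two sides of each double
    time; at the double time itself the index is an average, hence the punctured form of local
    constancy. Any [f] is allowed, so that a coefficient of q^ind can be substituted. *)
Lemma ext_index_profile (g : curve) (f : R -> R) (b t : R) (L : list (R * R)) :
  generic_immersion g -> regular_time g b -> crossing_list g b L ->
  b <= t <= b + 1 -> regular_time g t ->
  f (ext_index g (g t)) = f (ext_index g (g b)) + steps g f L t.
Proof.
  intros Gen Rb [ND HL] Ht Rt. assert (H := proj1 Gen).
  set (h := fun t => f (ext_index g (g t)) - steps g f L t).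
  assert (Hb : steps g f L b = 0).
  { assert (A : forall pr, In pr L -> b < fst pr /\ b < snd pr)
      by (intros pr Hpr; apply HL in Hpr as [A [B _]]; split; lra).
    clear - A. induction L as [|pr L IH]; auto.
    unfold steps, sum_list in *; simpl. rewrite IH by (intros q Hq; apply A; simpl; auto).
    destruct (A pr); [simpl; auto|]. unfold heaviside.
    destruct (Rlt_dec (snd pr) b), (Rlt_dec (fst pr) b); try lra. }
  assert (good : forall t, regular_time g t ->
    exists d, 0 < d /\ forall z, Rabs (z - t) < d -> h z = h t).
  { intros t0 R0. destruct (ext_index_near g t0 H R0) as [d1 [d10 H1]].
    destruct (steps_near g f L t0) as [d2 [d20 H2]].
    { intros pr Hpr. apply HL in Hpr. pose proof (crossing_pair_distinct _ _ _ Hpr) as N.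
      destruct Hpr as [_ [_ [E _]]]. split; intros ->; apply N.
      - apply R0; auto.
      - apply same_time_sym, R0; auto. }
    pose proof (Rmin_l d1 d2). pose proof (Rmin_r d1 d2).
    exists (Rmin d1 d2). split; [apply Rmin_glb_lt; auto|]. intros z Hz.
    unfold h. rewrite H2 by lra. destruct (H1 z) as [_ ->]; auto; lra. }
  assert (E : h t = h b).
  { apply (loc_const_punctured h b (b + 1)); auto; try lra.
    intros t0 Ht0. destruct (classic (regular_time g t0)) as [R0|N0].
    { destruct (good t0 R0) as [d [d0 Hd]]. exists d, (h t0). split; auto.
      intros y Hy. apply Hd, Hy. }
    destruct (not_regular g t0 N0) as [u [Eu Nu]].
    destruct (crossing_pair_of_times g b t0 u Gen Rb Ht0 Eu Nu) as [u' [Su [It [Iu P]]]].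
    assert (Ne : t0 <> u').
    { intros ->. apply Nu. now apply same_time_sym. }
    assert (Eu' : g u' = g t0) by (rewrite (curve_same_time g u u'); auto).
    destruct (heaviside_near t0 u' Ne) as [d3 [d30 H3]].
    (* Only one crossing has [t0] among its times, so the remaining steps are constant near [t0]. *)
    assert (Rest : forall pr l1 l2, L = l1 ++ pr :: l2 -> pr = (t0, u') \/ pr = (u', t0) ->
      forall q, In q (l1 ++ l2) -> t0 <> fst q /\ t0 <> snd q).
    { intros pr l1 l2 EL Hpr q Hq.
      assert (Pq : crossing_pair g b q).
      { apply HL. rewrite EL. apply in_app_iff in Hq. apply in_app_iff. simpl; tauto. }
      assert (Ppr : crossing_pair g b pr).
      { apply HL. rewrite EL. apply in_app_iff. simpl; auto. }
      assert (Nq : pr <> q).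
      { intros <-. rewrite EL in ND. apply NoDup_remove_2 in ND. contradiction. }
      assert (Et : g (fst pr) = g t0) by (destruct Hpr as [->| ->]; auto).
      split; intros Eq; apply Nq; apply (crossing_pair_unique g b); auto; rewrite Et, Eq; auto.
      destruct Pq as [_ [_ [Eq' _]]]. auto. }
    destruct P as [P|P]; assert (Pin := proj2 (HL _) P);
      apply in_split in Pin as [l1 [l2 EL]];
      destruct (steps_near g f (l1 ++ l2) t0) as [d2 [d20 H2]].
    - eapply Rest; eauto.
    - destruct (ext_index_crossing g b _ Gen P) as [d1 [d10 [A1 [A2 _]]]]. simpl in A1, A2.
      exists (Rmin d1 (Rmin d2 d3)). eexists. split; [repeat apply Rmin_glb_lt; auto|].
      pose proof (Rmin_l d1 (Rmin d2 d3)). pose proof (Rmin_r d1 (Rmin d2 d3)).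
      pose proof (Rmin_l d2 d3). pose proof (Rmin_r d2 d3).
      intros y [Hy1 Hy2]. unfold h. rewrite EL, steps_remove, H2, H3 by lra. simpl.
      assert (ne : y <> t0) by (intros ->; rewrite Rminus_diag, Rabs_R0 in Hy1; lra).
      apply Rabs_def2 in Hy2.
      (* The common value on both sides; [t0] is the first time of its pair, so the index on the
         left is the average plus a half. *)
      instantiate (1 := f (ext_index g (g t0) + 1 / 2) -
        (jump f (ext_index g (g t0)) * heaviside t0 u' + steps g f (l1 ++ l2) t0)).
      unfold jump, heaviside at 2. destruct (Rlt_dec t0 y).
      + destruct (A2 y) as [_ ->]; [lra|]. ring.
      + destruct (A1 y) as [_ ->]; [lra|]. ring.
    - eapply Rest; eauto.
    - destruct (ext_index_crossing g b _ Gen P) as [d1 [d10 [_ [_ [A1 A2]]]]]. simpl in A1, A2.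
      rewrite Eu' in A1, A2.
      exists (Rmin d1 (Rmin d2 d3)). eexists. split; [repeat apply Rmin_glb_lt; auto|].
      pose proof (Rmin_l d1 (Rmin d2 d3)). pose proof (Rmin_r d1 (Rmin d2 d3)).
      pose proof (Rmin_l d2 d3). pose proof (Rmin_r d2 d3).
      intros y [Hy1 Hy2]. unfold h. rewrite EL, steps_remove, H2, H3 by lra. simpl.
      rewrite Eu'.
      assert (ne : y <> t0) by (intros ->; rewrite Rminus_diag, Rabs_R0 in Hy1; lra).
      apply Rabs_def2 in Hy2.
      (* Here [t0] is the second time, and the index on the left is the average minus a half. *)
      instantiate (1 := f (ext_index g (g t0) - 1 / 2) -
        (- jump f (ext_index g (g t0)) * heaviside t0 u' + steps g f (l1 ++ l2) t0)).
      unfold jump, heaviside at 1. destruct (Rlt_dec t0 y).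
      + destruct (A2 y) as [_ ->]; [lra|]. ring.
      + destruct (A1 y) as [_ ->]; [lra|]. ring. }
  unfold h in E. rewrite Hb in E. lra.
Qed.

(** * The invariant as a sum over the double points *)

(** The profile is known only at regular times. The finitely many others are dealt with one by one,
    by splitting the interval at them. *)
Lemma is_RInt_except (f h : R -> R) (T : list R) (a b I : R) :
  a <= b -> (forall t, a < t < b -> ~ In t T -> f t = h t) ->
  is_RInt f a b I -> is_RInt h a b I.
Proof.
  revert a b I. induction T as [|u T IH]; intros a b I ab E Hf.
  - apply (is_RInt_ext f); auto. intros t Ht. rewrite Rmin_left, Rmax_right in Ht by lra.
    apply E; auto.
  - destruct (classic (a < u < b)) as [Hu|Hu].
    + assert (X : ex_RInt f a b) by (now exists I).
      destruct (ex_RInt_Chasles_1 f a u b ltac:(lra) X) as [I1 H1].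
      destruct (ex_RInt_Chasles_2 f a u b ltac:(lra) X) as [I2 H2].
      assert (I = plus I1 I2) as ->.
      { rewrite <- (is_RInt_unique _ _ _ _ Hf). apply is_RInt_unique.
        now apply is_RInt_Chasles with u. }
      apply is_RInt_Chasles with u.
      * apply IH; auto; [lra|]. intros t Ht Nt. apply E; [lra|]. intros [A|A]; [lra|auto].
      * apply IH; auto; [lra|]. intros t Ht Nt. apply E; [lra|]. intros [A|A]; [lra|auto].
    + apply IH; auto. intros t Ht Nt. apply E; auto. intros [A|A]; [subst; auto|auto].
Qed.

Lemma is_RInt_period (F : R -> R) (b I : R) :
  (forall t, F (t + 1) = F t) -> 0 <= b < 1 -> is_RInt F b (b + 1) I -> is_RInt F 0 1 I.
Proof.
  intros P Hb HI. assert (X : ex_RInt F b (b + 1)) by (now exists I).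
  destruct (ex_RInt_Chasles_1 F b 1 (b + 1) ltac:(lra) X) as [I1 H1].
  destruct (ex_RInt_Chasles_2 F b 1 (b + 1) ltac:(lra) X) as [I2 H2].
  assert (I = plus I1 I2) as ->.
  { rewrite <- (is_RInt_unique _ _ _ _ HI). apply is_RInt_unique.
    now apply is_RInt_Chasles with 1. }
  rewrite plus_comm. apply is_RInt_Chasles with b; auto.
  apply (is_RInt_ext (fun y => scal 1 (F (1 * y + 1)))).
  - intros t _. unfold scal; simpl; unfold mult; simpl. rewrite Rmult_1_l, Rmult_1_l. apply P.
  - apply (is_RInt_comp_lin F 1 1 0 b).
    replace (1 * 0 + 1) with 1 by ring. replace (1 * b + 1) with (b + 1) by ring. auto.
Qed.

Lemma curvature_continuous (g : curve) (t : R) :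
  closed_immersion g -> continuous (fun u => curvature g u * speed g u) t.
Proof.
  intros H.
  apply (continuous_ext (fun u => cross (vel g u) (acc g u) * / (dot (vel g u) (vel g u)))).
  - intros u. assert (P : 0 < speed g u) by (apply norm2_pos, H).
    pose proof (norm2_sq (vel g u)) as S. fold (speed g u) in S. rewrite <- S.
    unfold curvature. eqR. field. lra.
  - pose proof (is_derive_continuous _ _ _ (acc_fst g t H)) as V1.
    pose proof (is_derive_continuous _ _ _ (acc_snd g t H)) as V2.
    destruct (acc_continuous g t H) as [A1 A2].
    apply (continuous_mult (K := R_AbsRing)).
    + apply (continuous_minus (V := R_NormedModule)); apply (continuous_mult (K := R_AbsRing)); auto.
    + apply (continuous_comp (fun u => dot (vel g u) (vel g u)) Rinv).
      * apply (continuous_plus (V := R_NormedModule)); apply (continuous_mult (K := R_AbsRing)); auto.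
      * apply continuous_Rinv. assert (P : 0 < norm2 (vel g t)) by (apply norm2_pos, H).
        pose proof (norm2_sq (vel g t)). nra.
Qed.

Lemma sum_list_ext {A : Type} (f h : A -> R) (L : list A) :
  (forall x, In x L -> f x = h x) -> sum_list f L = sum_list h L.
Proof. intros E. unfold sum_list. f_equal. apply map_ext_in, E. Qed.

Lemma sum_list_plus {A : Type} (f h : A -> R) (L : list A) :
  sum_list (fun x => f x + h x) L = sum_list f L + sum_list h L.
Proof. unfold sum_list. induction L; simpl; [ring|rewrite IHL; ring]. Qed.

Lemma sum_list_permutation {A : Type} (f : A -> R) (L L' : list A) :
  Permutation L L' -> sum_list f L = sum_list f L'.
Proof. intros P. unfold sum_list. induction P; simpl; lra. Qed.

Lemma sum_list_map {A B : Type} (f : B -> R) (h : A -> B) (L : list A) :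
  sum_list f (map h L) = sum_list (fun x => f (h x)) L.
Proof. unfold sum_list. now rewrite map_map. Qed.

Lemma is_RInt_heaviside (k ph : R -> R) (a b u : R) :
  a < u < b -> (forall t, is_derive ph t (k t)) -> (forall t, continuous k t) ->
  is_RInt (fun t => k t * heaviside t u) a b (ph b - ph u).
Proof.
  intros Hu D C.
  replace (ph b - ph u) with (plus (0 : R) (minus (ph b) (ph u)))
    by (unfold plus, minus, opp; simpl; unfold plus, opp; simpl; ring).
  apply (is_RInt_Chasles (V := R_NormedModule) _ a u b).
  - apply (is_RInt_ext (fun _ => 0)).
    + intros t Ht. rewrite Rmin_left, Rmax_right in Ht by lra. unfold heaviside.
      eqR. destruct (Rlt_dec u t); [lra|ring].
    + evar_last; [apply (is_RInt_const (V := R_NormedModule))|]. unfold scal; simpl; unfold mult; simpl; eqR; ring.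
  - apply (is_RInt_ext k).
    + intros t Ht. rewrite Rmin_left, Rmax_right in Ht by lra. unfold heaviside.
      eqR. destruct (Rlt_dec u t); [ring|lra].
    + apply (is_RInt_derive (V := R_CompleteNormedModule)); auto.
Qed.

(** The integration by parts: each step turns the integral of [k] into an increment of [ph]. *)
Lemma is_RInt_steps (g : curve) (f k ph : R -> R) (a b : R) (L : list (R * R)) :
  (forall pr, In pr L -> a < fst pr < b /\ a < snd pr < b) ->
  (forall t, is_derive ph t (k t)) -> (forall t, continuous k t) ->
  is_RInt (fun t => k t * steps g f L t) a b
    (sum_list (fun pr => jump f (ext_index g (g (fst pr))) * (ph (fst pr) - ph (snd pr))) L).
Proof.
  intros HL D C. induction L as [|pr L IH].
  - apply (is_RInt_ext (fun _ => 0)).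
    + intros t _. unfold steps, sum_list; simpl; eqR; ring.
    + evar_last; [apply (is_RInt_const (V := R_NormedModule))|].
      unfold scal; simpl; unfold mult; simpl; unfold sum_list; simpl; eqR; ring.
  - destruct (HL pr) as [A B]; [simpl; auto|].
    set (j := jump f (ext_index g (g (fst pr)))).
    apply (is_RInt_ext (fun t => plus
      (scal j (minus (k t * heaviside t (snd pr)) (k t * heaviside t (fst pr))))
      (k t * steps g f L t))).
    + intros t _. unfold steps, sum_list; simpl. fold j.
      unfold plus, scal, minus, opp; simpl; unfold plus, mult; simpl. eqR; ring.
    + evar_last.
      * apply (is_RInt_plus (V := R_NormedModule)).
        -- apply (is_RInt_scal (V := R_NormedModule)), (is_RInt_minus (V := R_NormedModule));
             apply is_RInt_heaviside with (ph := ph); auto.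
        -- apply IH. intros q Hq. apply HL; simpl; auto.
      * unfold sum_list; simpl. fold j.
        unfold plus, scal, minus, opp; simpl; unfold plus, mult; simpl. eqR; ring.
Qed.

Lemma double_points_spec (g : curve) : generic_immersion g ->
  NoDup (double_points g) /\ forall d, In d (double_points g) <-> double_point g d.
Proof.
  intros [_ [[l Hl] _]]. unfold double_points. apply epsilon_spec.
  assert (dec : forall x y : point, {x = y} + {x <> y}).
  { intros x y. apply excluded_middle_informative. }
  set (inb := fun d => if excluded_middle_informative (double_point g d) then true else false).
  exists (nodup dec (filter inb l)). split; [apply NoDup_nodup|].
  intros d. rewrite nodup_In, filter_In. unfold inb.
  destruct (excluded_middle_informative (double_point g d)) as [D|D].
  - split; auto.
  - split; [intros [_ A]; discriminate|contradiction].
Qed.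

Lemma crossing_double_point (g : curve) (b : R) (pr : R * R) :
  closed_immersion g -> crossing_pair g b pr -> double_point g (g (fst pr)).
Proof.
  intros H P. pose proof (crossing_pair_distinct _ _ _ P) as N. destruct P as [_ [_ [E _]]].
  destruct (Z_fraction (fst pr) 0) as [i Hi]. destruct (Z_fraction (snd pr) 0) as [j Hj].
  exists (fst pr + IZR i), (snd pr + IZR j). repeat split; try lra.
  - intros A. apply N. apply (same_time_trans _ (fst pr + IZR i)); [now exists i|].
    rewrite A. apply same_time_sym. now exists j.
  - now apply curve_period.
  - rewrite E. now apply curve_period.
Qed.

Lemma double_pair_crossing (g : curve) (b t1 t2 : R) (d : point) :
  generic_immersion g -> regular_time g b -> double_pair g d t1 t2 ->
  exists pr, crossing_pair g b pr /\ g (fst pr) = d /\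
    (same_time t1 (fst pr) /\ same_time t2 (snd pr) \/
     same_time t1 (snd pr) /\ same_time t2 (fst pr)).
Proof.
  intros Gen Rb [H1 [H2 [N [E1 E2]]]]. assert (H := proj1 Gen).
  assert (NS : ~ same_time t1 t2).
  { intros S. apply N. symmetry. apply same_time_close; auto. apply Rabs_def1; lra. }
  destruct (Z_fraction t1 b) as [k Hk].
  assert (Sk : same_time t1 (t1 + IZR k)) by now exists k.
  destruct (crossing_pair_of_times g b (t1 + IZR k) t2 Gen Rb) as [u' [Su [_ [_ P]]]].
  - lra.
  - rewrite curve_period; auto. congruence.
  - intros S. apply NS. exact (same_time_trans _ _ _ Sk S).
  - assert (Eu : g u' = d) by (rewrite (curve_same_time g t2 u'); auto).
    assert (Ek : g (t1 + IZR k) = d) by (rewrite curve_period; auto).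
    destruct P as [P|P]; [exists (t1 + IZR k, u')|exists (u', t1 + IZR k)]; simpl; auto.
Qed.

(** The choice in [theta] may take the two times in either order, but the angle between one velocity
    and the opposite of the other is symmetric in the two. *)
Lemma theta_crossing (g : curve) (b : R) (pr : R * R) :
  generic_immersion g -> regular_time g b -> crossing_pair g b pr ->
  theta g (g (fst pr)) = angle (vel g (fst pr)) (popp (vel g (snd pr))).
Proof.
  intros Gen Rb P. assert (H := proj1 Gen).
  assert (X : is_theta g (g (fst pr)) (theta g (g (fst pr)))).
  { unfold theta. apply epsilon_spec.
    destruct (crossing_double_point g b pr H P) as [t1 [t2 D]].
    eexists. exists t1, t2. split; [exact D|reflexivity]. }
  destruct X as [t1 [t2 [D ->]]].
  destruct (double_pair_crossing g b t1 t2 _ Gen Rb D) as [pr' [P' [E' S]]].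
  assert (pr' = pr) as -> by (apply (crossing_pair_unique g b); auto).
  destruct S as [[S1 S2]|[S1 S2]];
    apply same_time_sym in S1; apply same_time_sym in S2;
    rewrite (vel_same_time g _ _ H S1), (vel_same_time g _ _ H S2); auto.
  unfold angle. rewrite !norm2_opp.
  f_equal. f_equal; [plane; ring|apply Rmult_comm].
Qed.

Lemma double_points_crossings (g : curve) (b : R) (L : list (R * R)) :
  generic_immersion g -> regular_time g b -> crossing_list g b L ->
  Permutation (double_points g) (map (fun pr => g (fst pr)) L).
Proof.
  intros Gen Rb [ND HL]. assert (H := proj1 Gen).
  destruct (double_points_spec g Gen) as [ND' HD].
  apply NoDup_Permutation; auto.
  - apply NoDup_map_NoDup_ForallPairs; auto.
    intros pr pr' I I' E. apply (crossing_pair_unique g b); auto; now apply HL.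
  - intros d. rewrite HD, in_map_iff. split.
    + intros [t1 [t2 D]]. destruct (double_pair_crossing g b t1 t2 d Gen Rb D) as [pr [P [E _]]].
      exists pr. split; auto. now apply HL.
    + intros [pr [<- I]]. apply HL in I. now apply (crossing_double_point g b pr).
Qed.

Lemma qpow_shift (e : R) (n k : Z) : qpow e (n - k)%Z = qpow (e + IZR k / 2) n.
Proof.
  unfold qpow. rewrite minus_IZR.
  destruct (Req_EM_T ((IZR n - IZR k) / 2) e), (Req_EM_T (IZR n / 2) (e + IZR k / 2));
    auto; lra.
Qed.

Lemma fdiff_jump (e : R) (n : Z) : fdiff (qpow e) n = jump (fun v => qpow v n) e.
Proof.
  unfold fdiff, fsub, fshift, jump. rewrite !qpow_shift.
  replace (e + -1 / 2) with (e - 1 / 2) by lra. reflexivity.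
Qed.

Definition turn (g : curve) (ph : R -> R) (pr : R * R) : R :=
  angle (vel g (fst pr)) (popp (vel g (snd pr))) + ph (snd pr) - ph (fst pr).

Lemma Iq_formula (g : curve) (b : R) (n : Z) (L : list (R * R)) (ph : R -> R) :
  generic_immersion g -> 0 <= b < 1 -> regular_time g b -> crossing_list g b L ->
  (forall t, is_derive ph t (curvature g t * speed g t)) ->
  2 * PI * Iq g n = (ph (b + 1) - ph b) * qpow (ext_index g (g b)) n
    - sum_list (fun pr => turn g ph pr *
        jump (fun v => qpow v n) (ext_index g (g (fst pr)))) L.
Proof.
  intros Gen Hb Rb HL D. assert (H := proj1 Gen).
  set (f := fun v => qpow v n). set (k := fun t => curvature g t * speed g t).
  assert (C : forall t, continuous k t) by (intros t; now apply curvature_continuous).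
  assert (HLb : forall pr, In pr L -> b < fst pr < b + 1 /\ b < snd pr < b + 1).
  { intros pr I. apply HL in I as [A [B _]]; auto. }
  assert (Int : is_RInt (fun t => k t * f (ext_index g (g t))) b (b + 1)
    ((ph (b + 1) - ph b) * f (ext_index g (g b)) +
     sum_list (fun pr => jump f (ext_index g (g (fst pr))) * (ph (fst pr) - ph (snd pr))) L)).
  { apply (is_RInt_except (fun t => k t * (f (ext_index g (g b)) + steps g f L t)) _
      (map fst L ++ map snd L)); [lra| |].
    - intros t Ht Nt. f_equal. symmetry. apply (ext_index_profile g f b); auto; [lra|].
      destruct (classic (regular_time g t)) as [|NR]; auto. exfalso.
      destruct (not_regular g t NR) as [u [Eu Nu]].
      destruct (crossing_pair_of_times g b t u Gen Rb ltac:(lra) Eu Nu) as [u' [_ [_ [_ P]]]].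
      apply Nt, in_app_iff. destruct P as [P|P]; apply HL in P; [left|right].
      + change t with (fst (t, u')). now apply in_map.
      + change t with (snd (u', t)). now apply in_map.
    - apply (is_RInt_ext (fun t => plus (scal (f (ext_index g (g b))) (k t))
        (k t * steps g f L t))).
      + intros t _. unfold plus, scal; simpl; unfold mult; simpl; eqR; ring.
      + evar_last.
        * apply (is_RInt_plus (V := R_NormedModule)).
          -- apply (is_RInt_scal (V := R_NormedModule)), (is_RInt_derive (V := R_CompleteNormedModule)); auto.
          -- apply is_RInt_steps with (ph := ph); auto.
        * unfold plus, scal, minus, opp; simpl; unfold plus, mult; simpl. eqR; ring. }
  apply is_RInt_period in Int; auto.
  (* Periodicity of the integrand, for which the acceleration has to be shifted as well. *)
  2:{ intros t. unfold k, curvature, speed. pose proof (vel_period g t 1 H) as V.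
      pose proof (curve_period g t 1 H) as P. rewrite V, P.
      assert (A : acc g (t + 1) = acc g t); [|now rewrite A].
      unfold acc. f_equal.
      - pose proof (acc_fst g t H) as A0. pose proof (acc_fst g (t + 1) H) as A1.
        apply is_derive_unique in A1. change (fst (acc g (t + 1)) = fst (acc g t)).
        rewrite <- A1. apply is_derive_unique.
        apply (is_derive_ext (fun u => fst (vel g (u - 1)))).
        + intros u. rewrite <- (vel_period g (u - 1) 1 H). f_equal. f_equal. ring.
        + evar_last; [apply (is_derive_comp (fun u => fst (vel g u)) (fun u => u - 1))|].
          * replace (t + 1 - 1) with t by ring. exact A0.
          * instantiate (1 := 1). auto_derive; auto.
          * unfold scal; simpl; unfold mult; simpl; eqR; ring.
      - pose proof (acc_snd g t H) as A0. pose proof (acc_snd g (t + 1) H) as A1.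
        apply is_derive_unique in A1. change (snd (acc g (t + 1)) = snd (acc g t)).
        rewrite <- A1. apply is_derive_unique.
        apply (is_derive_ext (fun u => snd (vel g (u - 1)))).
        + intros u. rewrite <- (vel_period g (u - 1) 1 H). f_equal. f_equal. ring.
        + evar_last; [apply (is_derive_comp (fun u => snd (vel g u)) (fun u => u - 1))|].
          * replace (t + 1 - 1) with t by ring. exact A0.
          * instantiate (1 := 1). auto_derive; auto.
          * unfold scal; simpl; unfold mult; simpl; eqR; ring. }
  unfold Iq, fscal, fsub, fint, fsum.
  change (RInt (fun t => curvature g t * speed g t * qpow (ext_index g (g t)) n) 0 1)
    with (RInt (fun t => k t * f (ext_index g (g t))) 0 1).
  rewrite (is_RInt_unique _ _ _ _ Int).
  rewrite (sum_list_permutation _ _ _ (double_points_crossings g b L Gen Rb HL)), sum_list_map.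
  (* The angle is split into the [turn] and a phase difference that cancels the contribution of the
     integral at this double point. *)
  rewrite (sum_list_ext (fun pr => theta g (g (fst pr)) * _) (fun pr => turn g ph pr * jump f (ext_index g (g (fst pr))) +
    jump f (ext_index g (g (fst pr))) * (ph (fst pr) - ph (snd pr)))).
  - rewrite sum_list_plus. unfold f. field. apply PI_neq0.
  - intros pr I. rewrite (theta_crossing g b); auto; [|now apply HL].
    rewrite fdiff_jump. unfold turn, f. ring.
Qed.

(** The positive cross product puts the rotation between the velocities, modulo 2 PI, in (0, PI),
    and the angle is its supplement. The bounds on [ph y - ph x] are recorded because they let a
    leash determine [m]. *)
Lemma turn_value (g : curve) (ph : R -> R) (x y : R) :
  closed_immersion g -> is_lift (vel g) ph -> 0 < cross (vel g x) (vel g y) ->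
  exists m : Z, 2 * PI * IZR m < ph y - ph x < 2 * PI * IZR m + PI /\
    turn g ph (x, y) = PI + 2 * PI * IZR m.
Proof.
  intros H Lf C. pose proof PI_RGT_0 as P.
  assert (nx : 0 < norm2 (vel g x)) by (apply norm2_pos, H).
  assert (ny : 0 < norm2 (vel g y)) by (apply norm2_pos, H).
  assert (nxy : 0 < norm2 (vel g x) * norm2 (vel g y)) by (apply Rmult_lt_0_compat; auto).
  pose proof (lift_dot _ _ _ _ y x Lf Lf) as Dt.
  rewrite (lift_cross _ _ _ _ x y Lf Lf) in C.
  destruct (Z_fraction ((ph y - ph x) / (2 * PI)) 0) as [k Hk].
  set (m := (- k)%Z). set (dl := ph y - ph x - 2 * PI * IZR m).
  assert (Edl : dl = 2 * PI * ((ph y - ph x) / (2 * PI) + IZR k)).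
  { unfold dl, m. rewrite opp_IZR. field. lra. }
  assert (R : 0 <= dl < 2 * PI) by (rewrite Edl; nra).
  assert (Ed : ph y - ph x = dl + 2 * PI * IZR m) by (unfold dl; ring).
  rewrite Ed in *. rewrite sin_period_Z in C. rewrite cos_period_Z in Dt.
  assert (S : 0 < sin dl) by nra.
  assert (d0 : 0 < dl) by (destruct (Req_dec dl 0) as [Z|]; [rewrite Z, sin_0 in S|]; lra).
  assert (d1 : dl < PI).
  { destruct (Rlt_dec dl PI); auto. assert (sin dl <= 0) by (apply sin_le_0; lra). lra. }
  exists m. split; [lra|]. unfold turn; simpl.
  assert (A : angle (vel g x) (popp (vel g y)) = PI - dl).
  { unfold angle. rewrite norm2_opp.
    replace (dot (vel g x) (popp (vel g y)) / (norm2 (vel g x) * norm2 (vel g y)))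
      with (cos (PI - dl)); [apply acos_cos; lra|].
    rewrite cos_minus, cos_PI, sin_PI.
    replace (dot (vel g x) (popp (vel g y))) with (- dot (vel g y) (vel g x)) by (plane; ring).
    rewrite Dt. field. lra. }
  rewrite A. lra.
Qed.

(** * Continuation of the double points along a homotopy *)

(** If 0 is a double time, the times just after it are regular. *)
Lemma exists_regular_time (g : curve) :
  generic_immersion g -> exists b, 0 <= b < 1 /\ regular_time g b.
Proof.
  intros Gen. assert (H := proj1 Gen).
  destruct (classic (regular_time g 0)) as [R0|N0]; [exists 0; split; auto; lra|].
  destruct (not_regular g 0 N0) as [u [Eu Nu]].
  assert (C := generic_transversal g 0 u Gen (eq_sym Eu) Nu).
  assert (X : exists d, 0 < d /\ forall t, 0 < t < 0 + d -> regular_time g t).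
  { destruct (Rlt_dec 0 (cross (vel g 0) (vel g u))) as [P|P].
    - destruct (ext_index_double g 0 u H Eu) as [d [d0 [_ [A _]]]]; auto.
      + intros v Ev. now apply (generic_times g).
      + exists d. split; auto. intros t Ht. now apply A.
    - destruct (ext_index_double g u 0 H (eq_sym Eu)) as [d [d0 [_ [_ [_ A]]]]].
      + intros v Ev. apply (generic_times g); auto. intros S; apply Nu, same_time_sym, S.
      + replace (cross (vel g u) (vel g 0)) with (- cross (vel g 0) (vel g u)) by (plane; ring).
        lra.
      + exists d. split; auto. intros t Ht. now apply A. }
  destruct X as [d [d0 Hd]].
  pose proof (Rmin_l d 1). pose proof (Rmin_r d 1).
  assert (0 < Rmin d 1) by (apply Rmin_glb_lt; lra).
  exists (Rmin d 1 / 2). split; [lra|]. apply Hd; lra.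
Qed.

Lemma crossing_list_exists (g : curve) (b : R) :
  generic_immersion g -> regular_time g b -> exists L, crossing_list g b L.
Proof.
  intros Gen Rb. assert (H := proj1 Gen).
  destruct (double_points_spec g Gen) as [ND HD].
  set (P := fun d pr => crossing_pair g b pr /\ g (fst pr) = d).
  set (pair := fun d => epsilon (inhabits (0, 0)) (P d)).
  assert (Hp : forall d, In d (double_points g) -> P d (pair d)).
  { intros d I. apply epsilon_spec. apply HD in I as [t1 [t2 D]].
    destruct (double_pair_crossing g b t1 t2 d Gen Rb D) as [pr [Ppr [E _]]].
    exists pr. split; auto. }
  exists (map pair (double_points g)). split.
  - apply NoDup_map_NoDup_ForallPairs; auto. intros d d' I I' E.
    destruct (Hp d I) as [_ <-]. destruct (Hp d' I') as [_ <-]. now rewrite E.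
  - intros pr. rewrite in_map_iff. split.
    + intros [d [<- I]]. now apply Hp.
    + intros Ppr. assert (I : In (g (fst pr)) (double_points g)).
      { apply HD. now apply (crossing_double_point g b). }
      exists (g (fst pr)). split; auto. destruct (Hp _ I) as [P' E'].
      now apply (crossing_pair_unique g b).
Qed.

Lemma injective_family (G : R -> curve) (s0 t0 : R) :
  C1_family G -> 0 <= s0 <= 1 ->
  exists d, 0 < d /\ forall s x y, 0 <= s <= 1 -> Rabs (s - s0) < d ->
    Rabs (x - t0) < d -> Rabs (y - t0) < d -> G s x = G s y -> x = y.
Proof.
  intros HG Hs0. set (v := vel (G s0) t0).
  assert (v0 : 0 < norm2 v) by (apply norm2_pos, HG, Hs0).
  destruct (strict_derivative G s0 t0 (norm2 v / 2) HG Hs0) as [d [d0 Hd]]; [lra|].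
  exists d; split; auto. intros s x y Hs Hsd Hx Hy E.
  specialize (Hd s x y Hs Hsd Hx Hy). rewrite E in Hd. fold v in Hd.
  replace (psub (psub (G s y) (G s y)) (pscal (y - x) v)) with (popp (pscal (y - x) v)) in Hd
    by (destruct (G s y); clearbody v; plane; f_equal; ring).
  rewrite norm2_opp, norm2_scal in Hd. pose proof (Rabs_pos (y - x)).
  assert (Z0 : Rabs (y - x) = 0) by nra.
  destruct (Req_dec (y - x) 0) as [|n]; [lra|]. apply Rabs_no_R0 in n. lra.
Qed.

(** No double point is born: by compactness in both times, a pair of double times of a nearby curve
    is close to such a pair of [G s0]. Pairs near the diagonal are excluded by uniform local
    injectivity. *)
Lemma double_times_close (G : R -> curve) (s0 a b eta : R) :
  C1_family G -> 0 <= s0 <= 1 -> 0 < eta ->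
  exists d, 0 < d /\ forall s x y, 0 <= s <= 1 -> Rabs (s - s0) < d ->
    a <= x <= b -> a <= y <= b -> G s x = G s y -> ~ same_time x y ->
    exists x0 y0, a <= x0 <= b /\ a <= y0 <= b /\ G s0 x0 = G s0 y0 /\ ~ same_time x0 y0 /\
      Rabs (x - x0) < eta /\ Rabs (y - y0) < eta.
Proof.
  intros HG Hs0 eta0. pose proof HG as [HC [HP HV]].
  set (Q := fun s x y => G s x = G s y -> ~ same_time x y ->
    exists x0 y0, a <= x0 <= b /\ a <= y0 <= b /\ G s0 x0 = G s0 y0 /\ ~ same_time x0 y0 /\
      Rabs (x - x0) < eta /\ Rabs (y - y0) < eta).
  destruct (tube (fun d s => 0 <= s <= 1 /\ Rabs (s - s0) < d)
    (fun s x => forall y, a <= y <= b -> Q s x y) a b) as [d [d0 Hd]].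
  - intros d d' s Hd [A B]; split; auto; lra.
  - intros x0 Hx0.
    destruct (tube (fun d (z : R * R) => 0 <= fst z <= 1 /\ Rabs (fst z - s0) < d /\
        Rabs (snd z - x0) < d) (fun z y => Q (fst z) (snd z) y) a b) as [d [d0 Hd]].
    + intros d d' z Hd [A [B C]]; repeat split; try apply A; lra.
    + intros y0 Hy0. destruct (classic (G s0 x0 = G s0 y0)) as [E|N].
      * destruct (classic (same_time x0 y0)) as [[k Hk]|NS].
        (* The diagonal modulo 1: [y] is shifted by an integer to the neighbourhood of [x0]. *)
        -- destruct (injective_family G s0 x0 HG Hs0) as [d [d0 Hd]].
           exists d; split; auto. intros [s x] y [A [B C]] Hy E' N'. exfalso. simpl in *.
           apply N'. exists k. enough (x = y + IZR (- k)) by (rewrite opp_IZR in *; lra).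
           apply (Hd s); auto.
           ++ rewrite opp_IZR. replace (y + - IZR k - x0) with (y - y0) by lra. auto.
           ++ rewrite curve_period; auto.
        -- exists eta; split; auto. intros [s x] y [A [B C]] Hy _ _. exists x0, y0. simpl in *. tauto.
      * set (m := dist2 (G s0 x0) (G s0 y0)).
        assert (m0 : 0 < m) by (apply norm2_pos; intros Z0; apply N, psub_eq0, Z0).
        destruct (HP s0 x0 (m / 2) Hs0) as [e1 [e10 He1]]; [lra|].
        destruct (HP s0 y0 (m / 2) Hs0) as [e2 [e20 He2]]; [lra|].
        pose proof (Rmin_l e1 e2). pose proof (Rmin_r e1 e2).
        exists (Rmin e1 e2). split; [apply Rmin_glb_lt; auto|].
        intros [s x] y [A [B C]] Hy E _. exfalso. simpl in *.
        specialize (He1 s x A ltac:(lra) ltac:(lra)).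
        specialize (He2 s y A ltac:(lra) ltac:(lra)).
        pose proof (dist2_triang (G s0 x0) (G s x) (G s0 y0)) as T. fold m in T.
        rewrite (dist2_sym (G s0 x0) (G s x)), E in T. rewrite E in He1. lra.
    + exists d; split; auto. intros s x [A B] Hx y Hy.
      apply (Hd (s, x) y); auto.
  - exists d; split; auto. intros s x y Hs Hsd Hx Hy. apply (Hd s x); auto.
Qed.

(** Double points cannot merge: the difference [G s x - G s y] has a nearly constant derivative in
    [(x, y)], invertible by transversality. *)
Lemma crossing_unique_near (G : R -> curve) (s0 x0 y0 : R) :
  C1_family G -> 0 <= s0 <= 1 -> 0 < cross (vel (G s0) x0) (vel (G s0) y0) ->
  exists d, 0 < d /\ forall s x y x' y', 0 <= s <= 1 -> Rabs (s - s0) < d ->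
    Rabs (x - x0) < d -> Rabs (x' - x0) < d -> Rabs (y - y0) < d -> Rabs (y' - y0) < d ->
    G s x = G s y -> G s x' = G s y' -> x' = x /\ y' = y.
Proof.
  intros HG Hs0 C. set (v1 := vel (G s0) x0) in *. set (v2 := vel (G s0) y0) in *.
  set (c := cross v1 v2) in *.
  assert (n1 : 0 < norm2 v1) by (apply norm2_pos, HG, Hs0).
  assert (n2 : 0 < norm2 v2) by (apply norm2_pos, HG, Hs0).
  set (eta := c / (2 * (norm2 v1 + norm2 v2))).
  assert (e0 : 0 < eta) by (apply Rdiv_lt_0_compat; lra).
  assert (Eeta : 2 * eta * (norm2 v1 + norm2 v2) = c) by (unfold eta; field; lra).
  destruct (strict_derivative G s0 x0 eta HG Hs0 e0) as [d1 [d10 H1]]. fold v1 in H1.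
  destruct (strict_derivative G s0 y0 eta HG Hs0 e0) as [d2 [d20 H2]]. fold v2 in H2.
  pose proof (Rmin_l d1 d2). pose proof (Rmin_r d1 d2).
  exists (Rmin d1 d2). split; [apply Rmin_glb_lt; auto|].
  intros s x y x' y' Hs Hsd Hx Hx' Hy Hy' E E'.
  specialize (H1 s x x' Hs ltac:(lra) ltac:(lra) ltac:(lra)).
  specialize (H2 s y y' Hs ltac:(lra) ltac:(lra) ltac:(lra)).
  rewrite E, E' in H1. set (w := psub (G s y') (G s y)) in *.
  set (e1 := psub w (pscal (x' - x) v1)) in *. set (e2 := psub w (pscal (y' - y) v2)) in *.
  set (h := x' - x) in *. set (k := y' - y) in *.
  (* Cramer's rule for the increments [h] and [k], with the error [e2 - e1] as right-hand side. *)
  assert (A1 : h * c = cross (psub e2 e1) v2)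
    by (unfold e1, e2, c; clearbody w v1 v2; plane; ring).
  assert (A2 : k * c = cross (psub e2 e1) v1)
    by (unfold e1, e2, c; clearbody w v1 v2; plane; ring).
  assert (Ne : norm2 (psub e2 e1) <= eta * (Rabs h + Rabs k)).
  { replace (psub e2 e1) with (padd e2 (popp e1)) by (clearbody e1 e2; plane; f_equal; ring).
    eapply Rle_trans; [apply norm2_triang|]. rewrite norm2_opp. lra. }
  pose proof (cross_le (psub e2 e1) v2) as C2. rewrite <- A1, Rabs_mult, (Rabs_pos_eq c) in C2 by lra.
  pose proof (cross_le (psub e2 e1) v1) as C1. rewrite <- A2, Rabs_mult, (Rabs_pos_eq c) in C1 by lra.
  pose proof (Rabs_pos h). pose proof (Rabs_pos k).
  assert (B2 : norm2 (psub e2 e1) * norm2 v2 <= eta * (Rabs h + Rabs k) * norm2 v2)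
    by (apply Rmult_le_compat_r; lra).
  assert (B1 : norm2 (psub e2 e1) * norm2 v1 <= eta * (Rabs h + Rabs k) * norm2 v1)
    by (apply Rmult_le_compat_r; lra).
  (* The choice of [eta] bounds the errors by half of the left-hand side, so both increments
     vanish. *)
  assert (S : (Rabs h + Rabs k) * c <= (Rabs h + Rabs k) * (c / 2)).
  { replace (c / 2) with (eta * (norm2 v1 + norm2 v2)) by lra. lra. }
  assert (Z0 : Rabs h + Rabs k = 0) by nra.
  assert (Zh : h = 0).
  { destruct (Req_dec h 0) as [|n]; auto. apply Rabs_pos_lt in n. lra. }
  assert (Zk : k = 0).
  { destruct (Req_dec k 0) as [|n]; auto. apply Rabs_pos_lt in n. lra. }
  unfold h, k in *. lra.
Qed.

Lemma cross_sign_near (G : R -> curve) (s0 x0 y0 : R) :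
  C1_family G -> 0 <= s0 <= 1 -> 0 < cross (vel (G s0) x0) (vel (G s0) y0) ->
  exists d, 0 < d /\ forall s x y, 0 <= s <= 1 -> Rabs (s - s0) < d ->
    Rabs (x - x0) < d -> Rabs (y - y0) < d -> 0 < cross (vel (G s) x) (vel (G s) y).
Proof.
  intros [HC [_ HV]] Hs0 C. set (v1 := vel (G s0) x0) in *. set (v2 := vel (G s0) y0) in *.
  pose proof (norm2_ge0 v1). pose proof (norm2_ge0 v2).
  set (c := cross v1 v2) in *. set (M := norm2 v1 + norm2 v2 + 1).
  set (eps := Rmin 1 (c / (2 * M))).
  assert (Mp : 0 < M) by (unfold M; lra).
  assert (e0 : 0 < eps) by (apply Rmin_glb_lt; [lra|apply Rdiv_lt_0_compat; lra]).
  assert (e1 : eps <= 1) by apply Rmin_l.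
  assert (e2 : eps * M <= c / 2).
  { replace (c / 2) with (c / (2 * M) * M) by (field; lra).
    apply Rmult_le_compat_r; [lra|apply Rmin_r]. }
  destruct (HV s0 x0 eps Hs0 e0) as [d1 [d10 H1]]. fold v1 in H1.
  destruct (HV s0 y0 eps Hs0 e0) as [d2 [d20 H2]]. fold v2 in H2.
  pose proof (Rmin_l d1 d2). pose proof (Rmin_r d1 d2).
  exists (Rmin d1 d2). split; [apply Rmin_glb_lt; auto|].
  intros s x y Hs Hsd Hx Hy.
  specialize (H1 s x Hs ltac:(lra) ltac:(lra)). specialize (H2 s y Hs ltac:(lra) ltac:(lra)).
  simpl in H1, H2. set (w1 := vel (G s) x) in *. set (w2 := vel (G s) y) in *.
  unfold dist2 in *.
  assert (Nw : norm2 w1 <= norm2 v1 + eps).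
  { replace w1 with (padd v1 (psub w1 v1)) by apply padd_psub.
    eapply Rle_trans; [apply norm2_triang|]. lra. }
  replace (cross w1 w2) with (c + cross (psub w1 v1) v2 + cross w1 (psub w2 v2))
    by (unfold c; clearbody v1 v2 w1 w2; plane; ring).
  pose proof (cross_le (psub w1 v1) v2) as C1. pose proof (cross_le w1 (psub w2 v2)) as C2.
  apply Rcomplements.Rabs_le_between in C1. apply Rcomplements.Rabs_le_between in C2.
  pose proof (norm2_ge0 (psub w1 v1)). pose proof (norm2_ge0 (psub w2 v2)).
  pose proof (norm2_ge0 w1).
  assert (norm2 (psub w1 v1) * norm2 v2 <= eps * norm2 v2) by (apply Rmult_le_compat_r; lra).
  assert (norm2 w1 * norm2 (psub w2 v2) <= (norm2 v1 + 1) * eps)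
    by (apply Rmult_le_compat; lra).
  unfold M in e2. lra.
Qed.

(** Supplies the hypothesis of the leash for tangent vectors, uniformly in the affine parameter by
    compactness. *)
Lemma tangent_path_close (G : R -> curve) (s0 x0 y0 : R) :
  C1_family G -> 0 <= s0 <= 1 ->
  exists d, 0 < d /\ forall s x y, 0 <= s <= 1 -> Rabs (s - s0) < d ->
    Rabs (x - x0) < d -> Rabs (y - y0) < d -> forall l, 0 <= l <= 1 ->
    0 < dot (vel (G s0) (x0 + l * (y0 - x0))) (vel (G s) (x + l * (y - x))).
Proof.
  intros HG Hs0. pose proof HG as [HC [_ HV]].
  destruct (tube (fun d (z : R * R * R) => let '(s, x, y) := z in
      0 <= s <= 1 /\ Rabs (s - s0) < d /\ Rabs (x - x0) < d /\ Rabs (y - y0) < d)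
    (fun z l => let '(s, x, y) := z in 0 <= l <= 1 ->
      0 < dot (vel (G s0) (x0 + l * (y0 - x0))) (vel (G s) (x + l * (y - x)))) 0 1)
    as [d [d0 Hd]].
  - intros d d' [[s x] y] Hd [A [B [C D]]]. repeat split; try apply A; lra.
  - intros l0 _. set (p0 := x0 + l0 * (y0 - x0)). set (v := vel (G s0) p0).
    assert (v0 : 0 < norm2 v) by (apply norm2_pos, HC, Hs0).
    destruct (HV s0 p0 (norm2 v / 4) Hs0) as [e [e0 He]]; [lra|]. fold v in He.
    (* Half of [e] is for the change of endpoints, and half for the change of [l], which is scaled
       by [y0 - x0]. *)
    set (d := Rmin (e / 2) (e / 2 / (Rabs (y0 - x0) + 1))).
    pose proof (Rabs_pos (y0 - x0)) as Yp.
    assert (d0 : 0 < d) by (apply Rmin_glb_lt; [lra|apply Rdiv_lt_0_compat; lra]).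
    assert (de : d <= e / 2) by apply Rmin_l.
    assert (dm : d * (Rabs (y0 - x0) + 1) <= e / 2).
    { apply Rle_trans with (e / 2 / (Rabs (y0 - x0) + 1) * (Rabs (y0 - x0) + 1)).
      - apply Rmult_le_compat_r; [lra|apply Rmin_r].
      - right. field. lra. }
    exists d; split; auto. intros [[s x] y] l [A [B [C D]]] Hl Hl01.
    assert (P0 : Rabs (x0 + l * (y0 - x0) - p0) < e / 2).
    { replace (x0 + l * (y0 - x0) - p0) with ((l - l0) * (y0 - x0)) by (unfold p0; ring).
      rewrite Rabs_mult. pose proof (Rabs_pos (l - l0)).
      assert (Rabs (l - l0) * Rabs (y0 - x0) <= d * Rabs (y0 - x0))
        by (apply Rmult_le_compat_r; lra). lra. }
    assert (P1 : Rabs (x + l * (y - x) - (x0 + l * (y0 - x0))) <= d).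
    { replace (x + l * (y - x) - (x0 + l * (y0 - x0))) with
        ((1 - l) * (x - x0) + l * (y - y0)) by ring.
      eapply Rle_trans; [apply Rabs_triang|]. rewrite !Rabs_mult, !(Rabs_pos_eq (_ - l)),
        (Rabs_pos_eq l) by lra.
      assert ((1 - l) * Rabs (x - x0) <= (1 - l) * d) by (apply Rmult_le_compat_l; lra).
      assert (l * Rabs (y - y0) <= l * d) by (apply Rmult_le_compat_l; lra). lra. }
    assert (P2 : Rabs (x + l * (y - x) - p0) < e).
    { replace (x + l * (y - x) - p0) with
        ((x + l * (y - x) - (x0 + l * (y0 - x0))) + (x0 + l * (y0 - x0) - p0)) by ring.
      eapply Rle_lt_trans; [apply Rabs_triang|]. lra. }
    assert (S0 : Rabs (s0 - s0) < e) by (rewrite Rminus_diag, Rabs_R0; auto).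
    pose proof (He s0 (x0 + l * (y0 - x0)) Hs0 S0 ltac:(lra)) as Q0.
    pose proof (He s (x + l * (y - x)) A ltac:(lra) P2) as Q1.
    simpl in Q0, Q1. set (a := vel (G s0) (x0 + l * (y0 - x0))) in *.
    set (c := vel (G s) (x + l * (y - x))) in *.
    apply dot_close_pos. pose proof (dist2_triang c v a) as T.
    rewrite (dist2_sym v a) in T. unfold dist2 in *.
    assert (norm2 v <= norm2 a + norm2 (psub a v)).
    { replace v with (padd a (popp (psub a v))) at 1 by (clearbody a v; plane; f_equal; ring).
      eapply Rle_trans; [apply norm2_triang|]. rewrite norm2_opp. lra. }
    lra.
  - exists d; split; auto. intros s x y Hs Hsd Hx Hy l Hl.
    apply (Hd (s, x, y) l); auto.
Qed.

Lemma ext_index_constant (g : curve) (a b : R) :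
  closed_immersion g -> a <= b -> (forall t, a <= t <= b -> regular_time g t) ->
  ext_index g (g b) = ext_index g (g a).
Proof.
  intros H ab R. apply (loc_const (fun t => ext_index g (g t)) a b); auto.
  intros t Ht. destruct (ext_index_near g t H (R t Ht)) as [d [d0 Hd]].
  exists d; split; auto. intros y _ Hy. now apply Hd.
Qed.

Lemma crossing_isolated (g : curve) (b : R) (pr : R * R) :
  generic_immersion g -> crossing_pair g b pr ->
  exists d, 0 < d /\ forall t, Rabs (t - fst pr) < d -> regular_time g t \/ t = fst pr.
Proof.
  intros Gen P. destruct (ext_index_crossing g b pr Gen P) as [d [d0 [A1 [A2 _]]]].
  exists d; split; auto. intros t Ht. apply Rabs_def2 in Ht.
  destruct (Rtotal_order t (fst pr)) as [l|[E|l]]; auto; left.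
  - apply A1; lra.
  - apply A2; lra.
Qed.

(* The index along the curve jumps across [fst pr], so a double point must persist
   there; its partner stays near [snd pr] by compactness. *)
Lemma crossing_continuation (G : R -> curve) (s0 b : R) (pr : R * R) (eta : R) :
  C1_family G -> (forall s, 0 <= s <= 1 -> generic_immersion (G s)) -> 0 <= s0 <= 1 ->
  regular_time (G s0) b -> crossing_pair (G s0) b pr -> 0 < eta ->
  exists d, 0 < d /\ forall s, 0 <= s <= 1 -> Rabs (s - s0) < d ->
    exists pr', crossing_pair (G s) b pr' /\ Rabs (fst pr' - fst pr) < eta /\
      Rabs (snd pr' - snd pr) < eta /\
      ext_index (G s) (G s (fst pr')) = ext_index (G s0) (G s0 (fst pr)).
Proof.
  intros HG Gen Hs0 Rb P eta0. pose proof HG as [HC _].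
  destruct pr as [x0 y0]. pose proof P as [X0 [Y0 [E0 C0]]]. simpl in *.
  pose proof (crossing_pair_distinct _ _ _ P) as N0. simpl in N0.
  destruct (ext_index_crossing _ b _ (Gen s0 Hs0) P) as [de [de0 [A1 [A2 _]]]]. simpl in A1, A2.
  set (e := ext_index (G s0) (G s0 x0)) in *.
  destruct (crossing_unique_near G s0 x0 y0 HG Hs0 C0) as [du [du0 Uniq]].
  destruct (cross_sign_near G s0 x0 y0 HG Hs0 C0) as [dc [dc0 Sign]].
  set (rho := Rmin (de / 4) (Rmin ((x0 - b) / 2) ((b + 1 - x0) / 2))).
  assert (rho0 : 0 < rho) by (repeat apply Rmin_glb_lt; lra).
  assert (r1 : rho <= de / 4) by apply Rmin_l.
  assert (r2 : rho <= (x0 - b) / 2) by (eapply Rle_trans; [apply Rmin_r|apply Rmin_l]).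
  assert (r3 : rho <= (b + 1 - x0) / 2) by (eapply Rle_trans; [apply Rmin_r|apply Rmin_r]).
  set (et := Rmin (Rmin eta du) (Rmin dc rho)).
  assert (et0 : 0 < et) by (repeat apply Rmin_glb_lt; lra).
  assert (t1 : et <= eta) by (eapply Rle_trans; [apply Rmin_l|apply Rmin_l]).
  assert (t2 : et <= du) by (eapply Rle_trans; [apply Rmin_l|apply Rmin_r]).
  assert (t3 : et <= dc) by (eapply Rle_trans; [apply Rmin_r|apply Rmin_l]).
  assert (t4 : et <= rho) by (eapply Rle_trans; [apply Rmin_r|apply Rmin_r]).
  destruct (double_times_close G s0 b (b + 1) et HG Hs0 et0) as [d1 [d10 Close]].
  destruct (A1 (x0 - rho)) as [Ra Ea]; [lra|]. destruct (A2 (x0 + rho)) as [Ra' Ea']; [lra|].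
  destruct (ext_index_family G s0 (x0 - rho) HG Hs0 Ra) as [d2 [d20 Ka]].
  destruct (ext_index_family G s0 (x0 + rho) HG Hs0 Ra') as [d3 [d30 Ka']].
  destruct (ext_index_family G s0 b HG Hs0 Rb) as [d4 [d40 Kb]].
  set (d := Rmin (Rmin (Rmin d1 d2) (Rmin d3 d4)) (Rmin du dc)).
  assert (d0 : 0 < d) by (repeat apply Rmin_glb_lt; auto).
  assert (D1 : d <= Rmin (Rmin d1 d2) (Rmin d3 d4)) by apply Rmin_l.
  assert (D2 : d <= Rmin du dc) by apply Rmin_r.
  pose proof (Rmin_l (Rmin d1 d2) (Rmin d3 d4)). pose proof (Rmin_r (Rmin d1 d2) (Rmin d3 d4)).
  pose proof (Rmin_l d1 d2). pose proof (Rmin_r d1 d2).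
  pose proof (Rmin_l d3 d4). pose proof (Rmin_r d3 d4).
  pose proof (Rmin_l du dc). pose proof (Rmin_r du dc).
  exists d; split; auto. intros s Hs Hsd.
  assert (Hc := HC s Hs). assert (Hg := Gen s Hs).
  assert (Z : forall t q, 0 < q -> Rabs (t - t) < q) by (intros; rewrite Rminus_diag, Rabs_R0; auto).
  destruct (Ka s (x0 - rho) Hs ltac:(lra) (Z _ _ d20)) as [Rsa Esa].
  destruct (Ka' s (x0 + rho) Hs ltac:(lra) (Z _ _ d30)) as [Rsa' Esa'].
  destruct (Kb s b Hs ltac:(lra) (Z _ _ d40)) as [Rsb _].
  (* A double time of [G s] in this window is close to a double time of [G s0], which can only be
     [x0]; its partner is then close to [y0]. *)
  assert (Near : forall t, x0 - rho <= t <= x0 + rho -> ~ regular_time (G s) t ->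
    exists u, crossing_pair (G s) b (t, u) /\ Rabs (t - x0) < et /\ Rabs (u - y0) < et).
  { intros t Ht NR. destruct (not_regular _ t NR) as [u0 [Eu0 Nu0]].
    destruct (crossing_pair_of_times (G s) b t u0 Hg Rsb ltac:(lra) Eu0 Nu0)
      as [u [Su [It [Iu PP]]]].
    assert (Etu : G s t = G s u) by (rewrite <- Eu0; symmetry; now apply curve_same_time).
    assert (Ntu : ~ same_time t u).
    { intros S. apply Nu0. exact (same_time_trans _ _ _ S (same_time_sym _ _ Su)). }
    destruct (Close s t u Hs ltac:(lra) ltac:(lra) ltac:(lra) Etu Ntu)
      as [x1 [y1 [X1 [Y1 [E1 [N1 [Cx Cy]]]]]]].
    assert (x1 = x0) as ->.
    { apply Rabs_def2 in Cx. destruct (Rtotal_order x1 x0) as [l|[|l]]; auto; exfalso; apply N1.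
      - apply (A1 x1); [lra|]. now rewrite E1.
      - apply (A2 x1); [lra|]. now rewrite E1. }
    assert (y1 = y0) as ->.
    { destruct (generic_times (G s0) x0 y0 y1 (Gen s0 Hs0) E0 N0) as [S|S]; auto; [contradiction|].
      apply same_time_close; auto. apply Rabs_def1; lra. }
    exists u. split; [|auto].
    assert (0 < cross (vel (G s) t) (vel (G s) u)) by (apply Sign; auto; lra).
    repeat split; simpl; auto; lra. }
  (* With regular times only, the index would be constant from [x0 - rho] to [x0 + rho], yet it
     drops by one. *)
  assert (Ex : exists t, x0 - rho <= t <= x0 + rho /\ ~ regular_time (G s) t).
  { apply NNPP. intros NE.
    assert (K : ext_index (G s) (G s (x0 + rho)) = ext_index (G s) (G s (x0 - rho))).
    { apply ext_index_constant; auto; [lra|]. intros t Ht. apply NNPP. intros NR.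
      apply NE. now exists t. }
    rewrite Esa, Esa', Ea, Ea' in K. lra. }
  destruct Ex as [x [Hx NRx]]. destruct (Near x Hx NRx) as [y [Pxy [Cx Cy]]].
  exists (x, y). simpl. split; [auto|]. split; [lra|]. split; [lra|].
  destruct (ext_index_crossing (G s) b _ Hg Pxy) as [dx [dx0 [B1 _]]]. simpl in B1.
  assert (xa : x0 - rho < x).
  { destruct (Req_dec x (x0 - rho)) as [->|]; [contradiction|lra]. }
  (* A time just before [x] and still in the window. Uniqueness leaves no double time up to it, so
     the index there is the one at [x0 - rho]. *)
  set (tm := Rmax (x0 - rho) (x - dx / 2)).
  assert (tm1 : x0 - rho <= tm) by apply Rmax_l.
  assert (tm2 : x - dx / 2 <= tm) by apply Rmax_r.
  assert (tm3 : tm < x) by (apply Rmax_lub_lt; lra).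
  destruct (B1 tm) as [_ Etm]; [lra|].
  assert (K : ext_index (G s) (G s tm) = ext_index (G s) (G s (x0 - rho))).
  { apply ext_index_constant; auto. intros t Ht. apply NNPP. intros NR.
    destruct (Near t) as [u [Ptu [Ct Cu]]]; [lra|auto|].
    destruct Pxy as [_ [_ [Exy _]]]. destruct Ptu as [_ [_ [Etu _]]]. simpl in Exy, Etu.
    destruct (Uniq s x y t u Hs ltac:(lra) ltac:(lra) ltac:(lra) ltac:(lra) ltac:(lra) Exy Etu)
      as [A _]. lra. }
  rewrite Etm, Esa, Ea in K. lra.
Qed.

(** Both turns lie in PI + 2 PI Z, and a leash compares them. The lifts [ph0] and [ph] are chosen
    independently, as only their increments enter. *)
Lemma turn_locally_constant (G : R -> curve) (s0 x0 y0 : R) :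
  C1_family G -> 0 <= s0 <= 1 -> 0 < cross (vel (G s0) x0) (vel (G s0) y0) ->
  exists d, 0 < d /\ forall s x y ph0 ph, 0 <= s <= 1 -> Rabs (s - s0) < d ->
    Rabs (x - x0) < d -> Rabs (y - y0) < d ->
    is_lift (vel (G s0)) ph0 -> is_lift (vel (G s)) ph ->
    0 < cross (vel (G s) x) (vel (G s) y) /\ turn (G s) ph (x, y) = turn (G s0) ph0 (x0, y0).
Proof.
  intros HG Hs0 C. pose proof HG as [HC _].
  destruct (cross_sign_near G s0 x0 y0 HG Hs0 C) as [d1 [d10 H1]].
  destruct (tangent_path_close G s0 x0 y0 HG Hs0) as [d2 [d20 H2]].
  pose proof (Rmin_l d1 d2). pose proof (Rmin_r d1 d2).
  exists (Rmin d1 d2). split; [apply Rmin_glb_lt; auto|].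
  intros s x y ph0 ph Hs Hsd Hx Hy L0 L.
  assert (C' : 0 < cross (vel (G s) x) (vel (G s) y)) by (apply H1; auto; lra).
  split; auto.
  destruct (turn_value (G s0) ph0 x0 y0 (HC s0 Hs0) L0 C) as [m0 [B0 ->]].
  destruct (turn_value (G s) ph x y (HC s Hs) L C') as [m [B ->]].
  do 2 f_equal. f_equal. symmetry. apply two_PI_Z_eq.
  assert (T : Rabs ((ph0 y0 - ph0 x0) - (ph y - ph x)) < PI).
  { apply (leash (vel (G s0)) (vel (G s))); auto. apply H2; auto; lra. }
  apply Rabs_def2 in T. apply Rabs_def1; lra.
Qed.

(** The local form of the invariance of the rotation number under regular homotopy. *)
Lemma rotation_locally_constant (G : R -> curve) (s0 b : R) :
  C1_family G -> 0 <= s0 <= 1 ->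
  exists d, 0 < d /\ forall s ph0 ph, 0 <= s <= 1 -> Rabs (s - s0) < d ->
    is_lift (vel (G s0)) ph0 -> is_lift (vel (G s)) ph ->
    ph (b + 1) - ph b = ph0 (b + 1) - ph0 b.
Proof.
  intros HG Hs0. pose proof HG as [HC _].
  destruct (tangent_path_close G s0 b (b + 1) HG Hs0) as [d [d0 Hd]].
  exists d; split; auto. intros s ph0 ph Hs Hsd L0 L.
  assert (Turn : forall s ph, 0 <= s <= 1 -> is_lift (vel (G s)) ph ->
    exists k : Z, ph (b + 1) - ph b = 2 * PI * IZR k).
  { intros s' ph' Hs' L'. apply (lift_turn (vel (G s'))); auto.
    - symmetry. apply (vel_period _ b 1); auto.
    - apply HC; auto. }
  destruct (Turn s ph Hs L) as [k Hk]. destruct (Turn s0 ph0 Hs0 L0) as [k0 Hk0].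
  rewrite Hk, Hk0. do 2 f_equal. symmetry. apply two_PI_Z_eq. rewrite <- Hk, <- Hk0.
  pose proof PI_RGT_0. eapply Rlt_trans; [|instantiate (1 := PI); lra].
  apply (leash (vel (G s0)) (vel (G s))); auto.
  apply Hd; auto; rewrite Rminus_diag, Rabs_R0; auto.
Qed.

(** [move] follows each crossing to the one nearby. It is injective because the crossings of [G s0]
    are isolated, and surjective because every crossing of [G s] is close to one of [G s0] and
    unique near it. *)
Lemma crossing_list_continuation (G : R -> curve) (s0 b : R) (L0 : list (R * R)) (eta : R) :
  C1_family G -> (forall s, 0 <= s <= 1 -> generic_immersion (G s)) -> 0 <= s0 <= 1 ->
  regular_time (G s0) b -> crossing_list (G s0) b L0 -> 0 < eta ->
  exists d, 0 < d /\ forall s, 0 <= s <= 1 -> Rabs (s - s0) < d ->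
    exists move, crossing_list (G s) b (map move L0) /\
      forall pr, In pr L0 ->
        Rabs (fst (move pr) - fst pr) < eta /\ Rabs (snd (move pr) - snd pr) < eta /\
        ext_index (G s) (G s (fst (move pr))) = ext_index (G s0) (G s0 (fst pr)).
Proof.
  intros HG Gen Hs0 Rb [ND HL] eta0. pose proof HG as [HC _].
  assert (X : exists e, 0 < e /\ forall pr l, In pr L0 -> 0 < l <= e ->
    (forall s x y, 0 <= s <= 1 -> Rabs (s - s0) < l -> Rabs (x - fst pr) < l ->
      Rabs (y - snd pr) < l -> 0 < cross (vel (G s) x) (vel (G s) y)) /\
    (forall s x y x' y', 0 <= s <= 1 -> Rabs (s - s0) < l ->
      Rabs (x - fst pr) < l -> Rabs (x' - fst pr) < l ->
      Rabs (y - snd pr) < l -> Rabs (y' - snd pr) < l ->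
      G s x = G s y -> G s x' = G s y' -> x' = x /\ y' = y) /\
    (* Twice the radius, since two pairs with the same image have first times less than [2 * l]
       apart. *)
    (forall t, Rabs (t - fst pr) < 2 * l -> regular_time (G s0) t \/ t = fst pr)).
  { apply common_radius. intros pr I. apply HL in I as P. pose proof P as [_ [_ [_ C]]].
    destruct (cross_sign_near G s0 _ _ HG Hs0 C) as [d1 [d10 H1]].
    destruct (crossing_unique_near G s0 _ _ HG Hs0 C) as [d2 [d20 H2]].
    destruct (crossing_isolated _ b pr (Gen s0 Hs0) P) as [d3 [d30 H3]].
    pose proof (Rmin_l d1 (Rmin d2 (d3 / 2))). pose proof (Rmin_r d1 (Rmin d2 (d3 / 2))).
    pose proof (Rmin_l d2 (d3 / 2)). pose proof (Rmin_r d2 (d3 / 2)).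
    exists (Rmin d1 (Rmin d2 (d3 / 2))). split; [repeat apply Rmin_glb_lt; lra|].
    intros l Hl. split; [|split].
    - intros s x y Hs Hsd Hx Hy. apply H1; auto; lra.
    - intros s x y x' y' Hs Hsd Hx Hx' Hy Hy'. apply H2; auto; lra.
    - intros t Ht. apply H3; lra. }
  destruct X as [e [e0 He]].
  set (et := Rmin eta e). assert (et0 : 0 < et) by (apply Rmin_glb_lt; auto).
  assert (et1 : et <= eta) by apply Rmin_l. assert (et2 : et <= e) by apply Rmin_r.
  set (good := fun s pr pr' => crossing_pair (G s) b pr' /\ Rabs (fst pr' - fst pr) < et /\
      Rabs (snd pr' - snd pr) < et /\
      ext_index (G s) (G s (fst pr')) = ext_index (G s0) (G s0 (fst pr))).
  assert (Y : exists d, 0 < d /\ forall pr l, In pr L0 -> 0 < l <= d ->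
    forall s, 0 <= s <= 1 -> Rabs (s - s0) < l -> exists pr', good s pr pr').
  { apply common_radius. intros pr I.
    destruct (crossing_continuation G s0 b pr et HG Gen Hs0 Rb (proj1 (HL pr) I) et0)
      as [d [d0 Hd]].
    exists d; split; auto. intros l Hl s Hs Hsd. apply Hd; auto; lra. }
  destruct Y as [d1 [d10 H1]].
  destruct (double_times_close G s0 b (b + 1) et HG Hs0 et0) as [d2 [d20 H2]].
  pose proof (Rmin_l (Rmin d1 d2) et). pose proof (Rmin_r (Rmin d1 d2) et).
  pose proof (Rmin_l d1 d2). pose proof (Rmin_r d1 d2).
  exists (Rmin (Rmin d1 d2) et). split; [repeat apply Rmin_glb_lt; auto|].
  intros s Hs Hsd.
  set (move := fun pr => epsilon (inhabits (0, 0)) (good s pr)).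
  assert (Hm : forall pr, In pr L0 -> good s pr (move pr)).
  { intros pr I. apply epsilon_spec. apply (H1 pr d1); auto; lra. }
  exists move. split.
  2:{ intros pr I. destruct (Hm pr I) as [_ [A [B C]]]. repeat split; auto; lra. }
  split.
  - apply NoDup_map_NoDup_ForallPairs; auto. intros pr pr' I I' E.
    destruct (Hm pr I) as [_ [A _]]. destruct (Hm pr' I') as [_ [A' _]]. rewrite E in A.
    destruct (He pr et I ltac:(lra)) as [_ [_ Iso]].
    apply HL in I, I'. destruct (Iso (fst pr')) as [Rg|Eq].
    + replace (fst pr' - fst pr) with ((fst (move pr') - fst pr) - (fst (move pr') - fst pr')) by ring.
      unfold Rminus at 1. eapply Rle_lt_trans; [apply Rabs_triang|]. rewrite Rabs_Ropp. lra.
    + elim (crossing_pair_distinct _ _ _ I'). apply Rg. symmetry. apply I'.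
    + apply (crossing_pair_unique (G s0) b); auto. now rewrite Eq.
  - intros pr. rewrite in_map_iff. split; [intros [pr0 [<- I]]; now apply Hm|].
    intros P. pose proof P as [A [B [E C]]].
    pose proof (crossing_pair_distinct _ _ _ P) as N.
    destruct (H2 s (fst pr) (snd pr) Hs ltac:(lra) ltac:(lra) ltac:(lra) E N)
      as [x0 [y0 [X0 [Y0 [E0 [N0 [Cx Cy]]]]]]].
    destruct (crossing_pair_of_times (G s0) b x0 y0 (Gen s0 Hs0) Rb X0 (eq_sym E0) N0)
      as [y1 [S [Ix [Iy PP]]]].
    assert (y1 = y0) as ->.
    { apply same_time_close; auto. apply Rabs_def1; lra. }
    destruct PP as [P0|P0].
    + assert (I0 := proj2 (HL _) P0). exists (x0, y0). split; auto.
      destruct (Hm _ I0) as [P1 [A1 [B1 _]]]. simpl in A1, B1.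
      destruct (He (x0, y0) et I0 ltac:(lra)) as [_ [Uq _]]. simpl in Uq.
      destruct P1 as [_ [_ [E1 _]]].
      destruct (Uq s (fst pr) (snd pr) (fst (move (x0, y0))) (snd (move (x0, y0)))) as [F1 F2];
        auto; try lra.
      rewrite (surjective_pairing (move (x0, y0))), F1, F2. now rewrite <- surjective_pairing.
    (* A nearby pair in the opposite order would give the cross product the wrong sign. *)
    + exfalso. assert (I0 := proj2 (HL _) P0).
      destruct (He (y0, x0) et I0 ltac:(lra)) as [Sg _]. simpl in Sg.
      specialize (Sg s (snd pr) (fst pr) Hs ltac:(lra) Cy Cx).
      assert (cross (vel (G s) (snd pr)) (vel (G s) (fst pr))
        = - cross (vel (G s) (fst pr)) (vel (G s) (snd pr))) by (plane; ring). lra.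
Qed.

(** * Local constancy and finiteness of the invariant *)

Lemma Iq_locally_constant (G : R -> curve) (s0 : R) :
  C1_family G -> (forall s, 0 <= s <= 1 -> generic_immersion (G s)) -> 0 <= s0 <= 1 ->
  exists d, 0 < d /\ forall s, 0 <= s <= 1 -> Rabs (s - s0) < d -> Iq (G s) = Iq (G s0).
Proof.
  intros HG Gen Hs0. pose proof HG as [HC _].
  destruct (exists_regular_time (G s0) (Gen s0 Hs0)) as [b [Hb Rb]].
  destruct (crossing_list_exists (G s0) b (Gen s0 Hs0) Rb) as [L0 HL0].
  assert (X : exists e, 0 < e /\ forall pr l, In pr L0 -> 0 < l <= e ->
    forall s x y ph0 ph, 0 <= s <= 1 -> Rabs (s - s0) < l ->
    Rabs (x - fst pr) < l -> Rabs (y - snd pr) < l ->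
    is_lift (vel (G s0)) ph0 -> is_lift (vel (G s)) ph ->
    turn (G s) ph (x, y) = turn (G s0) ph0 pr).
  { apply common_radius. intros [x0 y0] I. apply HL0 in I as [_ [_ [_ C]]].
    destruct (turn_locally_constant G s0 _ _ HG Hs0 C) as [d [d0 Hd]].
    exists d; split; auto. intros l Hl s x y ph0 ph Hs Hsd Hx Hy. simpl in *.
    apply Hd; auto; lra. }
  destruct X as [e [e0 He]].
  destruct (crossing_list_continuation G s0 b L0 e HG Gen Hs0 Rb HL0 e0) as [d1 [d10 H1]].
  destruct (rotation_locally_constant G s0 b HG Hs0) as [d2 [d20 H2]].
  destruct (ext_index_family G s0 b HG Hs0 Rb) as [d3 [d30 H3]].
  set (d := Rmin (Rmin d1 d2) (Rmin d3 e)).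
  assert (d0 : 0 < d) by (repeat apply Rmin_glb_lt; auto).
  pose proof (Rmin_l (Rmin d1 d2) (Rmin d3 e)). pose proof (Rmin_r (Rmin d1 d2) (Rmin d3 e)).
  pose proof (Rmin_l d1 d2). pose proof (Rmin_r d1 d2).
  pose proof (Rmin_l d3 e). pose proof (Rmin_r d3 e). fold d in H, H0.
  (* The radius was fixed before the coefficient [n], so all coefficients are treated at once. *)
  exists d; split; auto. intros s Hs Hsd. apply functional_extensionality. intros n.
  destruct (H1 s Hs ltac:(lra)) as [move [HL Hm]].
  destruct (H3 s b Hs ltac:(lra)) as [Rsb Esb]; [rewrite Rminus_diag, Rabs_R0; auto|].
  destruct (lift_tangent (G s0) (HC s0 Hs0)) as [ph0 [L0' D0]].
  destruct (lift_tangent (G s) (HC s Hs)) as [ph [L D]].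
  pose proof PI_RGT_0. apply (Rmult_eq_reg_l (2 * PI)); [|lra].
  rewrite (Iq_formula (G s) b n (map move L0) ph); auto.
  rewrite (Iq_formula (G s0) b n L0 ph0); auto.
  rewrite (H2 s ph0 ph Hs ltac:(lra) L0' L), Esb. f_equal.
  rewrite sum_list_map. apply sum_list_ext. intros pr I. destruct (Hm pr I) as [A [B ->]].
  f_equal. rewrite (surjective_pairing (move pr)). apply (He pr e); auto; lra.
Qed.

Lemma qpow_large (v : R) (n : Z) : 2 * Rabs v < IZR (Z.abs n) -> qpow v n = 0.
Proof.
  intros B. unfold qpow. destruct (Req_EM_T (IZR n / 2) v) as [E|]; auto.
  exfalso. rewrite abs_IZR, <- E in B. unfold Rdiv in B.
  rewrite Rabs_mult, (Rabs_pos_eq (/ 2)) in B by lra. lra.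
Qed.

(** The integral in the definition runs over all points of the curve, whereas the formula for [Iq]
    shows only finitely many exponents. *)
Lemma Iq_laurent (g : curve) : generic_immersion g -> is_laurent (Iq g).
Proof.
  intros Gen. assert (H := proj1 Gen).
  destruct (exists_regular_time g Gen) as [b [Hb Rb]].
  destruct (crossing_list_exists g b Gen Rb) as [L HL].
  destruct (lift_tangent g H) as [ph [_ D]].
  (* Exponents count halves, hence the factor 2; the extra 1 covers the shifts by a half in
     [jump]. *)
  assert (B : exists M, forall pr, In pr L -> 2 * Rabs (ext_index g (g (fst pr))) + 1 <= M).
  { clear. induction L as [|pr L [M HM]].
    - exists 0. intros pr [].
    - exists (Rmax (2 * Rabs (ext_index g (g (fst pr))) + 1) M).
      intros q [<-|I]; [apply Rmax_l|]. eapply Rle_trans; [apply HM, I|apply Rmax_r]. }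
  destruct B as [M HM].
  set (K := Rmax (2 * Rabs (ext_index g (g b))) M).
  exists (up K). intros n Hn. destruct (archimed K) as [A _].
  apply IZR_lt in Hn.
  assert (K1 : 2 * Rabs (ext_index g (g b)) <= K) by apply Rmax_l.
  assert (K2 : M <= K) by apply Rmax_r.
  pose proof PI_RGT_0. apply (Rmult_eq_reg_l (2 * PI)); [|lra].
  rewrite (Iq_formula g b n L ph), qpow_large; auto; [|lra].
  rewrite (sum_list_ext _ (fun _ => 0)).
  - assert (Z0 : sum_list (fun _ : R * R => 0) L = 0).
    { clear. unfold sum_list. induction L; simpl; lra. }
    rewrite Z0. ring.
  - intros pr I. specialize (HM pr I). unfold jump. set (e := ext_index g (g (fst pr))) in *.
    rewrite !qpow_large; [ring| |].
    + pose proof (Rabs_triang e (- (1 / 2))) as T. rewrite Rabs_Ropp, (Rabs_pos_eq (1 / 2)) in T by lra.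
      unfold Rminus. lra.
    + pose proof (Rabs_triang e (1 / 2)) as T. rewrite (Rabs_pos_eq (1 / 2)) in T by lra. lra.
Qed.

(** * From the smooth homotopy to a jointly continuous family *)

Lemma continuity_2d_eps (X : R -> R -> R) (s0 t0 eps : R) :
  continuity_2d_pt X s0 t0 -> 0 < eps ->
  exists d, 0 < d /\ forall s t, Rabs (s - s0) < d -> Rabs (t - t0) < d ->
    Rabs (X s t - X s0 t0) < eps.
Proof.
  intros C e0. destruct (C (mkposreal eps e0)) as [d Hd].
  exists d; split; [apply cond_pos|]. intros s t Hs Ht. now apply Hd.
Qed.

Lemma continuous_family_of_components (F : R -> R -> point) (X Y : R -> R -> R) :
  (forall s t, continuity_2d_pt X s t) -> (forall s t, continuity_2d_pt Y s t) ->
  (forall s t, 0 <= s <= 1 -> F s t = (X s t, Y s t)) -> continuous_family F.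
Proof.
  intros CX CY E s0 t0 eps Hs0 e0.
  destruct (continuity_2d_eps X s0 t0 (eps / 2) (CX s0 t0)) as [d1 [d10 H1]]; [lra|].
  destruct (continuity_2d_eps Y s0 t0 (eps / 2) (CY s0 t0)) as [d2 [d20 H2]]; [lra|].
  pose proof (Rmin_l d1 d2). pose proof (Rmin_r d1 d2).
  exists (Rmin d1 d2). split; [apply Rmin_glb_lt; auto|].
  intros s t Hs Hsd Ht. rewrite !E by auto. unfold dist2.
  eapply Rle_lt_trans; [apply norm2_le_sum|]. unfold psub; simpl.
  specialize (H1 s t ltac:(lra) ltac:(lra)). specialize (H2 s t ltac:(lra) ltac:(lra)). lra.
Qed.

(** For [s] in [[0, 1]] the velocity of [G s] is the partial derivative in [t] of the extended maps,
    which is continuous in both variables. *)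
Lemma C1_family_homotopy (G : R -> curve) : generic_regular_homotopy G -> C1_family G.
Proof.
  intros [[X [Y [S E]]] Gen]. split; [|split].
  - intros s Hs. apply (Gen s Hs).
  - apply (continuous_family_of_components _ X Y); auto.
    + intros s t. apply (S 0%nat s t).
    + intros s t. apply (S 0%nat s t).
  - apply (continuous_family_of_components _
      (fun s t => Derive (fun z => X s z) t) (fun s t => Derive (fun z => Y s z) t)).
    + intros s t. apply (S 1%nat s t).
    + intros s t. apply (S 1%nat s t).
    + intros s t Hs. unfold vel. f_equal; apply Derive_ext; intros u; now rewrite E.
Qed.

Theorem theorem2 (G : R -> curve) (hG : generic_regular_homotopy G) :
  is_laurent (Iq (G 0)) /\ is_laurent (Iq (G 1)) /\ Iq (G 0) = Iq (G 1).
Proof.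
  assert (HG := C1_family_homotopy G hG). destruct hG as [_ Gen].
  split; [|split].
  - apply Iq_laurent, Gen; lra.
  - apply Iq_laurent, Gen; lra.
  - symmetry. apply (loc_const (fun s => Iq (G s)) 0 1); [lra|].
    intros s0 Hs0. destruct (Iq_locally_constant G s0 HG Gen Hs0) as [d [d0 Hd]].
    exists d; split; auto.
Qed.
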